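(* Let $\{X_n\}_{n\ge1}$ be an i.i.d. sequence of $\mathbb{R}^N$-valued random variables with a probability density function $\kappa$ (with respect to Lebesgue measure) which has convex and compact support $S$ and satisfies $0<\inf_{x\in S}\kappa(x)\le\sup_{x\in S}\kappa(x)<\infty$. Let $\mathcal{X}_n=\{X_1,\dots,X_n\}$ and let $N_k(\mathcal{X}_n)$ be the number of critical $k$-simplices in the Čech filtration $\{\mathcal{C}_t(\mathcal{X}_n)\}_{t\ge0}$. Then for $k=1,2,\dots,N$, $$\frac{N_k(\mathcal{X}_n)}{n}\to\gamma_{N,k}\quad\text{almost surely as } n\to\infty,$$ where $$\gamma_{N,k}=\frac{1}{(k+1)!}\int_{(\mathbb{R}^N)^k}h_k(\{0,y_1,\dots,y_k\})\,e^{-\omega_N R(\{0,y_1,\dots,y_k\})^N}\,dy_1\cdots dy_k$$ and $\omega_N$ is the volume of the unit ball in $\mathbb{R}^N$.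
   Context: For a finite set $\mathcal{X}\subset\mathbb{R}^N$ and $t\ge0$, the Čech complex is $\mathcal{C}_t(\mathcal{X})=\{\emptyset\neq\sigma\subset\mathcal{X}:\bigcap_{x\in\sigma}\bar B_t(x)\neq\emptyset\}$, where $\bar B_t(x)$ is the closed Euclidean ball of radius $t$ centered at $x$. A $k$-simplex is a subset of cardinality $k+1$. For a set $\alpha$ of $k+1$ points in general position in $\mathbb{R}^N$, let $S(\alpha)$ be the unique $(k-1)$-dimensional sphere containing $\alpha$ (the circumsphere in the affine span of $\alpha$), $C(\alpha)$ its center in $\mathbb{R}^N$, $R(\alpha)$ its radius, $\bar B(\alpha)$ the closed ball in $\mathbb{R}^N$ with center $C(\alpha)$ and radius $R(\alpha)$, and $\mathrm{conv}^\circ(\alpha)$ the open $k$-simplex spanned by $\alpha$. The indicator function $h_k(\alpha)$ equals $1$ if $C(\alpha)\in\mathrm{conv}^\circ(\alpha)$ and $0$ otherwise. A $k$-simplex $\sigma\subset\mathcal{X}$ is critical in $\{\mathcal{C}_t(\mathcal{X})\}_{t\ge0}$ if and only if $h_k(\sigma)=1$ and no point of $\mathcal{X}\setminus\sigma$ lies in $\bar B(\sigma)$ (almost surely the points of $\mathcal{X}_n$ are in general position, so this is well defined). *)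

(* Defs.v *)
From HB Require Import structures.
From mathcomp Require Import all_boot all_order all_algebra finmap.
From mathcomp Require Import all_classical all_reals all_analysis.

Set Implicit Arguments.
Unset Strict Implicit.
Unset Printing Implicit Defensive.

Import Order.TTheory GRing.Theory Num.Theory.
Import numFieldNormedType.Exports.

Local Open Scope classical_set_scope.
Local Open Scope ring_scope.

(* 'rV[T]_n carries the product sigma-algebra, generated by the coordinates;
   for T = R this is the Borel sigma-algebra of R^n. *)
Section measurable_row.
Context {d : measure_display} {T : measurableType d}.
Variable n : nat.

Let coors : 'I_n -> 'rV[T]_n -> T := fun i v => v ord0 i.

Let row_set0 : g_sigma_preimage coors set0.
Proof. exact: sigma_algebra0. Qed.

Let row_setC A : g_sigma_preimage coors A -> g_sigma_preimage coors (~` A).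
Proof. exact: sigma_algebraC. Qed.

Let row_bigcup (F : (set 'rV[T]_n)^nat) :
  (forall i, g_sigma_preimage coors (F i)) ->
  g_sigma_preimage coors (\bigcup_i (F i)).
Proof. exact: sigma_algebra_bigcup. Qed.

HB.instance Definition _ := @isMeasurable.Build (measure_tuple_display d)
  'rV[T]_n (g_sigma_preimage coors) row_set0 row_setC row_bigcup.

Lemma measurable_row_coord (i : 'I_n) :
  measurable_fun [set: 'rV[T]_n] (fun v => v ord0 i).
Proof.
move=> _ Y mY; rewrite setTI; apply: sub_sigma_algebra => /=.
rewrite -bigcup_seq/=; exists i => /=; first by rewrite mem_index_enum.
by exists Y => //; rewrite setTI.
Qed.

End measurable_row.

Lemma measure_sigma_finite_measure d (T : measurableType d) (R : realType)
    (m : {measure set T -> \bar R}) :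
  sigma_finite setT m ->
  {m' : {sigma_finite_measure set T -> \bar R} |
    (m : set T -> \bar R) = m'}.
Proof.
move=> sf.
pose S1 := isSFinite.Build _ _ _ _ (sfinite_measure_sigma_finite sf).
pose S := isSigmaFinite.Build _ _ _ _ sf.
by exists (HB.pack_for (sigma_finite_measure T R) (Measure.sort m) S1 S).
Qed.

Lemma pushforward_sigma_finite_measure d d' (U : measurableType d)
    (V : measurableType d') (R : realType)
    (m : {measure set U -> \bar R}) (f : U -> V) (g : V -> U) :
  sigma_finite setT m ->
  measurable_fun setT f -> measurable_fun setT g -> cancel f g ->
  {m' : {sigma_finite_measure set V -> \bar R} | pushforward m f = m'}.
Proof.
move=> sfm mf mg fK.
have sf : sigma_finite setT (pushforward m f).
  have [F FT Foo] := sfm; exists (fun i => g @^-1` F i); first by rewrite -preimage_bigcup -FT.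
  move=> i; have [mF Fi] := Foo i; split.
    by rewrite -[X in measurable X]setTI; exact: mg.
  rewrite /pushforward (_ : _ @^-1` _ = F i)//.
  by apply/seteqP; split => x /=; rewrite fK.
exact: (measure_sigma_finite_measure (m :=
  measure_function_pushforward__canonical__measure_function_Measure m mf) sf).
Qed.

Section power_measure.
Local Open Scope ereal_scope.
Context {d : measure_display} {T : measurableType d} {R : realType}.

Definition cons_pair n (p : T * n.-tuple T) : n.+1.-tuple T :=
  [tuple of p.1 :: p.2].

(* the n-fold product measure mu \x ... \x mu *)
Fixpoint power_measure (mu : set T -> \bar R) (n : nat) :
    set (n.-tuple T) -> \bar R :=
  match n with
  | 0 => \d_ [tuple]
  | n'.+1 => pushforward (mu \x @power_measure mu n') (@cons_pair n')
  end.

Arguments power_measure : clear implicits.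


Let mu_sigma_finite_measure (mu : {sigma_finite_measure set T -> \bar R}) n :
  {m : {sigma_finite_measure set (n.-tuple T) -> \bar R} |
    power_measure mu n = m}.
Proof.
elim: n => [|n [m mE]] /=; first by exists (\d_ [tuple]).
rewrite mE.
pose g (t : n.+1.-tuple T) : T * n.-tuple T := (thead t, [tuple of behead t]).
apply: (@pushforward_sigma_finite_measure _ _ _ _ _ (mu \x m) _ g).
- have /sigma_finiteP[F [TF ndF Foo]] := sigma_finiteT mu.
  have /sigma_finiteP[G [TG ndG Goo]] := sigma_finiteT m.
  exists (fun n => F n `*` G n).
    rewrite -setXTT TF TG predeqE => -[x y]; split.
      move=> [/= [i _ Fix] [k _ Gky]]; exists (maxn i k) => //; split.
      - by move: x Fix; exact/subsetPset/ndF/leq_maxl.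
      - by move: y Gky; exact/subsetPset/ndG/leq_maxr.
    by move=> [i _ []/= ? ?]; split; exists i.
  move=> k; have [? ?] := Foo k; have [? ?] := Goo k.
  split; first exact: measurableX.
  by rewrite /= product_measure1E// lte_mul_pinfty// ge0_fin_numE.
- exact: measurable_cons.
- by apply: measurable_fun_pair; [exact: measurable_tnth|exact: measurable_behead].
- by case=> x t; rewrite /g theadE; congr (_, _); exact/val_inj.
Qed.

Variables (mu : {sigma_finite_measure set T -> \bar R}) (n : nat).

Let power0 : power_measure mu n set0 = 0.
Proof. by have [m ->] := mu_sigma_finite_measure mu n; exact: measure0. Qed.

Let power_ge0 A : 0 <= power_measure mu n A.
Proof. by have [m ->] := mu_sigma_finite_measure mu n; exact: measure_ge0. Qed.

Let power_sigma_additive : semi_sigma_additive (power_measure mu n).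
Proof.
have [m ->] := mu_sigma_finite_measure mu n.
exact: measure_semi_sigma_additive.
Qed.

HB.instance Definition _ := isMeasure.Build _ _ _ (power_measure mu n)
  power0 power_ge0 power_sigma_additive.

Let power_sigma_finite : sigma_finite setT (power_measure mu n).
Proof.
by have [m ->] := mu_sigma_finite_measure mu n; exact: sigma_finiteT.
Qed.

HB.instance Definition _ := Measure_isSigmaFinite.Build _ _ _
  (power_measure mu n) power_sigma_finite.

End power_measure.
Arguments power_measure {d T R} mu n.

Section lebesgue_row.
Context {R : realType}.
Variable n : nat.

Definition row_of_tuple (t : n.-tuple R) : 'rV[R]_n := \row_i tnth t i.

Definition lebesgue_row : set 'rV[R]_n -> \bar R :=
  pushforward (power_measure lebesgue_measure n) row_of_tuple.

Let lebesgue_row_sigma_finite_measure :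
  {m : {sigma_finite_measure set 'rV[R]_n -> \bar R} | lebesgue_row = m}.
Proof.
pose g (v : 'rV[R]_n) : n.-tuple (measurableTypeR R) :=
  [tuple v ord0 i | i < n].
pose m : {sigma_finite_measure set (n.-tuple (measurableTypeR R)) -> \bar R} :=
  power_measure lebesgue_measure n.
apply: (@pushforward_sigma_finite_measure _ _ _ _ _ m row_of_tuple g).
- exact: sigma_finiteT.
- move=> _ A mA; rewrite setTI.
  have : preimage_set_system setT row_of_tuple measurable (row_of_tuple @^-1` A).
    by exists A => //; rewrite setTI.
  rewrite /measurable/= -g_sigma_preimage_comp.
  rewrite (_ : (fun i => _ \o _) = fun i (t : n.-tuple R) => tnth t i)//.
  by apply/funext => i; apply/funext => t /=; rewrite mxE.
- apply/measurable_fun_tnthP => i.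
  rewrite (_ : _ \o g = fun v : 'rV[R]_n => v ord0 i).
    exact: measurable_row_coord.
  by apply/funext => v /=; rewrite tnth_mktuple.
- by move=> t; apply: eq_from_tnth => i; rewrite tnth_mktuple mxE.
Qed.

Let lebesgue_row0 : lebesgue_row set0 = 0%E.
Proof. by have [m ->] := lebesgue_row_sigma_finite_measure; exact: measure0. Qed.

Let lebesgue_row_ge0 A : (0 <= lebesgue_row A)%E.
Proof. by have [m ->] := lebesgue_row_sigma_finite_measure; exact: measure_ge0. Qed.

Let lebesgue_row_sigma_additive : semi_sigma_additive lebesgue_row.
Proof.
have [m ->] := lebesgue_row_sigma_finite_measure.
exact: measure_semi_sigma_additive.
Qed.

HB.instance Definition _ := isMeasure.Build _ _ _ lebesgue_row
  lebesgue_row0 lebesgue_row_ge0 lebesgue_row_sigma_additive.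

Let lebesgue_row_sigma_finite : sigma_finite setT lebesgue_row.
Proof.
by have [m ->] := lebesgue_row_sigma_finite_measure; exact: sigma_finiteT.
Qed.

HB.instance Definition _ := Measure_isSigmaFinite.Build _ _ _
  lebesgue_row lebesgue_row_sigma_finite.

End lebesgue_row.
Arguments lebesgue_row {R} n.

Section geometry.
Context {R : realType} {N : nat}.
Implicit Types (alpha sigma X : {fset 'rV[R]_N}) (c x y : 'rV[R]_N).

(* The canonical norm of 'rV[R]_N is the sup norm; it induces the usual
   topology, but balls have to be taken for the Euclidean norm. *)
Definition enorm x : R := Num.sqrt (\sum_(i < N) x ord0 i ^+ 2).

Definition closed_eball c (r : R) : set 'rV[R]_N :=
  [set y | enorm (y - c) <= r].

Definition affine_span alpha : set 'rV[R]_N :=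
  [set y | exists2 a : 'rV[R]_N -> R,
    \sum_(x <- alpha) a x = 1 & y = \sum_(x <- alpha) a x *: x].

Definition open_simplex alpha : set 'rV[R]_N :=
  [set y | exists a : 'rV[R]_N -> R,
    [/\ {in alpha, forall x, 0 < a x}, \sum_(x <- alpha) a x = 1 &
        y = \sum_(x <- alpha) a x *: x]].

Definition affinely_independent alpha : Prop :=
  forall a : 'rV[R]_N -> R, \sum_(x <- alpha) a x = 0 ->
    \sum_(x <- alpha) a x *: x = 0 -> {in alpha, forall x, a x = 0}.

(* the sphere of the affine span of alpha with center s.1 and radius s.2
   contains alpha *)
Definition is_circumsphere alpha (s : 'rV[R]_N * R) : Prop :=
  affine_span alpha s.1 /\ {in alpha, forall x, enorm (x - s.1) = s.2}.

(* For alpha nonempty and affinely independent there is exactly one such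
   sphere; the value is (0, 0) if there is none. *)
Definition circumsphere alpha : 'rV[R]_N * R :=
  xget (0, 0) (is_circumsphere alpha).

Definition circumcenter alpha : 'rV[R]_N := (circumsphere alpha).1.
Definition circumradius alpha : R := (circumsphere alpha).2.

Definition circumball alpha : set 'rV[R]_N :=
  closed_eball (circumcenter alpha) (circumradius alpha).

(* The value is 0 by convention unless alpha consists of k+1 points in general
   position; such alpha matter only on Lebesgue-null sets of configurations. *)
Definition center_indicator (k : nat) alpha : bool :=
  `[< [/\ #|` alpha| = k.+1, affinely_independent alpha &
          open_simplex alpha (circumcenter alpha)] >].

Definition cech_complex (t : R) X : set {fset 'rV[R]_N} :=
  [set sigma | [/\ sigma != fset0, (sigma `<=` X)%fset &
    \bigcap_(x in [set` sigma]) closed_eball x t !=set0]].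

Definition critical_simplex (k : nat) X sigma : Prop :=
  [/\ exists2 t : R, 0 <= t & cech_complex t X sigma,
      #|` sigma| = k.+1,
      center_indicator k sigma &
      {in (X `\` sigma)%fset, forall x, ~ circumball sigma x}].

Definition num_critical (k : nat) X : nat :=
  #|` [fset sigma in fpowerset X | `[< critical_simplex k X sigma >]]%fset|.

End geometry.

Section limit_constant.
Context {R : realType}.

Definition unit_ball_volume (N : nat) : R :=
  fine (lebesgue_row N (closed_eball 0 1)).

Definition simplex_at0 (N : nat) (ys : seq 'rV[R]_N) : {fset 'rV[R]_N} :=
  (0%R |` [fset y in ys])%fset.

Definition gamma_const (N k : nat) : \bar R :=
  (((k.+1)`!%:R^-1)%:E *
  \int[power_measure (lebesgue_row N) k]_y
    ((center_indicator k (simplex_at0 y))%:R *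
     expR (- unit_ball_volume N * circumradius (simplex_at0 y) ^+ N))%:E)%E.

End limit_constant.

Section random_points.
Context {d : measure_display} {T : measurableType d} {R : realType}.
Context {N : nat} (P : probability T R).

Definition mutually_independent (X : nat -> {RV P >-> 'rV[R]_N}) : Prop :=
  forall (J : {fset nat}) (A : nat -> set 'rV[R]_N),
    (forall i, measurable (A i)) ->
    P (\bigcap_(i in [set` J]) X i @^-1` A i) =
    (\prod_(i <- J) P (X i @^-1` A i))%E.

Definition has_density (X : {RV P >-> 'rV[R]_N}) (kappa : 'rV[R]_N -> R) :
    Prop :=
  [/\ measurable_fun setT kappa, forall x, 0 <= kappa x &
      forall A, measurable A ->
        distribution P X A = (\int[lebesgue_row N]_(x in A) (kappa x)%:E)%E].

(* the first n terms of the sequence; X 0 plays the role of X_1 *)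
Definition sample (X : nat -> {RV P >-> 'rV[R]_N}) (n : nat) (w : T) :
    {fset 'rV[R]_N} :=
  [fset X i w | i in iota 0 n]%fset.

End random_points.

Definition fun_support {R : realType} {N : nat} (f : 'rV[R]_N -> R) :
    set 'rV[R]_N :=
  closure [set x | f x != 0].

(* Main.v *)
Require Import Defs.
From HB Require Import structures.
From mathcomp Require Import all_boot all_order all_algebra finmap.
From mathcomp Require Import all_classical all_reals all_analysis.
From mathcomp Require Import measurable_realfun.
From mathcomp Require Import ring lra zify.
Set Implicit Arguments.
Unset Strict Implicit.
Unset Printing Implicit Defensive.
Import Order.TTheory GRing.Theory Num.Theory.
Import numFieldNormedType.Exports.
Local Open Scope classical_set_scope.
Local Open Scope ring_scope.

(** Criticality of a simplex is a local feature: the simplex has to contain its circumcenter,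
and its circumball has to contain no other point. With [n] points it therefore lives at the scale
[n^(-1/N)], where the sample looks like a Poisson process whose intensity is the density at a
given point. The proof makes this precise for the mean and then shows that the count is close to
its mean.

Mean. The expected number of critical simplices is the number of sets of [k+1] indices times the
expectation of [(1 - u)^(n-k-1)] over simplices containing their circumcenter, [u] being the mass
of the circumball. Put [x_i = x + e y_i] for the vertices other than the first one [x], with
[e^N = 1/n]. As [e] tends to 0 the density at [x + e y_i] can be replaced by [kappa x], since
translations are continuous in L1 ([translation_continuous_bounded]), and [(1 - u)^n] by an
exponential ([binomial_poisson]); no continuity of the density is involved. The domination comes
from convexity: the center of a simplex containing it lies in the convex support, so that its
circumball of radius [r] has mass at least a constant times [r^N] ([mu_eball_ge]). In the limit a
dilation of the [y_i] by [kappa x ^ (1/N)] removes the density altogether ([limit_integral]), which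
is why the constant only depends on [N] and [k]. The result is [expected_weight_cvg].

Concentration. Only circumradii somewhat larger than the typical scale matter: larger circumballs
are empty with exponentially small probability ([expectation_large]). Among the smaller ones, two
simplices whose circumballs are apart are almost negatively correlated, and two others have all
their vertices in a small ball, which is rare ([expectation_pair]). This bounds the variance of
the count ([count_variance]), but only well enough for almost sure convergence along a
polynomially growing sequence of sample sizes ([summable_ae_cvg0], [small_lln]).

Between two such sizes the count is not monotone: a new point creates simplices and destroys
others. However the vertices and the points that have to avoid the circumball may be taken from
different samples. Vertices from the smaller and obstacles from the larger of two consecutive
samples give a lower bound for all sizes in between, and the converse choice an upper bound
([num_critical_bounds]). As consecutive sizes are asymptotically equal, all these counts have the
same limit, and [interpolation_cvg] concludes.

The geometry is expressed by the Gram matrix of the edges out of one vertex: affine independence,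
the circumcenter and its position become rational conditions on the vertices
([center_indicatorP]), hence measurable, and their equivariance under homotheties is a matter of
uniqueness for a linear system. *)

(** * Integrals against product measures *)

Section measurability.
Context {d : measure_display} {T : measurableType d} {R : realType}.

Lemma measurable_bool_set (b : T -> bool) : measurable_fun setT b -> measurable [set x | b x].
Proof. by move=> mb; have := mb measurableT [set true] I; rewrite setTI. Qed.

Lemma measurable_bool_natr (b : T -> bool) : measurable_fun setT b ->
  measurable_fun setT (fun x => (b x)%:R : R).
Proof.
move=> mb; rewrite (_ : (fun x => _) = fun x => if b x then 1%R else 0%R : R).
  exact: measurable_fun_ifT.
by apply/funext => x; case: (b x).
Qed.

Lemma measurable_le_set (f : T -> R) r : measurable_fun setT f -> measurable [set x | f x <= r].
Proof. by move=> mf; apply: measurable_bool_set; exact: measurable_fun_ler. Qed.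

Lemma measurable_forall_set (J : finType) (A : J -> set T) : (forall i, measurable (A i)) ->
  measurable [set x | forall i, A i x].
Proof.
move=> mA; rewrite (_ : mkset _ = \bigcap_(i in [set: J]) A i); first exact: fin_bigcap_measurable.
by apply/seteqP; split => x h i; [move=> _|]; exact: h.
Qed.

Lemma measurable_section_mass {d' : measure_display} {V : measurableType d'}
    (mu : probability V R) (D : T -> set V) :
  measurable [set p : T * V | D p.1 p.2] -> measurable_fun setT (fun x => fine (mu (D x))).
Proof.
move=> mD; apply: measurableT_comp => //.
have := measurable_fun_xsection mu mD.
by rewrite (_ : _ \o _ = fun x => mu (D x)) //; apply/funext => x; rewrite /= xsectionE.
Qed.

Lemma integral_cst_probability (P : probability T R) (c : R) : (\int[P]_x c%:E = c%:E)%E.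
Proof.
have -> : (\int[P]_x c%:E = c%:E * P setT)%E by exact: integral_cst.
by rewrite probability_setT mule1.
Qed.

End measurability.

Section power_integral.
Local Open Scope ereal_scope.
Context {d : measure_display} {T : measurableType d} {R : realType}.
Implicit Types (mu : {sigma_finite_measure set T -> \bar R}).

Lemma measurable_cons_pair n : measurable_fun setT (@cons_pair d T n).
Proof. exact: measurable_cons measurable_fst measurable_snd. Qed.

Lemma ge0_integral_power_measure0 mu (f : 0.-tuple T -> \bar R) :
  measurable_fun [set: 0.-tuple T] f ->
  \int[power_measure mu 0]_t f t = f [tuple].
Proof. by move=> mf; rewrite integral_dirac// diracT mul1e. Qed.

Lemma measurable_fun_consl n (f : n.+1.-tuple T -> \bar R) x :
  measurable_fun [set: n.+1.-tuple T] f ->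
  measurable_fun [set: n.-tuple T] (fun t : n.-tuple T => f [tuple of x :: t]).
Proof.
move=> mf; apply: (measurableT_comp mf).
exact: (@measurable_cons _ _ _ _ (fun=> x)).
Qed.

Lemma measurable_fun_power_integral mu n (f : n.+1.-tuple T -> \bar R) :
  measurable_fun [set: n.+1.-tuple T] f -> (forall t, 0 <= f t) ->
  measurable_fun setT (fun x => \int[power_measure mu n]_t f [tuple of x :: t]).
Proof.
move=> mf f0.
apply: (measurable_fun_fubini_tonelli_F (m2 := power_measure mu n)
  (f \o @cons_pair d T n)) => [|x /=]; last exact: f0.
exact: (measurableT_comp mf (@measurable_cons_pair n)).
Qed.

Lemma ge0_integral_power_measureS mu n (f : n.+1.-tuple T -> \bar R) :
  measurable_fun [set: n.+1.-tuple T] f -> (forall t, 0 <= f t) ->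
  \int[power_measure mu n.+1]_t f t =
  \int[mu]_x \int[power_measure mu n]_t f [tuple of x :: t].
Proof.
move=> mf f0.
rewrite (ge0_integral_pushforward (@measurable_cons_pair n)
   (mu \x power_measure mu n))//.
rewrite preimage_setT.
rewrite fubini_tonelli1//; last by move=> x /=; exact: f0.
exact: (measurableT_comp mf (@measurable_cons_pair n)).
Qed.

(** Tonelli, one coordinate at a time. The map may depend on the coordinate, as it does
for a translation of [R^n] seen as an [n]-fold product. *)
Lemma power_measure_change_of_variables mu n (phi : 'I_n -> T -> T) (c : R)
    (f : n.-tuple T -> \bar R) :
  (0 <= c)%R ->
  (forall i, measurable_fun setT (phi i)) ->
  (forall i (g : T -> \bar R), measurable_fun setT g -> (forall x, 0 <= g x) ->
    c%:E * \int[mu]_x g (phi i x) = \int[mu]_x g x) ->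
  measurable_fun [set: n.-tuple T] f -> (forall t, 0 <= f t) ->
  (c ^+ n)%:E * \int[power_measure mu n]_t f [tuple phi i (tnth t i) | i < n] =
  \int[power_measure mu n]_t f t.
Proof.
move=> c0; elim: n phi f => [|n IH] phi f mphi phiE mf f0.
  rewrite expr0 mul1e; apply: eq_integral => t _; congr f.
  by rewrite (tuple0 t) (tuple0 [tuple _ | _ < _]).
have mphit m (psi : 'I_m -> T -> T) : (forall i, measurable_fun setT (psi i)) ->
    measurable_fun [set: m.-tuple T] (fun t : m.-tuple T => [tuple psi i (tnth t i) | i < m]).
  move=> mpsi; apply/measurable_fun_tnthP => i.
  rewrite (_ : _ \o _ = psi i \o (fun t : m.-tuple T => tnth t i)).
    by apply: measurableT_comp => //; exact: measurable_tnth.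
  by apply/funext => t /=; rewrite tnth_mktuple.
pose psi i := phi (lift ord0 i).
have consE x (t : n.-tuple T) :
  [tuple phi i (tnth [tuple of x :: t] i) | i < n.+1] =
  [tuple of phi ord0 x :: [tuple psi i (tnth t i) | i < n]].
  apply: eq_from_tnth => i; rewrite tnth_mktuple.
  by case: (unliftP ord0 i) => [j|] ->; rewrite ?tnthS ?tnth_mktuple// !tnth0.
rewrite (@ge0_integral_power_measureS _ _ (fun t => f _))//; last first.
  exact: (measurableT_comp mf (mphit _ _ mphi)).
under eq_integral do under eq_integral do rewrite consE.
rewrite [RHS]ge0_integral_power_measureS//.
transitivity (c%:E * \int[mu]_x
   \int[power_measure mu n]_t f [tuple of phi ord0 x :: t]); last first.
  apply: (phiE ord0 (fun x => \int[power_measure mu n]_t f [tuple of x :: t])).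
    exact: measurable_fun_power_integral.
  by move=> x; exact: integral_ge0.
rewrite exprS EFinM -muleA; congr (_ * _).
rewrite -ge0_integralZl//; last 3 first.
- apply: (measurable_fun_fubini_tonelli_F (m2 := power_measure mu n)
    (f \o (fun p : T * n.-tuple T =>
       [tuple of phi ord0 p.1 :: [tuple psi i (tnth p.2 i) | i < n]])))
    => [|x /=]; last exact: f0.
  apply: (measurableT_comp mf); apply: measurable_cons.
    exact: (measurableT_comp (mphi ord0) measurable_fst).
  apply: (measurableT_comp (mphit n psi _) measurable_snd) => i.
  exact: mphi.
- by move=> x _; exact: integral_ge0.
- by rewrite lee_fin exprn_ge0.
apply: eq_integral => x _.
apply: (IH psi (fun t => f [tuple of phi ord0 x :: t])) => //.
- by move=> i; exact: mphi.
- by move=> i; exact: phiE.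
- exact: measurable_fun_consl.
Qed.

(** Passes from integrals over independent points with density [g] to integrals against
products of the reference measure, where changes of variables are available. *)
Lemma power_measure_density mu (la : {sigma_finite_measure set T -> \bar R})
    (g : T -> R) n (f : n.-tuple T -> \bar R) :
  measurable_fun setT g -> (forall x, 0 <= g x)%R ->
  (forall h : T -> \bar R, measurable_fun setT h -> (forall x, 0 <= h x) ->
    \int[mu]_x h x = \int[la]_x ((g x)%:E * h x)) ->
  measurable_fun [set: n.-tuple T] f -> (forall t, 0 <= f t) ->
  \int[power_measure mu n]_t f t =
  \int[power_measure la n]_t ((\prod_(i < n) g (tnth t i))%:E * f t).
Proof.
move=> mg g0 gE; elim: n f => [|n IH] f mf f0.
  rewrite !ge0_integral_power_measure0 ?big_ord0 ?mul1e//.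
  by under eq_fun do rewrite big_ord0 mul1e.
have mprod m : measurable_fun [set: m.-tuple T] (fun t : m.-tuple T => \prod_(i < m) g (tnth t i))%R.
  apply: measurable_prod => i _.
  by apply: measurableT_comp => //; exact: measurable_tnth.
have prod0 m (t : m.-tuple T) : 0 <= (\prod_(i < m) g (tnth t i))%:E.
  by rewrite lee_fin prodr_ge0.
rewrite !ge0_integral_power_measureS//; last 2 first.
- by apply: emeasurable_funM => //; apply/measurable_EFinP; exact: mprod.
- by move=> t; rewrite mule_ge0.
rewrite gE; last 2 first.
- exact: measurable_fun_power_integral.
- by move=> x; exact: integral_ge0.
apply: eq_integral => x _.
rewrite IH//; last exact: measurable_fun_consl.
rewrite -ge0_integralZl//; last 3 first.
- apply: emeasurable_funM => //; first by apply/measurable_EFinP; exact: mprod.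
  exact: measurable_fun_consl.
- by move=> t _; rewrite mule_ge0.
- by rewrite lee_fin.
apply: eq_integral => t _.
rewrite big_ord_recl tnth0 EFinM -muleA; congr (_ * (_ * _)); congr EFin.
by apply: eq_bigr => i _; rewrite tnthS.
Qed.

Lemma power_measure_prod mu n (F : 'I_n -> T -> \bar R) :
  (forall i, measurable_fun setT (F i)) -> (forall i x, 0 <= F i x) ->
  \int[power_measure mu n]_t (\prod_(i < n) F i (tnth t i)) =
  \prod_(i < n) \int[mu]_x F i x.
Proof.
have mprod m (G : 'I_m -> T -> \bar R) : (forall i, measurable_fun setT (G i)) ->
   measurable_fun [set: m.-tuple T] (fun t : m.-tuple T => \prod_(i < m) G i (tnth t i)).
  move=> mG; elim: (index_enum _) => [|i s IHs].
    under eq_fun do rewrite big_nil. exact: measurable_cst.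
  under eq_fun do rewrite big_cons.
  apply: emeasurable_funM => //; apply: measurableT_comp => //.
  exact: measurable_tnth.
elim: n F => [|n IH] F mF F0.
  by rewrite ge0_integral_power_measure0 ?big_ord0//; exact: mprod.
rewrite ge0_integral_power_measureS//; [|exact: mprod|by move=> t; exact: prode_ge0].
under eq_integral => x _.
  under eq_integral => t _.
    rewrite big_ord_recl tnth0.
    under eq_bigr do rewrite tnthS.
    over.
  rewrite ge0_integralZl//; last 2 first.
  - by apply: (mprod n (fun i => F (lift ord0 i))) => i; exact: mF.
  - by move=> t _; apply: prode_ge0.
  rewrite (IH (fun i => F (lift ord0 i)))//.
  over.
rewrite big_ord_recl ge0_integralZr//.
by apply: prode_ge0 => i _; exact: integral_ge0.
Qed.

Lemma power_measure_box mu n (A : 'I_n -> set T) :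
  (forall i, measurable (A i)) ->
  power_measure mu n [set t | forall i, A i (tnth t i)] = \prod_(i < n) mu (A i).
Proof.
move=> mA; pose B := [set t : n.-tuple T | forall i, A i (tnth t i)].
have mB : measurable B.
  apply: measurable_forall_set => i; rewrite -[X in measurable X]setTI.
  exact: measurable_tnth.
transitivity (\int[power_measure mu n]_t (\1_B t)%:E); first by rewrite integral_indic// setIT.
rewrite -(@eq_bigr _ _ _ _ _ _ (fun i => \int[mu]_x (\1_(A i) x)%:E)); last first.
  by move=> i _; rewrite integral_indic// setIT.
rewrite -power_measure_prod; last 2 first.
- by move=> i; apply/measurable_EFinP.
- by move=> i x; rewrite lee_fin.
apply: eq_integral => t _.
rewrite indicE; have [tB|/existsNP[i Ai]] := pselect (B t).
  by rewrite mem_set// big1// => i _; rewrite indicE mem_set.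
rewrite memNset; last by move=> /(_ i).
by rewrite (bigD1 i)//= indicE memNset ?mul0e.
Qed.

Lemma measurable_cat_pair m n :
  measurable_fun [set: m.-tuple T * n.-tuple T]
    (fun p : m.-tuple T * n.-tuple T => [tuple of p.1 ++ p.2]).
Proof.
apply/measurable_fun_tnthP => i; case: (split_ordP i) => j ->.
- rewrite (_ : _ \o _ = (fun t : m.-tuple T => tnth t j) \o fst).
    exact: (measurableT_comp (measurable_tnth _) measurable_fst).
  by apply/funext => p /=; rewrite tnth_lshift.
- rewrite (_ : _ \o _ = (fun t : n.-tuple T => tnth t j) \o snd).
    exact: (measurableT_comp (measurable_tnth _) measurable_snd).
  by apply/funext => p /=; rewrite tnth_rshift.
Qed.

(** Splits independent points into two blocks, the second being integrated first. *)
Lemma power_measure_cat mu m n (f : (m + n).-tuple T -> \bar R) :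
  measurable_fun [set: (m + n).-tuple T] f -> (forall t, 0 <= f t) ->
  \int[power_measure mu (m + n)]_t f t =
  \int[power_measure mu m]_u \int[power_measure mu n]_v f [tuple of u ++ v].
Proof.
have mcat m' n' (h : (m' + n').-tuple T -> \bar R) :
    measurable_fun [set: (m' + n').-tuple T] h -> (forall t, 0 <= h t) ->
    measurable_fun [set: m'.-tuple T]
      (fun u => \int[power_measure mu n']_v h [tuple of u ++ v]).
  move=> mh h0.
  apply: (measurable_fun_fubini_tonelli_F (m2 := power_measure mu n')
    (h \o (fun p : m'.-tuple T * n'.-tuple T => [tuple of p.1 ++ p.2])))
    => [|x /=]; last exact: h0.
  exact: (measurableT_comp mh (@measurable_cat_pair _ _)).
elim: m f => [|m IH] f mf f0.
  rewrite ge0_integral_power_measure0; last exact: (mcat 0%N n f mf f0).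
  by apply: eq_integral => t _; congr f; exact/val_inj.
rewrite (@ge0_integral_power_measureS mu (m + n) f)//.
rewrite ge0_integral_power_measureS//; last 2 first.
- exact: mcat.
- by move=> t; exact: integral_ge0.
apply: eq_integral => x _.
rewrite IH//; last exact: (@measurable_fun_consl (m + n) f x mf).
apply: eq_integral => u _; apply: eq_integral => v _; congr f; exact/val_inj.
Qed.

(** By uniqueness of densities, [g] coincides almost everywhere with the Radon-Nikodym
derivative of [nu]. *)
Lemma ge0_integral_density (nu : {finite_measure set T -> \bar R})
    (la : {sigma_finite_measure set T -> \bar R}) (g : T -> R) :
  measurable_fun setT g -> (forall x, 0 <= g x)%R ->
  (forall A, measurable A -> nu A = \int[la]_(x in A) (g x)%:E) ->
  forall h : T -> \bar R, measurable_fun setT h -> (forall x, 0 <= h x) ->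
    \int[nu]_x h x = \int[la]_x ((g x)%:E * h x).
Proof.
move=> mg g0 nuE h mh h0.
have ac : nu `<< la.
  apply/null_content_dominatesP => A mA A0.
  rewrite nuE//; apply: null_set_integral => //.
  by apply/measurable_EFinP; exact: measurable_funTS.
rewrite -(Radon_Nikodym_SigmaFinite.change_of_variables ac)//.
have intg : la.-integrable setT (EFin \o g).
  apply/integrableP; split; first exact/measurable_EFinP.
  under eq_integral do rewrite /= ger0_norm//.
  by rewrite -nuE// -ge0_fin_numE ?fin_num_measure.
have aeE : ae_eq la setT (Radon_Nikodym_SigmaFinite.f nu la) (EFin \o g).
  apply: integral_ae_eq => //.
  - exact: Radon_Nikodym_SigmaFinite.f_integrable.
  - exact/measurable_EFinP.
  - move=> A _ mA; rewrite -Radon_Nikodym_SigmaFinite.f_integral//.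
    exact: nuE.
apply: ae_eq_integral => //.
- apply: emeasurable_funM => //.
  exact: (measurable_int la (Radon_Nikodym_SigmaFinite.f_integrable ac)).
- by apply: emeasurable_funM => //; exact/measurable_EFinP.
- by apply: filterS aeE => x /(_ I) + _ => ->; rewrite muleC.
Qed.

End power_integral.

(** * Lebesgue measure and Euclidean balls *)

Section row_measurability.
Context {R : realType}.

Lemma measurable_fun_rowP {d : measure_display} {T : measurableType d} n
    (f : T -> 'rV[R]_n) :
  (forall i, measurable_fun setT (fun x => f x ord0 i)) ->
  measurable_fun setT f.
Proof.
move=> mf.
suff h : g_sigma_preimage (fun i => (fun v : 'rV[R]_n => v ord0 i) \o f) `<=` measurable.
  move=> _ A mA; rewrite setTI; apply: h; rewrite g_sigma_preimage_comp.
  by exists A => //; rewrite setTI.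
apply: smallest_sub; first exact: sigma_algebra_measurable.
move=> A; rewrite -bigcup_seq/= => -[i _] [B mB <-].
exact: mf.
Qed.

Context {d : measure_display} {T : measurableType d} {n : nat}.
Implicit Types f g : T -> 'rV[R]_n.

Lemma measurable_fun_coord f i :
  measurable_fun setT f -> measurable_fun setT (fun x => f x ord0 i).
Proof. by move=> mf; apply: (measurableT_comp (measurable_row_coord i)). Qed.

Lemma measurable_rowD f g : measurable_fun setT f -> measurable_fun setT g ->
  measurable_fun setT (fun x => f x + g x).
Proof.
move=> mf mg; apply: measurable_fun_rowP => i.
by under eq_fun do rewrite mxE; apply: measurable_funD; exact: measurable_fun_coord.
Qed.

Lemma measurable_rowZ (a : T -> R) f : measurable_fun setT a ->
  measurable_fun setT f -> measurable_fun setT (fun x => a x *: f x).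
Proof.
move=> ma mf; apply: measurable_fun_rowP => i.
by under eq_fun do rewrite mxE; apply: measurable_funM => //; exact: measurable_fun_coord.
Qed.

Lemma measurable_rowB f g : measurable_fun setT f -> measurable_fun setT g ->
  measurable_fun setT (fun x => f x - g x).
Proof.
move=> mf mg; apply: measurable_fun_rowP => i.
by under eq_fun do rewrite !mxE; apply: measurable_funB; exact: measurable_fun_coord.
Qed.

Lemma measurable_enorm f :
  measurable_fun setT f -> measurable_fun setT (fun x => enorm (f x)).
Proof.
move=> mf; rewrite /enorm.
apply: measurableT_comp.
  by apply: continuous_measurable_fun; exact: sqrt_continuous.
apply: measurable_sum => i; apply: measurable_funX; exact: measurable_fun_coord.
Qed.

End row_measurability.

Section lebesgue_row_integral.
Context {R : realType}.
Local Open Scope ereal_scope.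

Lemma measurable_row_of_tuple n :
  measurable_fun [set: n.-tuple (measurableTypeR R)] (@row_of_tuple R n).
Proof.
apply: measurable_fun_rowP => i; rewrite /row_of_tuple.
by under eq_fun do rewrite mxE; exact: measurable_tnth.
Qed.

Lemma ge0_integral_lebesgue_row n (f : 'rV[R]_n -> \bar R) :
  measurable_fun setT f -> (forall v, 0 <= f v) ->
  \int[lebesgue_row n]_v f v =
  \int[power_measure (@lebesgue_measure R) n]_t f (row_of_tuple t).
Proof.
move=> mf f0.
by rewrite (ge0_integral_pushforward (@measurable_row_of_tuple n)
  (power_measure (@lebesgue_measure R) n)).
Qed.

(** The left-hand side integrates against a measure that gives half-open intervals their
length, hence against Lebesgue measure. *)
Lemma lebesgue_measure_affine (z s : R) (f : measurableTypeR R -> \bar R) :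
  (0 < s)%R ->
  measurable_fun setT f -> (forall v, 0 <= f v) ->
  s%:E * \int[lebesgue_measure]_x f (z + s * x)%R =
  \int[@lebesgue_measure R]_x f x.
Proof.
move=> s0 mf f0.
pose phi (x : measurableTypeR R) : measurableTypeR R := (z + s * x)%R.
have mphi : measurable_fun setT phi.
  by apply: measurable_funD => //; exact: measurable_funM.
pose m := measure_function_pushforward__canonical__measure_function_Measure
  (@lebesgue_measure R) mphi.
pose s' := NngNum (ltW s0).
have E A : measurable A -> lebesgue_measure A = mscale s' m A.
  apply: lebesgue_measure_unique => X [[a b] /= _ <-].
  rewrite /mscale /= /pushforward.
  rewrite (_ : phi @^-1` _ = `](a - z) / s, (b - z) / s]%classic)%R; last first.
    apply/seteqP; split => x /=; rewrite !in_itv /= /phi => /andP[h1 h2].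
      by rewrite ltr_pdivrMr// ler_pdivlMr//; apply/andP; split; lra.
    move: h1 h2; rewrite ltr_pdivrMr// ler_pdivlMr// => h1 h2.
    by apply/andP; split; lra.
  rewrite !lebesgue_measure_itv/= !lte_fin.
  rewrite ltr_pM2r ?invr_gt0// ltrD2r.
  case: ifP => _; last by rewrite mule0.
  by rewrite -!EFinD -EFinM; congr EFin; field; rewrite gt_eqF.
rewrite [RHS](eq_measure_integral (mscale s' m)) => [|A mA _]; last exact: E.
rewrite ge0_integral_mscale//=; congr (_ * _).
by rewrite (ge0_integral_pushforward mphi).
Qed.

Lemma lebesgue_row_affine n (z : 'rV[R]_n) (s : R) (f : 'rV[R]_n -> \bar R) :
  (0 < s)%R -> measurable_fun setT f -> (forall v, 0 <= f v) ->
  (s ^+ n)%:E * \int[lebesgue_row n]_v f (z + s *: v)%R =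
  \int[lebesgue_row n]_v f v.
Proof.
move=> s0 mf f0.
rewrite !ge0_integral_lebesgue_row//; last first.
  apply: (measurableT_comp mf); apply: measurable_rowD => //.
  exact: measurable_rowZ.
rewrite -[RHS](@power_measure_change_of_variables _ _ _ (@lebesgue_measure R) n
   (fun i x => z ord0 i + s * x)%R s).
- congr (_ * _); apply: eq_integral => t _; congr f.
  by apply/rowP => i; rewrite !mxE tnth_mktuple.
- exact: ltW.
- by move=> i; apply: measurable_funD => //; exact: measurable_funM.
- by move=> i g mg g0; exact: lebesgue_measure_affine.
- exact: (measurableT_comp mf (@measurable_row_of_tuple n)).
- by [].
Qed.

Lemma lebesgue_row_tuple_affine n k (z : 'rV[R]_n) (s : R)
    (f : k.-tuple 'rV[R]_n -> \bar R) :
  (0 < s)%R -> measurable_fun [set: k.-tuple 'rV[R]_n] f -> (forall v, 0 <= f v) ->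
  ((s ^+ n) ^+ k)%:E *
    \int[power_measure (lebesgue_row n) k]_t f (map_tuple (fun y => z + s *: y)%R t) =
  \int[power_measure (lebesgue_row n) k]_t f t.
Proof.
move=> s0 mf f0.
rewrite -[RHS](@power_measure_change_of_variables _ _ _ (lebesgue_row n) k
   (fun i x => z + s *: x)%R (s ^+ n)).
- congr (_ * _); apply: eq_integral => t _; congr f.
  by apply: eq_from_tnth => i; rewrite tnth_map tnth_mktuple.
- by rewrite exprn_ge0// ltW.
- by move=> i; apply: measurable_rowD => //; exact: measurable_rowZ.
- by move=> i g mg g0; exact: lebesgue_row_affine.
- by [].
- by [].
Qed.

Lemma lebesgue_row_box n (A : 'I_n -> set (measurableTypeR R)) :
  (forall i, measurable (A i)) ->
  lebesgue_row n [set v | forall i, A i (v ord0 i)] =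
  \prod_(i < n) lebesgue_measure (A i).
Proof.
move=> mA; rewrite -power_measure_box// /lebesgue_row /pushforward.
congr (power_measure _ _ _); apply/seteqP; split => t /= h i; have := h i; by rewrite mxE.
Qed.

End lebesgue_row_integral.

Section euclidean_norm.
Context {R : realType} {n : nat}.
Implicit Types x y v : 'rV[R]_n.

Lemma enorm_ge0 v : 0 <= enorm v.
Proof. exact: sqrtr_ge0. Qed.

Lemma sqr_enorm v : enorm v ^+ 2 = \sum_(i < n) v ord0 i ^+ 2.
Proof. by rewrite sqr_sqrtr// sumr_ge0// => i _; exact: sqr_ge0. Qed.

Lemma coord_le_enorm v i : `|v ord0 i| <= enorm v.
Proof.
rewrite -(@ler_pXn2r _ 2)// ?nnegrE ?enorm_ge0// sqr_enorm real_normK ?num_real//.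
by rewrite (bigD1 i)//= lerDl sumr_ge0// => j _; exact: sqr_ge0.
Qed.

Lemma enorm_le_sum v : enorm v <= \sum_(i < n) `|v ord0 i|.
Proof.
have s0 : 0 <= \sum_(i < n) `|v ord0 i| by exact: sumr_ge0.
rewrite -(@ler_pXn2r _ 2)// ?nnegrE ?enorm_ge0// sqr_enorm [leRHS]expr2 mulr_suml.
apply: ler_sum => i _; rewrite -[leLHS]real_normK ?num_real// expr2.
by apply: ler_wpM2l => //; rewrite (bigD1 i)//= lerDl sumr_ge0.
Qed.

Lemma enormZ (a : R) v : enorm (a *: v) = `|a| * enorm v.
Proof.
rewrite /enorm -sqrtr_sqr -sqrtrM ?sqr_ge0//; congr Num.sqrt.
by rewrite mulr_sumr; apply: eq_bigr => i _; rewrite mxE exprMn.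
Qed.

Lemma enormN v : enorm (- v) = enorm v.
Proof. by rewrite -scaleN1r enormZ normrN1 mul1r. Qed.

Lemma enorm0_eq0 v : enorm v = 0 -> v = 0.
Proof.
by move=> v0; apply/rowP => i; rewrite mxE; apply/normr0_eq0/le_anti;
   rewrite normr_ge0 -v0 coord_le_enorm.
Qed.

Lemma measurable_closed_eball c (r : R) : measurable (closed_eball c r : set 'rV[R]_n).
Proof. by apply: measurable_le_set; apply: measurable_enorm; exact: measurable_rowB. Qed.

Lemma lebesgue_row_cube (c : 'rV[R]_n) (r : R) : 0 <= r ->
  lebesgue_row n [set v | forall i, `|v ord0 i - c ord0 i| <= r] =
  ((2 * r) ^+ n)%:E.
Proof.
move=> r0; rewrite (_ : mkset _ =
   [set v | forall i, `[c ord0 i - r, c ord0 i + r]%classic (v ord0 i)]).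
  rewrite (lebesgue_row_box (A := fun i => `[c ord0 i - r, c ord0 i + r]%classic))//.
  under eq_bigr => i _.
    rewrite lebesgue_measure_itv/= lte_fin -EFinB.
    rewrite (_ : (if _ then _ else _) = (2 * r)%:E); last first.
      case: ifPn => [_|]; first by congr EFin; ring.
      by rewrite -leNgt => h; congr EFin; lra.
    over.
  by rewrite prodEFin prodr_const card_ord.
by apply/seteqP; split => v /= h i; have := h i; rewrite in_itv/= ler_distl.
Qed.

Lemma measurable_cube (c : 'rV[R]_n) (r : R) :
  measurable [set v : 'rV[R]_n | forall i, `|v ord0 i - c ord0 i| <= r].
Proof.
apply: measurable_forall_set => i; apply: measurable_le_set; apply: measurableT_comp => //.
by apply: measurable_funB => //; exact: measurable_row_coord.
Qed.

Lemma unit_ball_volumeE : (unit_ball_volume n)%:E = lebesgue_row n (closed_eball (0 : 'rV[R]_n) 1).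
Proof.
rewrite fineK// ge0_fin_numE//.
apply: (@le_lt_trans _ _ (lebesgue_row n
   [set v : 'rV[R]_n | forall i, `|v ord0 i - (0 : 'rV[R]_n) ord0 i| <= 1])).
  apply: le_measure; rewrite ?inE; [exact: measurable_closed_eball|exact: measurable_cube|].
  move=> v; rewrite /closed_eball/= subr0 => v1 i; rewrite mxE subr0.
  exact: le_trans (coord_le_enorm _ _) v1.
by rewrite lebesgue_row_cube// ltry.
Qed.

(** Homogeneity of Lebesgue measure under the homothety that maps the unit ball to the given one. *)
Lemma lebesgue_row_eball (c : 'rV[R]_n) (r : R) : 0 < r ->
  lebesgue_row n (closed_eball c r) = (unit_ball_volume n * r ^+ n)%:E.
Proof.
move=> r0; rewrite mulrC EFinM unit_ball_volumeE.
have volE (A : set 'rV[R]_n) : measurable A ->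
    lebesgue_row n A = (\int[lebesgue_row n]_v (\1_A v)%:E)%E.
  by move=> mA; rewrite integral_indic// setIT.
rewrite (volE _ (measurable_closed_eball c r)).
rewrite (volE _ (measurable_closed_eball 0 1)).
rewrite -(lebesgue_row_affine c r0); last 2 first.
- by apply/measurable_EFinP/measurable_indic; exact: measurable_closed_eball.
- by move=> v; rewrite lee_fin.
congr (_ * _)%E; apply: eq_integral => v _; rewrite !indicE.
suff -> : (c + r *: v \in closed_eball c r) = (v \in closed_eball (0 : 'rV[R]_n) 1) :> bool by [].
apply/idP/idP; rewrite !inE /closed_eball/= subr0 addrC addKr enormZ gtr0_norm//.
  by rewrite ger_pMr.
by rewrite ger_pMr.
Qed.

Lemma unit_ball_volume_ge0 : 0 <= unit_ball_volume n :> R.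
Proof. by rewrite -lee_fin unit_ball_volumeE. Qed.

End euclidean_norm.

(** * Continuity of translations in L1 *)

Section translation_continuity.
Context {R : realType} {n : nat}.
Local Notation V := 'rV[R]_n.
Local Open Scope ereal_scope.
Implicit Types (f g h : V -> R) (z : V).

Definition shift_dist f z : \bar R :=
  \int[lebesgue_row n]_x (`|f (z + x) - f x|%R)%:E.

Definition translation_continuous f := forall e : R, (0 < e)%R ->
  exists2 delta : R, (0 < delta)%R &
    forall z, (forall i, `|z ord0 i| <= delta)%R -> shift_dist f z <= e%:E.

Lemma measurable_shift f z : measurable_fun setT f ->
  measurable_fun setT (fun x => f (z + x)%R).
Proof. by move=> mf; apply: (measurableT_comp mf); exact: measurable_rowD. Qed.

Lemma measurable_shift_diff f z : measurable_fun setT f ->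
  measurable_fun setT (fun x => (`|f (z + x) - f x|%R)%:E).
Proof.
move=> mf; apply/measurable_EFinP; apply: measurableT_comp => //.
by apply: measurable_funB => //; exact: measurable_shift.
Qed.

Lemma integral_shift (f : V -> \bar R) z : measurable_fun setT f ->
  (forall x, 0 <= f x) ->
  \int[lebesgue_row n]_x f (z + x)%R = \int[lebesgue_row n]_x f x.
Proof.
move=> mf f0; rewrite -[RHS](@lebesgue_row_affine _ _ z 1)// expr1n mul1e.
by under [RHS]eq_integral do rewrite scale1r.
Qed.

Lemma shift_dist_le2 f g h z :
  measurable_fun setT f -> measurable_fun setT g -> measurable_fun setT h ->
  (forall x, `|f (z + x) - f x| <= `|g (z + x) - g x| + `|h (z + x) - h x|)%R ->
  shift_dist f z <= shift_dist g z + shift_dist h z.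
Proof.
move=> mf mg mh fgh.
rewrite /shift_dist -ge0_integralD//; [|exact: measurable_shift_diff..].
apply: ge0_le_integral => //; first exact: measurable_shift_diff.
  by apply: emeasurable_funD; exact: measurable_shift_diff.
by move=> x _; rewrite -EFinD lee_fin.
Qed.

Lemma shift_dist_le f z : measurable_fun setT f -> (forall x, 0 <= f x)%R ->
  shift_dist f z <= 2%:E * \int[lebesgue_row n]_x (f x)%:E.
Proof.
move=> mf f0.
rewrite [2%:E](_ : _ = 1 + 1)%E; last by rewrite -EFinD.
rewrite ge0_muleDl// mul1e -[X in X + _](@integral_shift (EFin \o f) z)//; last first.
  exact/measurable_EFinP.
rewrite -ge0_integralD//; last 4 first.
- by move=> x _; rewrite lee_fin.
- by apply/measurable_EFinP; exact: measurable_shift.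
- by move=> x _; rewrite lee_fin.
- exact/measurable_EFinP.
apply: ge0_le_integral => //; first exact: measurable_shift_diff.
  apply: emeasurable_funD; apply/measurable_EFinP => //; exact: measurable_shift.
move=> x _; rewrite /= -EFinD lee_fin.
by rewrite (le_trans (ler_normB _ _))// !ger0_norm.
Qed.

Lemma translation_continuousD f g : measurable_fun setT f -> measurable_fun setT g ->
  translation_continuous f -> translation_continuous g ->
  translation_continuous (fun x => f x + g x)%R.
Proof.
move=> mf mg tf tg e e0.
have e2 : (0 < e / 2)%R by rewrite divr_gt0.
have [d d0 hd] := tf _ e2; have [d' d'0 hd'] := tg _ e2.
exists (Num.min d d'); first by rewrite lt_min d0.
move=> z zd; rewrite (splitr e) EFinD.
apply: (le_trans (@shift_dist_le2 _ f g _ _ mf mg _)).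
- exact: measurable_funD.
- move=> x; rewrite opprD addrACA; exact: ler_normD.
- apply: leeD.
    by apply: hd => i; have := zd i; rewrite le_min => /andP[].
  by apply: hd' => i; have := zd i; rewrite le_min => /andP[].
Qed.

Lemma translation_continuousZ f (c : R) : measurable_fun setT f ->
  translation_continuous f -> translation_continuous (fun x => c * f x)%R.
Proof.
move=> mf tf e e0.
have c1 : (0 < `|c| + 1)%R by rewrite ltr_wpDl.
have [d d0 hd] := tf (e / (`|c| + 1))%R (divr_gt0 e0 c1).
exists d => // z zd; rewrite /shift_dist.
under eq_integral do rewrite -mulrBr normrM EFinM.
rewrite ge0_integralZl//; last exact: measurable_shift_diff.
apply: (@le_trans _ _ (`|c|%R%:E * (e / (`|c| + 1))%R%:E)).
  by apply: lee_pmul => //; [exact: integral_ge0|exact: hd].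
rewrite -EFinM lee_fin mulrCA ger_pMr// ler_pdivrMr// mul1r lerDl//.
Qed.

Lemma translation_continuous_sum I (s : seq I) (F : I -> V -> R) :
  (forall i, measurable_fun setT (F i)) ->
  (forall i, translation_continuous (F i)) ->
  translation_continuous (fun x => \sum_(i <- s) F i x)%R.
Proof.
move=> mF tF; elim: s => [|i s IH].
  move=> e e0; exists 1%R => // z _; rewrite /shift_dist.
  under eq_integral do rewrite !big_nil subr0 normr0.
  by rewrite integral0 lee_fin ltW.
rewrite (_ : (fun x => _) = (fun x => F i x + \sum_(i <- s) F i x)%R); last first.
  by apply/funext => x; rewrite big_cons.
by apply: translation_continuousD => //; exact: measurable_sum.
Qed.

(** A nonnegative remainder [h] contributes at most twice its integral to the distance,
uniformly in the shift. *)
Lemma translation_continuous_approx f : measurable_fun setT f ->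
  (forall e : R, (0 < e)%R -> exists g : V -> R, exists h : V -> R,
    [/\ measurable_fun setT g, measurable_fun setT h, translation_continuous g,
     (forall x, f x = (g x + h x)%R) & (forall x, 0 <= h x)%R /\
     \int[lebesgue_row n]_x (h x)%:E <= e%:E]) ->
  translation_continuous f.
Proof.
move=> mf hf e e0.
have [g [h [mg mh tg fgh [h0 hint]]]] := hf (e / 4)%R (divr_gt0 e0 (ltr0Sn _ 3)).
have [d d0 hd] := tg (e / 2)%R (divr_gt0 e0 (ltr0Sn _ 1)).
exists d => // z zd.
apply: (le_trans (@shift_dist_le2 _ g h _ mf mg mh _)).
  by move=> x; rewrite !fgh opprD addrACA; exact: ler_normD.
rewrite (_ : e%:E = (e / 2)%:E + 2%:E * (e / 4)%:E)%E; last first.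
  by rewrite -EFinM -EFinD; congr EFin; field.
apply: leeD; first exact: hd.
by apply: (le_trans (shift_dist_le z mh h0)); rewrite lee_pmul2l.
Qed.

Definition big_cube (L : R) : set V := [set v | forall i, `|v ord0 i| <= L]%R.

Lemma big_cubeE L : big_cube L = [set v : V | forall i, `|v ord0 i - (0 : V) ord0 i| <= L]%R.
Proof. by apply/seteqP; split => v /= h i; have := h i; rewrite mxE subr0. Qed.

Lemma measurable_big_cube L : measurable (big_cube L).
Proof. by rewrite big_cubeE; exact: measurable_cube. Qed.

Lemma lebesgue_row_big_cube L : (0 <= L)%R ->
  lebesgue_row n (big_cube L) = ((2 * L) ^+ n)%:E.
Proof. by move=> L0; rewrite big_cubeE lebesgue_row_cube. Qed.

(** Coordinates with [a i = -oo] are free, so that these sets include the whole space and are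
stable under intersection. *)
Definition orthants : set (set V) :=
  [set A | exists a : 'I_n -> \bar R,
    A = [set v : V | forall i, a i < (v ord0 i)%:E]].

Lemma orthants_setI : setI_closed orthants.
Proof.
move=> _ _ [a ->] [b ->]; exists (fun i => maxe (a i) (b i)).
apply/seteqP; split => [v [ha hb] i|v h]; first by rewrite gt_max ha hb.
by split=> i; have := h i; rewrite gt_max => /andP[].
Qed.

Lemma orthants_gen : (measurable : set (set V)) = <<s orthants >>.
Proof.
apply/seteqP; split; last first.
  apply: smallest_sub; first exact: sigma_algebra_measurable.
  move=> _ [a ->].
  rewrite (_ : mkset _ = \bigcap_(i in [set: 'I_n])
     (setT `&` (fun v : V => (v ord0 i)%:E) @^-1` `]a i, +oo[%classic)).
    apply: fin_bigcap_measurable => // i _.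
    have /measurable_EFinP : measurable_fun setT (fun v : V => v ord0 i).
      exact: measurable_row_coord.
    by apply => //; exact: emeasurable_itv.
  apply/seteqP; split => v /= h i; last by have [] := h i I; rewrite /= in_itv/= andbT.
  by move=> _; split => //=; rewrite in_itv/= andbT.
apply: smallest_sub; first exact: smallest_sigma_algebra.
move=> A; rewrite -bigcup_seq/= => -[i _] [B mB <-]; rewrite setTI.
have {}mB : (@RGenOInfty.G R).-sigma.-measurable B.
  by rewrite -RGenOInfty.measurableE; exact: mB.
suff h : <<s @RGenOInfty.G R >> `<=` [set B | <<s orthants >> ((fun v : V => v ord0 i) @^-1` B)].
  exact: h.
apply: smallest_sub.
  have [s0 sC sU] := smallest_sigma_algebra [set: V] orthants.
  split.
  - by rewrite /= preimage_set0.
  - move=> C hC; rewrite /= setTD preimage_setC -setTD; exact: sC.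
  - by move=> F hF; rewrite /= preimage_bigcup; exact: sU.
move=> _ [x ->]; apply: sub_sigma_algebra.
exists (fun j => if j == i then x%:E else -oo).
apply/seteqP; split => v /=; rewrite in_itv/= andbT.
  by move=> xv j; case: eqP => [->|_]; rewrite ?lte_fin ?ltNyr.
by move=> /(_ i); rewrite eqxx lte_fin.
Qed.

Lemma measurable_slab (L a delta : R) (i : 'I_n) :
  measurable [set v | big_cube L v /\ `|v ord0 i - a| <= delta]%R.
Proof.
apply: measurableI; first exact: measurable_big_cube.
apply: measurable_le_set; apply: measurableT_comp => //; apply: measurable_funB => //.
exact: measurable_row_coord.
Qed.

Lemma lebesgue_row_slab (L a delta : R) (i : 'I_n) : (0 <= L)%R -> (0 <= delta)%R ->
  lebesgue_row n [set v | big_cube L v /\ `|v ord0 i - a| <= delta]%R <=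
  (2 * delta * (2 * L + 1) ^+ n)%:E.
Proof.
move=> L0 d0.
pose A (j : 'I_n) : set (measurableTypeR R) :=
  if j == i then `[a - delta, a + delta]%classic%R else `[- L, L]%classic%R.
have mA j : measurable (A j) by rewrite /A; case: ifP.
have lA j : lebesgue_measure (A j) = (if j == i then 2 * delta else 2 * L)%R%:E.
  rewrite /A; case: ifP => _; rewrite lebesgue_measure_itv/= lte_fin -EFinB.
    case: ifPn => [_|]; first by congr EFin; ring.
    by rewrite -leNgt => h; congr EFin; lra.
  case: ifPn => [_|]; first by congr EFin; ring.
  by rewrite -leNgt => h; congr EFin; lra.
apply: (@le_trans _ _ (lebesgue_row n [set v : V | forall i, A i (v ord0 i)])).
  apply: le_measure; rewrite ?inE.
  - exact: measurable_slab.
  - apply: measurable_forall_set => j; rewrite -[X in measurable X]setTI.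
    by apply: (@measurable_row_coord _ (measurableTypeR R)).
  - move=> v [vL va] j; rewrite /A; case: eqP => [->|_] /=.
      by rewrite in_itv/= -ler_distl.
    by rewrite in_itv/= -ler_norml.
rewrite lebesgue_row_box//.
under eq_bigr do rewrite lA.
rewrite prodEFin lee_fin (bigD1 i)//= eqxx.
apply: ler_wpM2l; first by rewrite mulr_ge0.
under eq_bigr => j /negPf ji do rewrite ji.
rewrite prodr_const.
have -> : #|[pred j | j != i]| = n.-1.
  by rewrite (eq_card (B := predC1 i))// cardC1 card_ord.
apply: (@le_trans _ _ ((2 * L + 1) ^+ n.-1)%R).
  by apply: lerXn2r; rewrite ?nnegrE ?lerDl// ?addr_ge0// mulr_ge0.
by apply: ler_weXn2l; rewrite ?leq_pred// lerDr mulr_ge0.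
Qed.

(** A small shift moves a point out of a truncated orthant only if one of its coordinates is
close to a threshold: one of the two faces of the cube, or the bound of the orthant. A lower bound
[-oo] is never crossed, so the value of [fine] there is irrelevant. *)
Lemma orthant_crossing (a : 'I_n -> \bar R) (L delta : R) (x y : V) :
  let A := [set v : V | forall i, a i < (v ord0 i)%:E] `&` big_cube L in
  (0 <= delta <= L)%R ->
  (forall i, `|x ord0 i - y ord0 i| <= delta)%R -> A x -> ~ A y ->
  [/\ big_cube (2 * L) x, big_cube (2 * L) y & exists i, exists2 p,
    p \in [:: fine (a i); L; - L]%R &
    (`|x ord0 i - p| <= delta /\ `|y ord0 i - p| <= delta)%R].
Proof.
move=> A /andP[d0 dL] xy [xa xL] nAy.
split.
- by move=> i; have := xL i; rewrite !ler_norml; lra.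
- by move=> i; have := xL i; have := xy i; rewrite !ler_norml; lra.
have [h|h] := pselect (forall i, a i < (y ord0 i)%:E); last first.
  move/existsNP: h => [i /negP]; rewrite -leNgt => ya; exists i.
  have := xa i; move: ya; case: (a i) => [r| |]; rewrite ?lee_fin ?lte_fin//= => yr rx.
  exists r; first by rewrite !inE eqxx.
  have := xy i; rewrite !ler_norml; lra.
have /existsNP[i /negP] : ~ (forall i, `|y ord0 i| <= L)%R by move=> h'; apply: nAy.
rewrite -ltNge => yL; exists i; have xyi := xy i; have xLi := xL i.
have [y0|y0] := leP 0%R (y ord0 i).
  exists L; first by rewrite !inE eqxx orbT.
  by move: yL xyi xLi; rewrite ger0_norm// !ler_norml; lra.
exists (- L)%R; first by rewrite !inE eqxx !orbT.
by move: yL xyi xLi; rewrite ltr0_norm// !ler_norml; lra.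
Qed.

(** The indicator changes only on finitely many slabs of width [2 * delta] around the thresholds. *)
Lemma translation_continuous_orthant A L : (0 < L)%R -> orthants A ->
  translation_continuous (\1_(A `&` big_cube L)).
Proof.
move=> L0 [a ->{A}] e e0; set A := _ `&` _.
pose c := (3 * n%:R * (2 * (2 * (2 * L) + 1) ^+ n) + 1)%R.
have c0 : (0 < c)%R.
  by rewrite ltr_wpDl// !mulr_ge0// exprn_ge0// addr_ge0// !mulr_ge0// ltW.
pose delta := (Num.min L (e / c))%R.
have d0 : (0 < delta)%R by rewrite lt_min L0 divr_gt0.
exists delta => // z zd.
pose slab (i : 'I_n) p := [set v : V | big_cube (2 * L) v /\ `|v ord0 i - p| <= delta]%R.
have mslab i p : measurable (slab i p) by exact: measurable_slab.
have mA : measurable A.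
  apply: measurableI; last exact: measurable_big_cube.
  by rewrite orthants_gen; apply: sub_sigma_algebra; exists a.
pose pts (i : 'I_n) := [:: fine (a i); L; - L]%R.
apply: (@le_trans _ _ (\int[lebesgue_row n]_x
    (\sum_(i < n) \sum_(p <- pts i) (\1_(slab i p) x)%:E))).
  apply: ge0_le_integral => //.
  - by apply: measurable_shift_diff; exact: measurable_indic.
  - apply: emeasurable_sum => i; apply: emeasurable_sum => p.
    by apply/measurable_EFinP; exact: measurable_indic.
  move=> x _.
  have sum0 : 0 <= \sum_(i < n) \sum_(p <- pts i) (\1_(slab i p) x : R)%:E.
    by apply: sume_ge0 => i _; apply: sume_ge0 => p _; rewrite lee_fin.
  have key : (A (z + x)%R /\ ~ A x) \/ (A x /\ ~ A (z + x)%R) ->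
      1 <= \sum_(i < n) \sum_(p <- pts i) (\1_(slab i p) x : R)%:E.
    move=> h.
    have [i [p pi sp]] : exists i, exists2 p, p \in pts i & slab i p x.
      have dL : (0 <= delta <= L)%R by rewrite ltW//= /delta ge_min lexx.
      case: h => -[h1 h2].
        have [|h3 h4 [i [p pi [_ hp]]]] := orthant_crossing dL _ h1 h2.
          by move=> i; rewrite mxE addrK.
        by exists i; exists p.
      have [|h3 h4 [i [p pi [hp _]]]] := orthant_crossing dL _ h1 h2.
        by move=> i; rewrite mxE opprD addrCA subrr addr0 normrN.
      by exists i; exists p.
    rewrite (bigD1 i)//= (big_rem p)//= indicE mem_set// -addeA.
    rewrite leeDl// adde_ge0//; first by apply: sume_ge0 => q _; rewrite lee_fin.
    by apply: sume_ge0 => j _; apply: sume_ge0 => q _; rewrite lee_fin.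
  rewrite !indicE.
  have [h1|h1] := pselect (A (z + x)%R); have [h2|h2] := pselect (A x).
  - by rewrite !mem_set// subrr normr0.
  - by rewrite mem_set// memNset// subr0 normr1; apply: key; left.
  - by rewrite memNset// mem_set// sub0r normrN normr1; apply: key; right.
  - by rewrite !memNset// subrr normr0.
rewrite ge0_integral_sum//; last 2 first.
- move=> i; apply: emeasurable_sum => p.
  by apply/measurable_EFinP; exact: measurable_indic.
- by move=> i x _; apply: sume_ge0 => p _; rewrite lee_fin.
apply: (@le_trans _ _ (\sum_(i < n) (3 * (2 * delta * (2 * (2 * L) + 1) ^+ n))%R%:E)).
  apply: lee_sum => i _.
  rewrite ge0_integral_sum//; last first.
    by move=> p; apply/measurable_EFinP; exact: measurable_indic.
  rewrite !big_cons big_nil !integral_indic// !setIT adde0.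
  rewrite (_ : (3 * _)%R = (2 * delta * (2 * (2 * L) + 1) ^+ n +
     (2 * delta * (2 * (2 * L) + 1) ^+ n + 2 * delta * (2 * (2 * L) + 1) ^+ n))%R); last by ring.
  rewrite !EFinD.
  by repeat apply: leeD; apply: lebesgue_row_slab; rewrite ?mulr_ge0// ltW.
rewrite sumEFin lee_fin sumr_const card_ord -[leLHS]mulr_natl.
apply: (@le_trans _ _ (delta * c)%R).
  rewrite /c mulrDr mulr1 (_ : (n%:R * _)%R = delta * (3 * n%:R * (2 * (2 * (2 * L) + 1) ^+ n)))%R; last by ring.
  by rewrite lerDl ltW.
by rewrite -ler_pdivlMr// ge_min lexx orbT.
Qed.

(** Orthants generate the measurable sets and are stable under intersection, and the class of
sets with this property is stable under complements and countable disjoint unions. Truncation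
by a cube keeps the tails of the unions of small volume. *)
Lemma translation_continuous_set (A : set V) L : (0 < L)%R -> measurable A ->
  translation_continuous (\1_(A `&` big_cube L)).
Proof.
move=> L0 mA; have mC := measurable_big_cube L.
pose P (B : set V) := translation_continuous (\1_(B `&` big_cube L)).
have PT : P setT.
  apply: translation_continuous_orthant => //; exists (fun=> -oo).
  by apply/seteqP; split => v //= _ i; rewrite ltNyr.
have := mA; rewrite orthants_gen; apply: (dynkin_induction (P := P)) => //.
- exact: orthants_gen.
- exact: orthants_setI.
- by move=> B oB; exact: translation_continuous_orthant.
- move=> B mB PB; rewrite /P.
  rewrite (_ : \1__ = (fun x => \1_(setT `&` big_cube L) x + (-1) * \1_(B `&` big_cube L) x)%R).
    apply: translation_continuousD => //.
    + by apply: measurable_indic; exact: measurableI.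
    + by apply: measurable_funM => //; apply: measurable_indic; exact: measurableI.
    + by apply: translation_continuousZ => //; apply: measurable_indic; exact: measurableI.
  apply/funext => x; rewrite !indicE setTI mulN1r.
  have [xC|xC] := pselect (big_cube L x); last first.
    by rewrite !memNset ?subr0//= => -[].
  rewrite [in RHS](mem_set xC).
  have [xB|xB] := pselect (B x).
    by rewrite [_ \in B `&` _]mem_set// memNset ?subrr// => -[].
  by rewrite mem_set// [_ \in B `&` _]memNset ?subr0// => -[].
- move=> F mF tF PF; rewrite /P.
  apply: translation_continuous_approx.
    apply: measurable_indic; apply: measurableI => //; exact: bigcup_measurable.
  move=> e e0.
  pose U m := \bigcup_(k in [set k | (m <= k)%N]) F k.
  have mU m : measurable (U m) by apply: bigcup_measurable.
  have [m Um] : exists m, lebesgue_row n (U m `&` big_cube L) <= e%:E.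
    have : lebesgue_row n (U m `&` big_cube L) @[m --> \oo] --> 0.
      rewrite -(measure0 (lebesgue_row n)).
      have U0 : \bigcap_m (U m `&` big_cube L) = set0.
        apply/seteqP; split => x //= Ux.
        have [[j _ Fj] _] := Ux 0%N I; have [[l /= jl Fl] _] := Ux j.+1 I.
        have jl' : j = l by apply: (tF j l) => //; exists x.
        by move: jl; rewrite jl' ltnn.
      rewrite -U0; apply: nonincreasing_cvg_mu.
      - apply: (@le_lt_trans _ _ (lebesgue_row n (big_cube L))).
          by apply: le_measure; rewrite ?inE//; exact: measurableI.
        by rewrite lebesgue_row_big_cube ?ltry// ltW.
      - by move=> i; exact: measurableI.
      - by rewrite U0.
      - move=> i j ij; apply/subsetPset; apply: setSI.
        by move=> x [l /= jl Fl]; exists l => //=; exact: leq_trans jl.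
    move=> /fine_cvgP[[m1 _ h1] /cvgrPdist_le /(_ _ e0)[m2 _ h2]].
    exists (maxn m1 m2); rewrite -[leLHS]fineK ?h1//= ?leq_maxl// lee_fin.
    have := h2 (maxn m1 m2) (leq_maxr _ _).
    by rewrite /= sub0r normrN ger0_norm// fine_ge0.
  exists (fun x => \sum_(i < m) \1_(F i `&` big_cube L) x)%R.
  exists (\1_(U m `&` big_cube L)).
  split.
  + by apply: measurable_sum => i; apply: measurable_indic; exact: measurableI.
  + by apply: measurable_indic; exact: measurableI.
  + by apply: translation_continuous_sum => i; [apply: measurable_indic; exact: measurableI|exact: PF].
  + move=> x; rewrite !indicE.
    have [xC|xC] := pselect (big_cube L x); last first.
      rewrite !memNset ?addr0; [|by case..].
      by rewrite big1// => i _; rewrite indicE memNset// => -[].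
    have [[j _ Fj]|nF] := pselect ((\bigcup_m F m) x); last first.
      rewrite !memNset ?addr0.
      - by rewrite big1// => i _; rewrite indicE memNset// => -[Fi _]; apply: nF; exists i.
      - by move=> [[i _ Fi] _]; apply: nF; exists i.
      - by case.
    have Fi i : i != j -> ~ F i x.
      by move=> /eqP ij Fix; apply: ij; apply: tF => //; exists x.
    rewrite mem_set; last by split => //; exists j.
    have [mj|jm] := leqP m j.
      rewrite mem_set; last by split => //; exists j.
      rewrite big1 ?add0r// => i _; rewrite indicE memNset// => -[+ _]; apply: Fi.
      by rewrite neq_ltn (leq_trans (ltn_ord i)).
    rewrite [_ \in U m `&` _]memNset; last first.
      move=> [[l /= ml Fl] _]; apply: (Fi l) => //.
      by rewrite neq_ltn (leq_trans jm ml) orbT.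
    rewrite addr0 (bigD1 (Ordinal jm))//= indicE mem_set// big1 ?addr0// => i ij.
    by rewrite indicE memNset// => -[+ _]; apply: Fi; rewrite -val_eqE in ij.
  + by split => //; rewrite integral_indic ?setIT//; exact: measurableI.
Qed.

(** Rounding [y] down to a multiple of [a] counts the levels below [y]. *)
Lemma step_approx (a y : R) m : (0 <= a)%R -> (0 <= y <= m%:R * a)%R ->
  (\sum_(j < m) a * ((j.+1%:R * a <= y)%R)%:R <= y <= \sum_(j < m) a * ((j.+1%:R * a <= y)%R)%:R + a)%R.
Proof.
move=> a0; elim: m => [|m IH] /andP[y0 ym].
  by rewrite big_ord0 add0r; move: ym; rewrite mul0r; lra.
have full p : (p%:R * a <= y)%R -> (\sum_(j < p) a * ((j.+1%:R * a <= y)%R)%:R = p%:R * a)%R.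
  move=> pa; rewrite (eq_bigr (fun=> a)) => [|j _]; last first.
    rewrite (_ : (_ <= _)%R = true) ?mulr1//; apply: le_trans pa.
    by rewrite ler_wpM2r// ler_nat.
  by rewrite sumr_const card_ord mulr_natl.
have [h|h] := leP (m.+1%:R * a)%R y.
  by rewrite full//; apply/andP; split => //; lra.
rewrite big_ord_recr/= (lt_geF h) mulr0 addr0.
have [h'|h'] := leP (m%:R * a)%R y; last by apply: IH; rewrite y0 ltW.
by rewrite full// h'/=; move: h; rewrite -natr1 mulrDl mul1r => /ltW.
Qed.

(** Up to a uniformly small error on the cube, [f] is a combination of indicators of its
superlevel sets. *)
Lemma translation_continuous_bounded f (L M : R) : (0 < L)%R -> (0 < M)%R ->
  measurable_fun setT f -> (forall x, 0 <= f x <= M)%R ->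
  (forall x, f x != 0%R -> big_cube L x) ->
  translation_continuous f.
Proof.
move=> L0 M0 mf fM fL.
apply: translation_continuous_approx => // e e0.
pose c := ((2 * L) ^+ n)%R.
have c0 : (0 < c)%R by rewrite exprn_gt0// mulr_gt0.
pose m := (Num.truncn (M * c / e)).+1.
pose a := (M / m%:R)%R.
have m0 : (0 < m%:R :> R)%R by rewrite ltr0n.
have a0 : (0 < a)%R by rewrite divr_gt0.
have ac : (a * c <= e)%R.
  rewrite /a mulrAC ler_pdivrMr// [(e * _)%R]mulrC -ler_pdivrMr// ltW//.
  exact: truncnS_gt.
pose A (j : nat) := [set x : V | (j.+1%:R * a <= f x)%R].
have mA j : measurable (A j).
  by apply: measurable_bool_set; exact: measurable_fun_ler.
have AL j : A j `&` big_cube L = A j.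
  apply/setIidPl => x; rewrite /A/= => h; apply: fL; rewrite gt_eqF//.
  by apply: lt_le_trans h; rewrite mulr_gt0.
exists (fun x => \sum_(j < m) a * \1_(A j `&` big_cube L) x)%R.
exists (fun x => f x - \sum_(j < m) a * \1_(A j `&` big_cube L) x)%R.
have mg : measurable_fun setT (fun x => \sum_(j < m) a * \1_(A j `&` big_cube L) x)%R.
  apply: measurable_sum => j; apply: measurable_funM => //; apply: measurable_indic.
  by apply: measurableI => //; exact: measurable_big_cube.
have key x : (0 <= f x - \sum_(j < m) a * \1_(A j `&` big_cube L) x <= a)%R.
  have := @step_approx a (f x) m (ltW a0).
  rewrite /a mulrC divfK ?gt_eqF// => /(_ (fM x)).
  rewrite -/a.
  under [in X in _ -> X]eq_bigr do rewrite AL indicE.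
  rewrite (eq_bigr (fun j : 'I_m => a * (x \in A j)%:R)%R); last first.
    move=> j _; rewrite (_ : (j.+1%:R * a <= f x)%R = (x \in A j) :> bool)//.
    by apply/idP/idP => [h|]; [exact: mem_set|rewrite inE].
  lra.
split => //.
- exact: measurable_funB.
- apply: translation_continuous_sum => j.
    apply: measurable_funM => //; apply: measurable_indic.
    by apply: measurableI => //; exact: measurable_big_cube.
  apply: translation_continuousZ; last exact: translation_continuous_set.
  apply: measurable_indic; apply: measurableI => //; exact: measurable_big_cube.
- by move=> x; rewrite addrC subrK.
- split; first by move=> x; have /andP[] := key x.
  apply: (@le_trans _ _ (\int[lebesgue_row n]_x (a%:E * (\1_(big_cube L) x)%:E))).
    apply: ge0_le_integral => //.
    + by move=> x _; rewrite lee_fin; have /andP[] := key x.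
    + by apply/measurable_EFinP; exact: measurable_funB.
    + apply: emeasurable_funM => //; apply/measurable_EFinP/measurable_indic.
      exact: measurable_big_cube.
    move=> x _; rewrite -EFinM lee_fin indicE.
    have [xC|xC] := pselect (big_cube L x).
      by rewrite mem_set// mulr1; have /andP[] := key x.
    rewrite memNset// mulr0.
    have -> : f x = 0%R by apply/eqP/negPn/negP => /fL.
    rewrite sub0r oppr_le0 sumr_ge0// => j _; rewrite mulr_ge0//; exact: ltW.
  rewrite ge0_integralZl//; last 2 first.
  + by apply/measurable_EFinP/measurable_indic; exact: measurable_big_cube.
  + by rewrite lee_fin ltW.
  rewrite integral_indic ?setIT//; last exact: measurable_big_cube.
  apply: (@le_trans _ _ (a%:E * lebesgue_row n (big_cube L))) => //.
  by rewrite lebesgue_row_big_cube; [rewrite -EFinM lee_fin|exact: ltW].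
Qed.

End translation_continuity.

(** * Circumspheres in Gram coordinates *)

Section dot_product.
Context {R : realType} {n : nat}.
Implicit Types u v w : 'rV[R]_n.

Definition dot u v : R := \sum_(i < n) u ord0 i * v ord0 i.

Lemma dotC u v : dot u v = dot v u.
Proof. by apply: eq_bigr => i _; rewrite mulrC. Qed.

Lemma dotDl u v w : dot (u + v) w = dot u w + dot v w.
Proof. by rewrite -big_split; apply: eq_bigr => i _ /=; rewrite mxE mulrDl. Qed.

Lemma dotZl (a : R) u v : dot (a *: u) v = a * dot u v.
Proof. by rewrite mulr_sumr; apply: eq_bigr => i _; rewrite mxE mulrA. Qed.

Lemma dotNl u v : dot (- u) v = - dot u v.
Proof. by rewrite -scaleN1r dotZl mulN1r. Qed.

Lemma dotBl u v w : dot (u - v) w = dot u w - dot v w.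
Proof. by rewrite dotDl dotNl. Qed.

Lemma dotBr u v w : dot w (u - v) = dot w u - dot w v.
Proof. by rewrite dotC dotBl !(dotC w). Qed.

Lemma dot_suml I (s : seq I) (F : I -> 'rV[R]_n) v :
  dot (\sum_(i <- s) F i) v = \sum_(i <- s) dot (F i) v.
Proof.
elim: s => [|i s IH]; last by rewrite !big_cons dotDl IH.
by rewrite !big_nil /dot big1// => i _; rewrite mxE mul0r.
Qed.

Lemma dot_enorm u : dot u u = enorm u ^+ 2.
Proof. by rewrite sqr_enorm; apply: eq_bigr => i _; rewrite expr2. Qed.

Lemma dot_eq0 u : dot u u = 0 -> u = 0.
Proof. by rewrite dot_enorm => /eqP; rewrite sqrf_eq0 => /eqP/enorm0_eq0. Qed.

Lemma enormB u v : enorm (u - v) ^+ 2 = enorm u ^+ 2 - 2 * dot u v + enorm v ^+ 2.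
Proof.
rewrite -!dot_enorm dotBl !dotBr (dotC v u); ring.
Qed.

Lemma mulmx_tr_dot m p (A : 'M[R]_(m, n)) (B : 'M[R]_(p, n)) i j :
  (A *m B^T) i j = dot (row i A) (row j B).
Proof. by rewrite mxE; apply: eq_bigr => l _; rewrite !mxE. Qed.

End dot_product.

Section circumsphere_uniqueness.
Context {R : realType} {N : nat}.
Implicit Types (alpha : {fset 'rV[R]_N}).

(** The difference [D] of two centers has the same scalar product with every point of [alpha],
hence with both centers, as they are affine combinations of these points; so [D] is orthogonal to
itself. *)
Lemma is_circumsphere_unique alpha s s' : alpha != fset0 ->
  is_circumsphere alpha s -> is_circumsphere alpha s' -> s = s'.
Proof.
move=> /fset0Pn[x0 x0a] [[a a1 sE] h] [[a' a1' s'E] h'].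
pose D := s.1 - s'.1.
pose C := (enorm s.1 ^+ 2 - enorm s'.1 ^+ 2 - s.2 ^+ 2 + s'.2 ^+ 2) / 2.
have xD x : x \in alpha -> dot x D = C.
  move=> xa; have := congr1 (fun r => r ^+ 2) (h x xa).
  have := congr1 (fun r => r ^+ 2) (h' x xa).
  by rewrite /= !enormB /C /D dotBr => <- <-; field.
have D0 : D = 0.
  apply: dot_eq0; rewrite {1}/D sE s'E dotBl !dot_suml.
  have E b : \sum_(x <- alpha) b x = 1 -> \sum_(x <- alpha) dot (b x *: x) D = C.
    move=> b1; rewrite -[RHS]mul1r -b1 mulr_suml !big_seq.
    by apply: eq_bigr => y ya; rewrite dotZl xD.
  by rewrite !E// subrr.
have s1 : s.1 = s'.1 by apply/eqP; rewrite -subr_eq0; apply/eqP.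
have s2 : s.2 = s'.2 by rewrite -(h _ x0a) -(h' _ x0a) s1.
by case: s s' s1 s2 {sE s'E h h' D xD D0 C} => [? ?] [? ?] /= -> ->.
Qed.

Lemma circumsphereE alpha s : alpha != fset0 -> is_circumsphere alpha s ->
  circumsphere alpha = s.
Proof.
move=> a0 hs; apply: (is_circumsphere_unique a0 _ hs).
exact: (@xgetI _ _ _ s).
Qed.

End circumsphere_uniqueness.

Section gram_coordinates.
Context {R : realType} {N k : nat}.
Implicit Types x : k.+1.-tuple 'rV[R]_N.

Definition vertices x : {fset 'rV[R]_N} := [fset v in val x]%fset.

Definition edges x : 'M[R]_(k, N) :=
  \matrix_(i < k) (tnth x (lift ord0 i) - tnth x ord0).

Definition gram x : 'M[R]_k := edges x *m (edges x)^T.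

Definition half_diag x : 'rV[R]_k := \row_i (gram x i i / 2).

(** The coordinates of the circumcenter along the edges out of the first vertex. Being equidistant
from all vertices means [bary x *m gram x = half_diag x]; Cramer's rule solves this system by an
expression that is measurable in [x] also where the vertices are not in general position. *)
Definition bary x : 'rV[R]_k :=
  (\det (gram x))^-1 *: (half_diag x *m \adj (gram x)).

Definition radius_vector x : 'rV[R]_N := bary x *m edges x.
Definition ccenter x : 'rV[R]_N := tnth x ord0 + radius_vector x.
Definition cradius x : R := enorm (radius_vector x).

Lemma bary_gram x : \det (gram x) != 0 -> bary x *m gram x = half_diag x.
Proof.
move=> d0; rewrite /bary -scalemxAl -mulmxA mul_adj_mx mul_mx_scalar scalerA.
by rewrite mulVf// scale1r.
Qed.

Lemma gram_inj x (w : 'rV[R]_k) : \det (gram x) != 0 -> w *m gram x = 0 -> w = 0.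
Proof.
move=> d0 /(congr1 (fun A => A *m \adj (gram x))).
rewrite -mulmxA mul_mx_adj mul_mx_scalar mul0mx => /eqP.
by rewrite scaler_eq0 (negbTE d0) => /eqP.
Qed.

Lemma edges_inj x (w : 'rV[R]_k) : \det (gram x) != 0 -> w *m edges x = 0 -> w = 0.
Proof. by move=> d0 w0; apply: (gram_inj d0); rewrite mulmxA w0 mul0mx. Qed.

(** A vector in the kernel of the Gram matrix gives a combination of the edges of norm 0. *)
Lemma gram_det_neq0 x : (forall w : 'rV[R]_k, w *m edges x = 0 -> w = 0) ->
  \det (gram x) != 0.
Proof.
move=> inj; rewrite -unitfE -unitmxE -row_free_unit; apply: inj_row_free => v v0.
apply: inj; apply: dot_eq0.
have := congr1 (fun A => (A *m v^T) ord0 ord0) v0.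
rewrite /gram mulmxA -mulmxA -trmx_mul mul0mx mulmx_tr_dot mxE.
by rewrite !row_id.
Qed.

Lemma sum_vertices (W : nmodType) x (F : 'rV[R]_N -> W) : uniq x ->
  \sum_(v <- vertices x) F v = \sum_(i < k.+1) F (tnth x i).
Proof.
move=> ux; rewrite -(big_tuple _ _ x xpredT F).
by apply: perm_big; apply: uniq_perm => // v; rewrite inE.
Qed.

(** Affine combinations of the vertices become linear combinations of the edges, for which the
Gram matrix decides independence. *)
Lemma comb_edges x (b : 'I_k.+1 -> R) :
  \sum_(i < k.+1) b i *: tnth x i =
  (\sum_(i < k.+1) b i) *: tnth x ord0 + (\row_i b (lift ord0 i)) *m edges x.
Proof.
rewrite [LHS]big_ord_recl [\sum_(i < k.+1) b i]big_ord_recl scalerDl -addrA; congr (_ + _).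
rewrite mulmx_sum_row scaler_suml -big_split /=; apply: eq_bigr => i _.
by rewrite mxE rowK scalerBr addrC subrK.
Qed.

Lemma vertices_neq0 x : vertices x != fset0.
Proof. by apply/fset0Pn; exists (tnth x ord0); rewrite inE /= mem_tnth. Qed.

(** Turns coefficients indexed by vertices into a function of points, the form in which
combinations of the points of a finite set are written. *)
Definition coef (b : 'I_k.+1 -> R) x (v : 'rV[R]_N) : R := b (inord (index v x)).

Lemma coefE b x i : uniq x -> coef b x (tnth x i) = b i.
Proof.
by move=> ux; rewrite /coef (tnth_nth 0) index_uniq ?size_tuple// inord_val.
Qed.

Lemma gram_det_uniq x : \det (gram x) != 0 -> uniq x.
Proof.
move=> d0; apply/(uniqP 0) => i j; rewrite !inE size_tuple => ik jk xij.
apply/eqP; apply: contraT => ij; exfalso.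
pose b (l : 'I_k.+1) : R := (l == Ordinal ik)%:R - (l == Ordinal jk)%:R.
have b0 : \sum_l b l = 0.
  rewrite sumrB (bigD1 (Ordinal ik))//= eqxx big1 => [|l /negPf->//].
  rewrite (bigD1 (Ordinal jk))//= eqxx big1 => [|l /negPf->//].
  by rewrite !addr0 subrr.
have bx : \sum_l b l *: tnth x l = 0.
  under eq_bigr do rewrite scalerBl; rewrite sumrB.
  rewrite (bigD1 (Ordinal ik))//= eqxx big1 => [|l /negPf->]; last by rewrite scale0r.
  rewrite (bigD1 (Ordinal jk))//= eqxx big1 => [|l /negPf->]; last by rewrite scale0r.
  by rewrite !addr0 !scale1r !(tnth_nth 0) /= xij subrr.
move: (comb_edges x b); rewrite b0 bx scale0r add0r => /esym/(edges_inj d0).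
move=> /rowP w0.
have b0' l : l != ord0 -> b l = 0.
  by move=> l0; case: (unliftP ord0 l) l0 => [m ->|->]; [have := w0 m; rewrite !mxE|rewrite eqxx].
have bi : b (Ordinal ik) = 1.
  rewrite /b eqxx (_ : (_ == _) = false) ?subr0//.
  by apply/negbTE; rewrite -val_eqE.
have bj : b (Ordinal jk) = -1.
  rewrite /b eqxx (_ : (_ == _) = false) ?sub0r//.
  by apply/negbTE; rewrite -val_eqE eq_sym.
have /eqP i0 : Ordinal ik == ord0.
  by apply: contraT => /b0'; rewrite bi => /eqP; rewrite oner_eq0.
have /eqP j0 : Ordinal jk == ord0.
  by apply: contraT => /b0'; rewrite bj => /eqP; rewrite oppr_eq0 oner_eq0.
by move: ij; rewrite -[i]/(val (Ordinal ik)) -[j]/(val (Ordinal jk)) i0 j0 eqxx.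
Qed.

(** The barycentric coordinates of the center with respect to all vertices, the first one included. *)
Definition bary_full x (i : 'I_k.+1) : R :=
  if unlift ord0 i is Some j then bary x ord0 j else 1 - \sum_j bary x ord0 j.

Lemma bary_full_lift x (j : 'I_k) : bary_full x (lift ord0 j) = bary x ord0 j.
Proof. by rewrite /bary_full; case: unliftP => [l /lift_inj ->//|/eqP]. Qed.

Lemma bary_full0 x : bary_full x ord0 = 1 - \sum_j bary x ord0 j.
Proof. by rewrite /bary_full unlift_none. Qed.

Lemma sum_bary_full x : \sum_i bary_full x i = 1.
Proof.
rewrite big_ord_recl bary_full0.
by under [in X in _ + X]eq_bigr do rewrite bary_full_lift; rewrite subrK.
Qed.

Lemma comb_bary_full x : \sum_i bary_full x i *: tnth x i = ccenter x.
Proof.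
rewrite comb_edges sum_bary_full scale1r /ccenter /radius_vector; congr (_ + _ *m _).
by apply/rowP => j; rewrite mxE bary_full_lift.
Qed.

(** The equation solved by [bary x] says that twice the scalar product of the center with an edge
is the square of the length of that edge. *)
Lemma enorm_center x i : \det (gram x) != 0 -> enorm (tnth x i - ccenter x) = cradius x.
Proof.
move=> d0; rewrite /ccenter; case: (unliftP ord0 i) => [j|] ->; last first.
  by rewrite opprD addrA subrr add0r enormN.
rewrite opprD addrA.
have -> : tnth x (lift ord0 j) - tnth x ord0 = row j (edges x) by rewrite rowK.
apply/eqP; rewrite -(@eqrXn2 _ 2) ?enorm_ge0//; apply/eqP.
rewrite enormB -/(cradius x).
suff -> : 2 * dot (row j (edges x)) (radius_vector x) = enorm (row j (edges x)) ^+ 2.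
  by rewrite subrr add0r.
have /rowP/(_ j) := bary_gram d0.
rewrite [RHS]mxE /gram mulmxA !mulmx_tr_dot row_id -dot_enorm => h.
by rewrite dotC /radius_vector h; field.
Qed.

Lemma circumsphere_gram x : \det (gram x) != 0 ->
  circumsphere (vertices x) = (ccenter x, cradius x).
Proof.
move=> d0; have ux := gram_det_uniq d0.
apply: circumsphereE; first exact: vertices_neq0.
split=> /=; last first.
  move=> v; rewrite inE /= => /tnthP[i ->]; exact: enorm_center.
exists (coef (bary_full x) x).
  rewrite sum_vertices//; under eq_bigr do rewrite coefE//.
  exact: sum_bary_full.
rewrite sum_vertices//; under eq_bigr do rewrite coefE//.
by rewrite comb_bary_full.
Qed.

(** Affine independence is nonvanishing of the Gram determinant, and the center lies in the open
simplex when its barycentric coordinates are positive. These are finitely many inequalities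
between measurable functions of the vertices. *)
Lemma center_indicatorP x : reflect
  [/\ \det (gram x) != 0, forall i, 0 < bary x ord0 i & \sum_i bary x ord0 i < 1]
  (center_indicator k (vertices x)).
Proof.
apply: (iffP (asboolP _)) => [[c ai os]|[d0 l0 l1]].
  have ux : uniq x.
    move: c; rewrite card_fseq => /esym sE.
    by rewrite -[uniq _]negbK -ltn_size_undup -sE size_tuple ltnn.
  have d0 : \det (gram x) != 0.
    apply: gram_det_neq0 => w w0.
    pose b (i : 'I_k.+1) := if unlift ord0 i is Some j then w ord0 j else - \sum_j w ord0 j.
    have bl (j : 'I_k) : b (lift ord0 j) = w ord0 j.
      by rewrite /b; case: unliftP => [l /lift_inj ->//|/eqP].
    have bs : \sum_i b i = 0.
      rewrite big_ord_recl {1}/b unlift_none.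
      by under [in X in _ + X]eq_bigr do rewrite bl; rewrite addNr.
    have bx : \sum_i b i *: tnth x i = 0.
      rewrite comb_edges bs scale0r add0r -[RHS]w0; congr (_ *m _).
      by apply/rowP => j; rewrite mxE bl.
    have := ai (coef b x); rewrite sum_vertices// sum_vertices//.
    under eq_bigr do rewrite coefE//.
    under [in X in _ -> X -> _]eq_bigr do rewrite coefE//.
    move=> /(_ bs bx) h; apply/rowP => j; rewrite mxE.
    have := h (tnth x (lift ord0 j)); rewrite coefE// bl; apply.
    by rewrite inE /= mem_tnth.
  move: os; rewrite /circumcenter circumsphere_gram//= => -[a [a0]].
  rewrite sum_vertices// sum_vertices// => a1.
  rewrite comb_edges a1 scale1r => /addrI /eqP.
  rewrite -subr_eq0 -mulmxBl => /eqP/(edges_inj d0)/eqP.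
  rewrite subr_eq0 => /eqP lE.
  have ap i : 0 < a (tnth x i) by apply: a0; rewrite inE /= mem_tnth.
  split => //; first by move=> i; rewrite lE mxE.
  rewrite lE; under eq_bigr do rewrite mxE.
  by rewrite -a1 big_ord_recl ltrDr.
have ux := gram_det_uniq d0.
split.
- by rewrite card_fseq undup_id// size_tuple.
- move=> a; rewrite sum_vertices// sum_vertices// => a0.
  rewrite comb_edges a0 scale0r add0r => /(edges_inj d0)/rowP w0 v.
  have aj j : a (tnth x (lift ord0 j)) = 0 by have := w0 j; rewrite !mxE.
  rewrite inE /= => /tnthP[i ->]; case: (unliftP ord0 i) => [j|] ->; first exact: aj.
  by move: a0; rewrite big_ord_recl big1 ?addr0.
- exists (coef (bary_full x) x); split.
  + move=> v; rewrite inE /= => /tnthP[i ->]; rewrite coefE// /bary_full.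
    by case: unliftP => [j _|_]; [exact: l0|rewrite subr_gt0].
  + rewrite sum_vertices//; under eq_bigr do rewrite coefE//.
    exact: sum_bary_full.
  + rewrite sum_vertices//; under eq_bigr do rewrite coefE//.
    by rewrite comb_bary_full /circumcenter circumsphere_gram.
Qed.

End gram_coordinates.

Section equivariance.
Context {R : realType} {N k : nat}.
Implicit Types x : k.+1.-tuple 'rV[R]_N.
Variables (z : 'rV[R]_N) (s : R).
Hypothesis s0 : 0 < s.

Let phi (v : 'rV[R]_N) := z + s *: v.

Lemma edges_affine x : edges (map_tuple phi x) = s *: edges x.
Proof.
apply/matrixP => i j; rewrite !mxE !tnth_map /phi !mxE; ring.
Qed.

Lemma gram_affine x : gram (map_tuple phi x) = s ^+ 2 *: gram x.
Proof.
by rewrite /gram edges_affine linearZ /= -scalemxAl -scalemxAr scalerA expr2.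
Qed.

Lemma gram_det_affine x :
  (\det (gram (map_tuple phi x)) != 0) = (\det (gram x) != 0).
Proof.
by rewrite gram_affine detZ mulf_eq0 !expf_eq0 (gt_eqF s0)/= !andbF.
Qed.

(** Both sides solve the same nonsingular system, the factor [s ^+ 2] cancelling. *)
Lemma bary_affine x : \det (gram x) != 0 -> bary (map_tuple phi x) = bary x.
Proof.
move=> d0; apply/eqP; rewrite -subr_eq0; apply/eqP/(gram_inj d0).
have d0' : \det (gram (map_tuple phi x)) != 0 by rewrite gram_det_affine.
apply: (scalerI (a := s ^+ 2)); first by rewrite expf_neq0// gt_eqF.
rewrite scaler0 mulmxBl scalerBr scalemxAr -gram_affine !bary_gram//.
suff -> : half_diag (map_tuple phi x) = s ^+ 2 *: half_diag x by rewrite subrr.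
by apply/rowP => i; rewrite [LHS]mxE gram_affine !mxE mulrA.
Qed.

Lemma radius_vector_affine x : \det (gram x) != 0 ->
  radius_vector (map_tuple phi x) = s *: radius_vector x.
Proof. by move=> d0; rewrite /radius_vector bary_affine// edges_affine -scalemxAr. Qed.

Lemma center_affine x : \det (gram x) != 0 ->
  ccenter (map_tuple phi x) = phi (ccenter x).
Proof.
by move=> d0; rewrite /ccenter radius_vector_affine// tnth_map /phi scalerDr addrA.
Qed.

Lemma radius_affine x : \det (gram x) != 0 ->
  cradius (map_tuple phi x) = s * cradius x.
Proof. by move=> d0; rewrite /cradius radius_vector_affine// enormZ gtr0_norm. Qed.

Lemma center_indicator_affine x :
  center_indicator k (vertices (map_tuple phi x)) =
  center_indicator k (vertices x).
Proof.
apply/center_indicatorP/center_indicatorP; rewrite gram_det_affine => -[d0].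
  by rewrite bary_affine.
by split; rewrite ?bary_affine.
Qed.

End equivariance.

Section matrix_measurability.
Context {R : realType}.

Lemma measurable_invr : measurable_fun setT (fun x : R => x^-1).
Proof.
rewrite -(setvU [set (0 : R)]); apply/measurable_funU => //.
  exact: measurableC.
split; last exact: measurable_fun_set1.
apply: open_continuous_measurable_fun; first by apply: closed_openC; apply: accessible_closed_set1; apply: hausdorff_accessible; exact: Rhausdorff.
by move=> x /[!inE] /eqP x0; exact: inv_continuous.
Qed.

Context {d : measure_display} {T : measurableType d}.

Lemma measurable_det n (A : T -> 'M[R]_n) :
  (forall i j, measurable_fun setT (fun t => A t i j)) ->
  measurable_fun setT (fun t => \det (A t)).
Proof.
move=> mA; rewrite /determinant; apply: measurable_sum => s.
by apply: measurable_funM => //; apply: measurable_prod => i _.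
Qed.

Lemma measurable_adj n (A : T -> 'M[R]_n) i j :
  (forall i j, measurable_fun setT (fun t => A t i j)) ->
  measurable_fun setT (fun t => \adj (A t) i j).
Proof.
move=> mA; under eq_fun do rewrite mxE.
apply: measurable_funM => //; apply: measurable_det => i' j'.
by under eq_fun do rewrite !mxE; exact: mA.
Qed.

Lemma measurable_mulmx m n p (A : T -> 'M[R]_(m, n)) (B : T -> 'M[R]_(n, p)) i j :
  (forall i j, measurable_fun setT (fun t => A t i j)) ->
  (forall i j, measurable_fun setT (fun t => B t i j)) ->
  measurable_fun setT (fun t => (A t *m B t) i j).
Proof.
move=> mA mB; under eq_fun do rewrite mxE.
by apply: measurable_sum => l; exact: measurable_funM.
Qed.

Lemma measurable_forall (I : finType) (f : I -> T -> bool) :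
  (forall i, measurable_fun setT (f i)) ->
  measurable_fun setT (fun t => [forall i, f i t]).
Proof.
move=> mf.
rewrite (_ : (fun t => _) = (fun t => \big[andb/true]_i f i t)); last first.
  by apply/funext => t; rewrite big_andE.
elim: (index_enum I) => [|i s IH].
  by under eq_fun do rewrite big_nil; exact: measurable_cst.
by under eq_fun do rewrite big_cons; exact: measurable_and.
Qed.

End matrix_measurability.

Section simplex_measurability.
Context {R : realType} {N k : nat}.
Local Notation V := 'rV[R]_N.
Local Notation cfg := (k.+1.-tuple V).

Lemma measurable_edges i j : measurable_fun [set: cfg] (fun x : cfg => edges x i j).
Proof.
under eq_fun do rewrite !mxE.
apply: measurable_funB; apply: measurable_fun_coord; exact: measurable_tnth.
Qed.

Lemma measurable_gram i j : measurable_fun [set: cfg] (fun x : cfg => gram x i j).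
Proof.
apply: measurable_mulmx => [|i' j']; first exact: measurable_edges.
by under eq_fun do rewrite mxE; exact: measurable_edges.
Qed.

Lemma measurable_gram_det : measurable_fun [set: cfg] (fun x : cfg => \det (gram x)).
Proof. by apply: measurable_det; exact: measurable_gram. Qed.

Lemma measurable_bary j : measurable_fun [set: cfg] (fun x : cfg => bary x ord0 j).
Proof.
under eq_fun do rewrite mxE.
apply: measurable_funM.
  exact: (measurableT_comp measurable_invr measurable_gram_det).
apply: measurable_mulmx => i' j'; last first.
  by apply: measurable_adj; exact: measurable_gram.
under eq_fun do rewrite mxE.
by apply: measurable_funM => //; exact: measurable_gram.
Qed.

Lemma measurable_radius_vector : measurable_fun [set: cfg] (fun x : cfg => radius_vector x).
Proof.
apply: measurable_fun_rowP => j; apply: measurable_mulmx; last exact: measurable_edges.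
by move=> i' j'; rewrite (ord1 i'); exact: measurable_bary.
Qed.

Lemma measurable_center : measurable_fun [set: cfg] (fun x : cfg => ccenter x).
Proof.
by apply: measurable_rowD; [exact: measurable_tnth|exact: measurable_radius_vector].
Qed.

Lemma measurable_radius : measurable_fun [set: cfg] (fun x : cfg => cradius x).
Proof. exact: measurable_enorm measurable_radius_vector. Qed.

Lemma measurable_center_indicator : measurable_fun [set: cfg]
  (fun x : cfg => center_indicator k (vertices x)).
Proof.
rewrite (_ : (fun x => _) = (fun x : cfg => [&& \det (gram x) != 0,
   [forall i, 0 < bary x ord0 i] & \sum_i bary x ord0 i < 1])); last first.
  apply/funext => x; apply/center_indicatorP/and3P => [[? l0 ?]|[? /forallP l0 ?]]; split=> //.
  exact/forallP.
apply: measurable_and.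
  have : measurable_fun [set: cfg] (fun x : cfg => ~~ (\det (gram x) == 0)).
    by apply: measurable_neg; apply: measurable_fun_eqr => //; exact: measurable_gram_det.
  by [].
apply: measurable_and.
  apply: measurable_forall => i; apply: measurable_fun_ltr => //; exact: measurable_bary.
apply: measurable_fun_ltr => //.
apply: measurable_sum => i; exact: measurable_bary.
Qed.

End simplex_measurability.

Section simplex_facts.
Context {R : realType} {N k : nat}.
Local Notation V := 'rV[R]_N.
Implicit Types x : k.+1.-tuple V.

Lemma center_indicator_det x : center_indicator k (vertices x) -> \det (gram x) != 0.
Proof. by case/center_indicatorP. Qed.

Lemma circumradius_vertices x : center_indicator k (vertices x) ->
  circumradius (vertices x) = cradius x.
Proof. by move=> /center_indicator_det/circumsphere_gram; rewrite /circumradius => ->. Qed.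

Lemma circumcenter_vertices x : center_indicator k (vertices x) ->
  circumcenter (vertices x) = ccenter x.
Proof. by move=> /center_indicator_det/circumsphere_gram; rewrite /circumcenter => ->. Qed.

Lemma circumball_vertices x : center_indicator k (vertices x) ->
  circumball (vertices x) = closed_eball (ccenter x) (cradius x).
Proof.
by move=> hx; rewrite /circumball circumradius_vertices// circumcenter_vertices.
Qed.

Lemma radius_ge0 x : 0 <= cradius x.
Proof. exact: enorm_ge0. Qed.

Lemma radius_gt0 x : (0 < k)%N -> center_indicator k (vertices x) -> 0 < cradius x.
Proof.
move=> k0 /center_indicatorP[d0 l0 _]; rewrite lt_neqAle radius_ge0 andbT eq_sym.
apply/eqP => /enorm0_eq0/(edges_inj d0)/rowP/(_ (Ordinal k0)).
by rewrite [RHS]mxE => /eqP; rewrite (gt_eqF (l0 (Ordinal k0))).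
Qed.

Lemma convex_set2 (S : set V) (u v : V) (t : R) : convex_set S -> 0 <= t <= 1 ->
  S u -> S v -> S (t *: u + (1 - t) *: v).
Proof.
move=> cS /andP[t0 t1] Su Sv.
by have := cS u v (Itv01 t0 t1) (mem_set Su) (mem_set Sv); rewrite inE.
Qed.

Lemma sumr_ord_gt0 m (b : 'I_m.+1 -> R) : (forall i, 0 < b i) -> 0 < \sum_i b i.
Proof.
by move=> b0; rewrite big_ord_recl ltr_pwDl// sumr_ge0// => i _; exact: ltW.
Qed.

Lemma convex_sum (S : set V) m (b : 'I_m.+1 -> R) (v : 'I_m.+1 -> V) :
  convex_set S -> (forall i, 0 < b i) -> (forall i, S (v i)) ->
  S ((\sum_i b i)^-1 *: \sum_i b i *: v i).
Proof.
move=> cS; elim: m b v => [|m IH] b v b0 Sv.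
  by rewrite !big_ord1 scalerA mulVf ?gt_eqF// scale1r.
have := IH (fun i => b (widen_ord (leqnSn m.+1) i))
  (fun i => v (widen_ord (leqnSn m.+1) i)) (fun i => b0 _) (fun i => Sv _).
have := sumr_ord_gt0 (fun i => b0 (widen_ord (leqnSn m.+1) i)).
rewrite [\sum_(i < m.+2) b i]big_ord_recr [\sum_(i < m.+2) _ *: _]big_ord_recr/=.
set B := \sum_(i < _) _; set W := \sum_(i < _) _ *: _ => B0 SW.
have bm := b0 ord_max.
have BB : 0 < B + b ord_max by rewrite addr_gt0.
have := @convex_set2 S _ _ (B / (B + b ord_max)) cS _ SW (Sv ord_max).
rewrite scalerA mulrAC divff ?gt_eqF// mul1r scalerDr scalerA.
rewrite (_ : 1 - B / (B + b ord_max) = (B + b ord_max)^-1 * b ord_max); last first.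
  by field; rewrite gt_eqF.
apply; apply/andP; split; first by rewrite divr_ge0// ltW.
by rewrite ler_pdivrMr// mul1r lerDl ltW.
Qed.

(** The barycentric coordinates of the center are positive. Hence circumballs of interior simplices
are centered in the support of the density, and have a mass bounded below. *)
Lemma center_in_convex (S : set V) x : convex_set S -> center_indicator k (vertices x) ->
  (forall i, S (tnth x i)) -> S (ccenter x).
Proof.
move=> cS /center_indicatorP[d0 l0 l1] Sx.
have := @convex_sum S k (bary_full x) (fun i => tnth x i) cS _ Sx.
rewrite sum_bary_full invr1 scale1r comb_bary_full; apply => i.
by rewrite /bary_full; case: unliftP => [j _|_]; rewrite ?subr_gt0.
Qed.

End simplex_facts.

(** * The density and the mass of circumballs *)

Section ball_mass.
Context {R : realType} {N k : nat}.
Local Notation V := 'rV[R]_N.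
Implicit Types (mu : probability V R) (x : k.+1.-tuple V).

Definition ball_mass mu x : R := fine (mu (closed_eball (ccenter x) (cradius x))).

Lemma ball_massE mu x : (ball_mass mu x)%:E = mu (closed_eball (ccenter x) (cradius x)).
Proof. by rewrite fineK// fin_num_measure//; exact: measurable_closed_eball. Qed.

Lemma ball_mass_ge0 mu x : 0 <= ball_mass mu x.
Proof. exact: fine_ge0. Qed.

Lemma ball_mass_le1 mu x : ball_mass mu x <= 1.
Proof. by rewrite -lee_fin ball_massE probability_le1//; exact: measurable_closed_eball. Qed.

Lemma measurable_ball_mass mu :
  measurable_fun [set: k.+1.-tuple V] (fun x : k.+1.-tuple V => ball_mass mu x).
Proof.
apply: measurable_section_mass; apply: measurable_bool_set; apply: measurable_fun_ler.
  apply: measurable_enorm; apply: measurable_rowB => //.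
  exact: (measurableT_comp measurable_center measurable_fst).
exact: (measurableT_comp measurable_radius measurable_fst).
Qed.

End ball_mass.

Section real_estimates.
Context {R : realType}.
Implicit Types a b u t : R.

Lemma exprB_le a b q : 0 <= a <= 1 -> 0 <= b <= 1 -> `|a ^+ q - b ^+ q| <= q%:R * `|a - b|.
Proof.
move=> /andP[a0 a1] /andP[b0 b1]; rewrite subrXX normrM mulrC.
apply: ler_wpM2r => //; apply: (le_trans (ler_norm_sum _ _ _)).
rewrite -[leRHS](_ : \sum_(i < q) 1 = _); last by rewrite sumr_const card_ord.
apply: ler_sum => i _; rewrite normrM !normrX !ger0_norm//.
by rewrite mulr_ile1// ?exprn_ge0// exprn_ile1.
Qed.

Lemma expR_sub_le t : 0 <= t -> `|(1 - t) - expR (- t)| <= t ^+ 2.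
Proof.
move=> t0; have h1 := expR_ge1Dx (- t).
rewrite distrC ger0_norm ?subr_ge0//.
have h2 := expR_ge1Dx t.
have t1 : 0 < 1 + t by rewrite ltr_pwDl.
have : expR (- t) <= (1 + t)^-1.
  by rewrite expRN lef_pV2// posrE ?expR_gt0.
move/le_trans => h; rewrite lerBlDr; apply: h.
rewrite -(ler_pM2r t1) mulVf ?gt_eqF//.
have : 0 <= t ^+ 3 by rewrite exprn_ge0.
rewrite !exprS expr0; nra.
Qed.

Lemma expR_lip a b : 0 <= a -> 0 <= b -> `|expR (- a) - expR (- b)| <= `|a - b|.
Proof.
have h x y : 0 <= x -> x <= y -> `|expR (- x) - expR (- y)| <= `|x - y|.
  move=> x0 xy; rewrite ger0_norm; last by rewrite subr_ge0 ler_expR lerN2.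
  rewrite ler0_norm ?subr_le0// opprB.
  have e1 : expR (- y) = expR (- x) * expR (- (y - x)) by rewrite -expRD; congr expR; lra.
  have := expR_ge1Dx (- (y - x)).
  have : expR (- x) <= 1 by rewrite -expR0 ler_expR lerNl oppr0.
  have : 0 < expR (- x) by exact: expR_gt0.
  rewrite e1; have : 0 <= y - x by rewrite subr_ge0.
  nra.
move=> a0 b0; have [ab|/ltW ba] := leP a b; first exact: h.
by rewrite distrC [leRHS]distrC h.
Qed.

(** The probability that [q] independent points avoid an event of probability [u], against the
probability that a Poisson variable of mean [v] vanishes. *)
Lemma binomial_poisson u (v : R) q : 0 <= u <= 1 -> 0 <= v ->
  `|(1 - u) ^+ q - expR (- v)| <= q%:R * u ^+ 2 + `|q%:R * u - v|.
Proof.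
move=> /andP[u0 u1] v0.
have -> : (1 - u) ^+ q - expR (- v) =
  ((1 - u) ^+ q - expR (- u) ^+ q) + (expR (- (q%:R * u)) - expR (- v)).
  by rewrite -expRM_natl mulrN addrA subrK.
apply: (le_trans (ler_normD _ _)); apply: lerD; last first.
  by apply: expR_lip => //; rewrite mulr_ge0.
apply: (le_trans (exprB_le _ _ _)).
- by rewrite subr_ge0 u1 gerBl.
- by rewrite expR_ge0 -[leRHS]expR0 ler_expR lerNl oppr0.
- by apply: ler_wpM2l => //; exact: expR_sub_le.
Qed.

(** The factors are replaced one at a time. *)
Lemma prod_diff_le n (a b : 'I_n -> R) (M : R) : 1 <= M ->
  (forall i, 0 <= a i <= M) -> (forall i, 0 <= b i <= M) ->
  `|\prod_i a i - \prod_i b i| <= M ^+ n * \sum_i `|a i - b i|.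
Proof.
move=> M1; have M0 : 0 <= M by exact: le_trans M1.
elim: n a b => [|n IH] a b ha hb.
  by rewrite !big_ord0 subrr normr0 mulr0.
rewrite !big_ord_recl.
set A := \prod_i _; set B := \prod_i _.
have hB : 0 <= B <= M ^+ n.
  apply/andP; split; first by apply: prodr_ge0 => i _; have /andP[] := hb (lift ord0 i).
  apply: (@le_trans _ _ (\prod_(i < n) M)); first by apply: ler_prod => i _; exact: hb.
  by rewrite prodr_const card_ord.
have := IH (fun i => a (lift ord0 i)) (fun i => b (lift ord0 i)) (fun i => ha _) (fun i => hb _).
rewrite -/A -/B; set s := \sum_i _ => AB.
rewrite (_ : _ - _ = a ord0 * (A - B) + (a ord0 - b ord0) * B); last by ring.
apply: (le_trans (ler_normD _ _)); rewrite !normrM mulrDr addrC.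
have /andP[a0 aM] := ha ord0; move/andP: hB => [B0 BM].
have Mn : 0 <= M ^+ n by exact: exprn_ge0.
apply: lerD.
  rewrite mulrC; apply: ler_wpM2r => //; rewrite ger0_norm//.
  by apply: (le_trans BM); apply: ler_weXn2l.
rewrite ger0_norm// exprS -mulrA; apply: ler_pM => //.
Qed.

End real_estimates.

Section bounded_density.
Context {R : realType} {N k : nat}.
Local Notation V := 'rV[R]_N.
Variables (mu : probability V R) (kappa : V -> R) (L M m0 : R).

(** The assumptions on the density with explicit constants: bounds [m0] and [M] on the support,
which is convex and contained in a cube. The bound [1 <= M] lets the powers of [M] increase. *)
Record good_density : Prop := GoodDensity {
  gd_N : (0 < N)%N;
  gd_meas : measurable_fun setT kappa;
  gd_ge0 : forall x, 0 <= kappa x;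
  gd_le : forall x, kappa x <= M;
  gd_M1 : 1 <= M;
  gd_m0 : 0 < m0;
  gd_low : forall x, kappa x != 0 -> m0 <= kappa x;
  gd_L : 0 < L;
  gd_cube : forall x, kappa x != 0 -> big_cube L x;
  gd_conv : convex_set [set x | kappa x != 0];
  gd_dens : forall A, measurable A -> mu A = (\int[lebesgue_row N]_(x in A) (kappa x)%:E)%E }.

Hypothesis gd : good_density.

Let S : set V := [set x | kappa x != 0].

Lemma measurable_supp : measurable S.
Proof.
rewrite (_ : S = setT `&` kappa @^-1` [set~ 0]).
  by apply: (gd_meas gd) => //; exact: measurableC.
by apply/seteqP; split => x /=; rewrite /S/=; [move=> /eqP|move=> [_ /eqP]].
Qed.

Lemma integral_dens (h : V -> \bar R) : measurable_fun setT h -> (forall x, 0 <= h x)%E ->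
  (\int[mu]_x h x = \int[lebesgue_row N]_x ((kappa x)%:E * h x))%E.
Proof.
by apply: ge0_integral_density; [exact: (gd_meas gd)|exact: (gd_ge0 gd)|exact: (gd_dens gd)].
Qed.

Lemma integral_dens_tuple n (f : n.-tuple V -> \bar R) :
  measurable_fun [set: n.-tuple V] f -> (forall t, 0 <= f t)%E ->
  (\int[power_measure mu n]_t f t =
   \int[power_measure (lebesgue_row N) n]_t ((\prod_(i < n) kappa (tnth t i))%:E * f t))%E.
Proof.
apply: power_measure_density; [exact: (gd_meas gd)|exact: (gd_ge0 gd)|exact: integral_dens].
Qed.

Lemma integral_dens_le (h : V -> \bar R) : measurable_fun setT h -> (forall x, 0 <= h x)%E ->
  (\int[mu]_x h x <= M%:E * \int[lebesgue_row N]_x h x)%E.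
Proof.
move=> mh h0; rewrite integral_dens// -ge0_integralZl//; last first.
  by rewrite lee_fin (le_trans _ (gd_M1 gd)).
apply: ge0_le_integral => //.
- by move=> x _; rewrite mule_ge0// lee_fin (gd_ge0 gd).
- by apply: emeasurable_funM => //; apply/measurable_EFinP; exact: (gd_meas gd).
- by apply: emeasurable_funM.
- by move=> x _; rewrite lee_wpmul2r// lee_fin (gd_le gd).
Qed.

(** The density of independent points vanishes as soon as one of them is off the support. *)
Lemma le_integral_supp n (f g : n.-tuple V -> \bar R) :
  measurable_fun [set: n.-tuple V] f -> measurable_fun [set: n.-tuple V] g ->
  (forall t, 0 <= f t)%E -> (forall t, 0 <= g t)%E ->
  (forall t, (forall i, S (tnth t i)) -> f t <= g t)%E ->
  (\int[power_measure mu n]_t f t <= \int[power_measure mu n]_t g t)%E.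
Proof.
move=> mf mg f0 g0 fg; rewrite !integral_dens_tuple//.
have p0 (t : n.-tuple V) : 0 <= \prod_(i < n) kappa (tnth t i).
  by apply: prodr_ge0 => i _; exact: (gd_ge0 gd).
have mp : measurable_fun [set: n.-tuple V] (fun t : n.-tuple V => (\prod_(i < n) kappa (tnth t i))%:E).
  apply/measurable_EFinP; apply: measurable_prod => i _.
  by apply: (measurableT_comp (gd_meas gd)); exact: measurable_tnth.
apply: ge0_le_integral => //.
- by move=> t _; rewrite mule_ge0// lee_fin.
- exact: emeasurable_funM.
- exact: emeasurable_funM.
move=> t _; have [h|/existsNP[i Si]] := pselect (forall i, S (tnth t i)).
  by rewrite lee_wpmul2l ?lee_fin//; exact: fg.
rewrite (_ : \prod_(i < n) kappa (tnth t i) = 0) ?mul0e//.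
by rewrite (bigD1 i)//= (_ : kappa _ = 0) ?mul0r//; apply/eqP/negPn/negP => /Si.
Qed.

Lemma mu_le (A : set V) : measurable A -> (mu A <= M%:E * lebesgue_row N A)%E.
Proof.
move=> mA; have := @integral_dens_le (fun x => (\1_A x)%:E).
rewrite !integral_indic// !setIT; apply => //.
by apply/measurable_EFinP.
Qed.

Lemma mu_supp : mu S = 1%E.
Proof.
rewrite -(probability_setT mu) !(gd_dens gd)//; last exact: measurable_supp.
rewrite integral_mkcond; apply: eq_integral => x _; rewrite patchE.
case: ifPn => //; rewrite notin_setE /S/= => /negP/negPn/eqP -> //.
Qed.

Let diam : R := 2 * L * N%:R.
Let volS : R := fine (lebesgue_row N S).
(** The ratio that [mu_eball_ge] guarantees between the mass of a ball centered in the support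
and the [N]-th power of its radius; [diam] bounds the diameter of the support. *)
Definition low_const : R := m0 * volS / diam ^+ N.

Let diam_gt0 : 0 < diam.
Proof. by rewrite !mulr_gt0 ?(gd_L gd)// ltr0n (gd_N gd). Qed.

Lemma supp_diam u v : S u -> S v -> enorm (u - v) <= diam.
Proof.
move=> /(gd_cube gd) uL /(gd_cube gd) vL; apply: (le_trans (enorm_le_sum _)).
rewrite /diam mulr_natr -[X in _ *+ X](card_ord N) -sumr_const; apply: ler_sum => i _.
rewrite !mxE mulr_natl mulr2n (le_trans (ler_normB _ _))//.
by apply: lerD; [exact: uL|exact: vL].
Qed.

Let volSE : volS%:E = lebesgue_row N S.
Proof.
rewrite fineK// ge0_fin_numE//.
apply: (@le_lt_trans _ _ (lebesgue_row N (big_cube L : set V))).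
  apply: le_measure; rewrite ?inE; [exact: measurable_supp|exact: measurable_big_cube|].
  by move=> x; exact: (gd_cube gd).
by rewrite lebesgue_row_big_cube ?ltry// ltW// (gd_L gd).
Qed.

Let volS_gt0 : 0 < volS.
Proof.
have := mu_le measurable_supp; rewrite mu_supp -volSE -EFinM lee_fin => h.
have M0 : 0 < M by apply: lt_le_trans (gd_M1 gd).
by rewrite -(pmulr_rgt0 _ M0); apply: lt_le_trans h.
Qed.

Lemma low_const_gt0 : 0 < low_const.
Proof. by rewrite divr_gt0 ?mulr_gt0 ?exprn_gt0// (gd_m0 gd). Qed.

(** The homothety of center [c] and ratio [r / diam] maps the support into the ball and, by
convexity, into the support itself. *)
Lemma mu_eball_ge (c : V) (r : R) : S c -> 0 <= r <= diam ->
  ((low_const * r ^+ N)%:E <= mu (closed_eball c r))%E.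
Proof.
move=> Sc /andP[r0 rd].
have [->|rn0] := eqVneq r 0.
  by rewrite expr0n gtn_eqF ?(gd_N gd)//= mulr0.
have {r0 rn0}r0 : 0 < r by rewrite lt_neqAle eq_sym rn0.
pose s := r / diam; have s0 : 0 < s by rewrite divr_gt0.
have s1 : s <= 1 by rewrite ler_pdivrMr// mul1r.
pose E := closed_eball c r `&` S.
have mE : measurable E by apply: measurableI; [exact: measurable_closed_eball|exact: measurable_supp].
have volE (A : set V) : measurable A ->
    lebesgue_row N A = (\int[lebesgue_row N]_v (\1_A v)%:E)%E.
  by move=> mA; rewrite integral_indic// setIT.
have lE : ((s ^+ N)%:E * lebesgue_row N S <= lebesgue_row N E)%E.
  have mi (A : set V) : measurable A -> measurable_fun setT (fun v => (\1_A v : R)%:E).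
    by move=> mA; apply/measurable_EFinP; exact: measurable_indic.
  rewrite (volE _ mE) (volE _ measurable_supp).
  rewrite -[leRHS](@lebesgue_row_affine _ _ (c - s *: c) s)//; last first.
  - exact: mi.
  rewrite lee_pmul2l ?lte_fin ?exprn_gt0//.
  apply: ge0_le_integral => //.
  - by apply: mi; exact: measurable_supp.
  - apply: (measurableT_comp (mi _ mE)); apply: measurable_rowD => //.
    exact: measurable_rowZ.
  move=> v _; rewrite lee_fin !indicE.
  have [Sv|nSv] := pselect (S v); last by rewrite memNset// ler0n.
  rewrite (mem_set Sv) mem_set//; split.
    rewrite /closed_eball/= (_ : _ - c = s *: (v - c)); last first.
      by rewrite scalerBr addrAC; apply/rowP => i; rewrite !mxE; ring.
    rewrite enormZ gtr0_norm// /s mulrAC ler_pdivrMr//.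
    by apply: ler_wpM2l; [exact: ltW|exact: supp_diam].
  rewrite (_ : c - s *: c + s *: v = s *: v + (1 - s) *: c); last first.
    by rewrite scalerBl scale1r addrC.
  by apply: convex_set2 (gd_conv gd) _ Sv Sc; rewrite ltW.
have mES : (m0%:E * lebesgue_row N E <= mu E)%E.
  rewrite (gd_dens gd)// (volE _ mE).
  rewrite -ge0_integralZl//; last 2 first.
  - by apply/measurable_EFinP; exact: measurable_indic.
  - by rewrite lee_fin ltW// (gd_m0 gd).
  rewrite [leRHS]integral_mkcond.
  apply: ge0_le_integral => //.
  - by move=> v _; rewrite mule_ge0// lee_fin// ltW// (gd_m0 gd).
  - by apply: emeasurable_funM => //; apply/measurable_EFinP; exact: measurable_indic.
  - apply/(measurable_restrictT _ mE); apply/measurable_EFinP.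
    by apply: measurable_funTS; exact: (gd_meas gd).
  move=> v _; rewrite patchE indicE; case: ifPn => vE; last by rewrite mule0.
  by rewrite mule1 lee_fin (gd_low gd)//; move: vE; rewrite inE => -[].
apply: (@le_trans _ _ (mu E)); last first.
  apply: le_measure; rewrite ?inE//; first exact: measurable_closed_eball.
  exact: subIsetl.
apply: le_trans mES; apply: (@le_trans _ _ (m0%:E * ((s ^+ N)%:E * lebesgue_row N S))%E).
  rewrite -volSE -!EFinM lee_fin /low_const /s expr_div_n.
  by rewrite le_eqVlt; apply/orP; left; apply/eqP; ring.
by rewrite lee_pmul2l// lte_fin (gd_m0 gd).
Qed.

Lemma ball_mass_ge (x : k.+1.-tuple V) : (forall i, S (tnth x i)) ->
  center_indicator k (vertices x) -> low_const * cradius x ^+ N <= ball_mass mu x.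
Proof.
move=> Sx hx; rewrite -lee_fin ball_massE.
have Sc : S (ccenter x) by exact: center_in_convex (gd_conv gd) hx Sx.
apply: mu_eball_ge => //; rewrite radius_ge0/=.
rewrite -(enorm_center ord0 (center_indicator_det hx)).
exact: supp_diam.
Qed.

Lemma ball_mass_le (x : k.+1.-tuple V) : 0 < cradius x ->
  ball_mass mu x <= M * (unit_ball_volume N * cradius x ^+ N).
Proof.
move=> r0; rewrite -lee_fin ball_massE EFinM -(lebesgue_row_eball (ccenter x))//.
by apply: mu_le; exact: measurable_closed_eball.
Qed.

End bounded_density.

(** * Integrability of the limit *)

Section limit_integrability.
Context {R : realType}.
Local Open Scope ereal_scope.

(** Twice the integral of an exponential density, up to a factor. *)
Lemma integral_exp_abs_lty (c : R) : (0 < c)%R ->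
  \int[@lebesgue_measure R]_x (expR (- c * `|x|))%:E < +oo.
Proof.
move=> c0; rewrite ge0_symfun_integralT; last 3 first.
- by move=> x; exact: expR_ge0.
- move=> x; apply: continuous_comp; last exact: continuous_expR.
  by apply: cvgM; [exact: cvg_cst|exact: norm_continuous].
- by move=> x /=; rewrite normrN.
apply: lte_mul_pinfty => //.
have mp : measurable [set x : R | 0 <= x]%R by rewrite -set_itvcy.
apply: (@le_lt_trans _ _ (\int[@lebesgue_measure R]_x ((c^-1)%:E * (exponential_pdf c x)%:E))).
  rewrite [leLHS]integral_mkcond; apply: ge0_le_integral => //.
  - by move=> x _; rewrite patchE; case: ifP => // _; rewrite lee_fin expR_ge0.
  - apply/(measurable_restrictT _ mp); apply/measurable_EFinP.
    apply: measurable_funTS; apply: measurableT_comp => //.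
    by apply: measurable_funM => //; apply: measurableT_comp.
  - apply: emeasurable_funM => //; apply/measurable_EFinP.
    exact: measurable_exponential_pdf.
  move=> x _; rewrite patchE; case: ifPn => x0.
    rewrite inE/= in x0.
    by rewrite -EFinM lee_fin exponential_pdfE// ger0_norm// mulrA mulVf ?mul1r// gt_eqF.
  by rewrite mule_ge0// lee_fin ?invr_ge0 ?exponential_pdf_ge0 1?ltW.
rewrite ge0_integralZl//; last 3 first.
- by apply/measurable_EFinP; exact: measurable_exponential_pdf.
- by move=> x _; rewrite lee_fin exponential_pdf_ge0// ltW.
- by rewrite lee_fin invr_ge0 ltW.
by rewrite integral_exponential_pdf// mule1 ltry.
Qed.

Context {N k : nat}.
Local Notation V := 'rV[R]_N.

Definition simplex0 (y : k.-tuple V) : k.+1.-tuple V := [tuple of 0%R :: y].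

Lemma measurable_simplex0 : measurable_fun [set: k.-tuple V] simplex0.
Proof. by apply: (@measurable_cons _ _ _ _ (fun=> 0%R : V) _ id). Qed.

Definition inside0 (y : k.-tuple V) : R := (center_indicator k (vertices (simplex0 y)))%:R.
Definition rad0 (y : k.-tuple V) : R := cradius (simplex0 y).

Lemma measurable_inside0 : measurable_fun [set: k.-tuple V] inside0.
Proof.
apply: measurable_bool_natr.
exact: (measurableT_comp measurable_center_indicator measurable_simplex0).
Qed.

Lemma measurable_rad0 : measurable_fun [set: k.-tuple V] rad0.
Proof. exact: (measurableT_comp measurable_radius measurable_simplex0). Qed.

Lemma inside0_ge0 y : (0 <= inside0 y)%R.
Proof. by rewrite ler0n. Qed.

Lemma coord_le_rad0 (y : k.-tuple V) (i : 'I_k) (j : 'I_N) :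
  center_indicator k (vertices (simplex0 y)) ->
  (`|tnth y i ord0 j| <= 2 * rad0 y)%R.
Proof.
move=> /center_indicator_det d0.
have h1 := coord_le_enorm (tnth (simplex0 y) (lift ord0 i) - ccenter (simplex0 y)) j.
have h2 := coord_le_enorm (tnth (simplex0 y) ord0 - ccenter (simplex0 y)) j.
move: h1 h2; rewrite !enorm_center// tnthS tnth0 -/(rad0 y) !mxE.
rewrite !ler_norml; lra.
Qed.

(** When the center is interior, all coordinates of the vertices are bounded by twice the radius.
The integrand is then dominated by a product of functions of one coordinate each. *)
Lemma limit_integrand_lty (c : R) : (0 < N)%N -> (0 < k)%N -> (0 < c)%R ->
  \int[power_measure (lebesgue_row N) k]_y
     (inside0 y * expR (- c * rad0 y ^+ N))%:E < +oo.
Proof.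
move=> N0 k0 c0.
pose c' := (c / (2 * k%:R * N%:R))%R.
have kN0 : (0 < 2 * k%:R * N%:R :> R)%R by rewrite !mulr_gt0// ltr0n.
have c'0 : (0 < c')%R by rewrite divr_gt0.
pose F (v : V) : \bar R := \prod_(j < N) (expR (- c' * `|v ord0 j|))%:E.
have F0 v : 0 <= F v by apply: prode_ge0 => j _; rewrite lee_fin expR_ge0.
have FE v : F v = (\prod_(j < N) expR (- c' * `|v ord0 j|))%:E by rewrite /F prodEFin.
have mF : measurable_fun setT F.
  rewrite (_ : F = EFin \o (fun v : V => \prod_(j < N) expR (- c' * `|v ord0 j|))%R); last first.
    by apply/funext => v; rewrite FE.
  apply/measurable_EFinP; apply: measurable_prod => j _.
  apply: measurableT_comp => //; apply: measurable_funM => //.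
  by apply: measurableT_comp => //; exact: measurable_row_coord.
have m1 : measurable_fun setT (fun x : measurableTypeR R => (expR (- c' * `|x|))%:E).
  apply/measurable_EFinP; apply: measurableT_comp => //; exact: measurable_funM.
have mprodF : measurable_fun [set: k.-tuple V]
    (fun y : k.-tuple V => \prod_(i < k) F (tnth y i)).
  rewrite (_ : (fun y : k.-tuple V => _) = EFin \o (fun y : k.-tuple V =>
    \prod_(i < k) \prod_(j < N) expR (- c' * `|tnth y i ord0 j|))%R); last first.
    by apply/funext => y /=; rewrite -prodEFin; apply: eq_bigr => i _; rewrite FE.
  apply/measurable_EFinP; apply: measurable_prod => i _; apply: measurable_prod => j _.
  apply: measurableT_comp => //; apply: measurable_funM => //.
  apply: measurableT_comp => //; apply: measurable_fun_coord; exact: measurable_tnth.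
have prodF0 (y : k.-tuple V) : [set: k.-tuple V] y -> 0 <= \prod_(i < k) F (tnth y i).
  by move=> _; apply: prode_ge0.
have expc0 : 0 <= (expR c)%:E by rewrite lee_fin expR_ge0.
apply: (@le_lt_trans _ _ (\int[power_measure (lebesgue_row N) k]_y
   ((expR c)%:E * \prod_(i < k) F (tnth y i)))).
  apply: ge0_le_integral => //.
  - by move=> y _; rewrite lee_fin mulr_ge0 ?inside0_ge0 ?expR_ge0.
  - apply/measurable_EFinP; apply: measurable_funM; first exact: measurable_inside0.
    apply: measurableT_comp => //; apply: measurable_funM => //.
    by apply: measurable_funX; exact: measurable_rad0.
  - exact: emeasurable_funM.
  move=> y _; under eq_bigr do rewrite FE.
  rewrite prodEFin -EFinM lee_fin.
  rewrite /inside0; case: (boolP (center_indicator k _)) => hy; last first.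
    by rewrite mul0r mulr_ge0 ?expR_ge0// prodr_ge0// => i _; rewrite prodr_ge0// => j _; exact: expR_ge0.
  rewrite mul1r.
  under eq_bigr do rewrite -expR_sum.
  rewrite -expR_sum -expRD ler_expR.
  have r0 : (0 <= rad0 y)%R by exact: radius_ge0.
  have rN : (rad0 y - 1 <= rad0 y ^+ N)%R.
    have [r1|r1] := leP 1%R (rad0 y).
      apply: (@le_trans _ _ (rad0 y)); first by rewrite gerBl.
      by apply: ler_eXnr.
    by apply: (@le_trans _ _ 0%R); rewrite ?exprn_ge0// subr_le0 ltW.
  have s1 : (\sum_(i < k) \sum_(j < N) (- c' * `|tnth y i ord0 j|) >= - c * rad0 y)%R.
    rewrite (_ : - c * rad0 y = \sum_(i < k) \sum_(j < N) (- c' * (2 * rad0 y)))%R.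
      apply: ler_sum => i _; apply: ler_sum => j _; rewrite ler_nM2l ?oppr_lt0//.
      exact: coord_le_rad0.
    rewrite !sumr_const !card_ord -[RHS]mulr_natr -[X in _ = (X * _)%R]mulr_natr /c'; field.
    by rewrite !pnatr_eq0 -!lt0n N0 k0.
  move: s1; set s := (\sum_(i < k) _)%R => s1.
  have : (c * (rad0 y - 1) <= c * rad0 y ^+ N)%R by rewrite ler_pM2l.
  lra.
have Fint : \int[lebesgue_row N]_v F v =
    \prod_(j < N) \int[@lebesgue_measure R]_x (expR (- c' * `|x|))%:E.
  rewrite ge0_integral_lebesgue_row//.
  rewrite -(@power_measure_prod _ _ _ (@lebesgue_measure R) N
    (fun _ x => (expR (- c' * `|x|))%:E)) //.
  by apply: eq_integral => t _; apply: eq_bigr => j _; rewrite mxE.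
rewrite ge0_integralZl//.
apply: lte_mul_pinfty; rewrite ?lee_fin ?expR_ge0//.
rewrite (power_measure_prod (lebesgue_row N) (F := fun=> F))// Fint.
have Ifin : \int[@lebesgue_measure R]_x (expR (- c' * `|x|))%:E \is a fin_num.
  rewrite ge0_fin_numE; first exact: integral_exp_abs_lty.
  by apply: integral_ge0 => x _; rewrite lee_fin expR_ge0.
by rewrite -(fineK Ifin) !prodEFin ltry.
Qed.

End limit_integrability.

(** * The rescaled expectation *)

Lemma abs_integral_diff {d : measure_display} {T : measurableType d} {R : realType}
    (m : {measure set T -> \bar R}) (f g : T -> R) (a b : R) :
  measurable_fun setT f -> measurable_fun setT g ->
  (forall x, 0 <= f x) -> (forall x, 0 <= g x) ->
  (\int[m]_x (f x)%:E = a%:E)%E -> (\int[m]_x (g x)%:E = b%:E)%E ->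
  ((`|a - b|)%:E <= \int[m]_x (`|f x - g x|)%:E)%E.
Proof.
move=> mf mg f0 g0 fa gb.
have mfg : measurable_fun setT (fun x => (`|f x - g x|)%:E).
  by apply/measurable_EFinP; apply: measurableT_comp => //; exact: measurable_funB.
have key (u v : T -> R) (p q : R) : measurable_fun setT u -> measurable_fun setT v ->
    (forall x, 0 <= u x) -> (forall x, 0 <= v x) ->
    (forall x, u x <= v x + `|f x - g x|) ->
    (\int[m]_x (u x)%:E = p%:E)%E -> (\int[m]_x (v x)%:E = q%:E)%E ->
    ((p - q)%:E <= \int[m]_x (`|f x - g x|)%:E)%E.
  move=> mu mv u0 v0 uv up vq.
  rewrite EFinB leeBlDr// -up -vq addeC -ge0_integralD//; last 2 first.
  - by move=> x _; rewrite lee_fin.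
  - by apply/measurable_EFinP.
  apply: ge0_le_integral => //.
  - by move=> x _; rewrite lee_fin.
  - by apply/measurable_EFinP.
  - by apply: emeasurable_funD => //; apply/measurable_EFinP.
  - by move=> x _; rewrite -EFinD lee_fin.
have [ab|ba] := leP b a.
  rewrite (ger0_norm (x := a - b)) ?subr_ge0//.
  apply: (key f g) => // x.
  by have := ler_norm (f x - g x); lra.
rewrite distrC (ger0_norm (x := b - a)); last by rewrite subr_ge0 ltW.
apply: (key g f) => // x.
by have := ler_norm (g x - f x); rewrite distrC; lra.
Qed.

Section rescaled_expectation.
Context {R : realType} {N k : nat}.
Local Notation V := 'rV[R]_N.
Variables (mu : probability V R) (kappa : V -> R) (L M m0 : R).
Hypothesis gd : good_density mu kappa L M m0.
Hypothesis k0 : (0 < k)%N.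
Local Open Scope ereal_scope.

Let M0 : (0 < M)%R. Proof. exact: lt_le_trans (gd_M1 gd). Qed.
Let mkappa := gd_meas gd.
Let kappa0 := gd_ge0 gd.
Let kappaM := gd_le gd.
Let om : R := unit_ball_volume N.

Lemma kappa_translation_continuous : translation_continuous kappa.
Proof.
apply: (translation_continuous_bounded (gd_L gd) M0 mkappa).
  by move=> x; rewrite kappa0 kappaM.
exact: (gd_cube gd).
Qed.

Definition small (r : R) (x : k.+1.-tuple V) : bool :=
  center_indicator k (vertices x) && (cradius x <= r)%R.

Lemma measurable_small r : measurable_fun [set: k.+1.-tuple V] (small r).
Proof.
apply: measurable_and; first exact: measurable_center_indicator.
by apply: measurable_fun_ler => //; exact: measurable_radius.
Qed.

(** The conditional probability, given the vertices [x], that [q] further points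
avoid the circumball of [x]. *)
Definition weight (r : R) (q : nat) (x : k.+1.-tuple V) : R :=
  ((small r x)%:R * (1 - ball_mass mu x) ^+ q)%R.

Lemma weight_ge0 r q x : (0 <= weight r q x)%R.
Proof. by rewrite mulr_ge0// exprn_ge0// subr_ge0 ball_mass_le1. Qed.

Lemma weight_le1 r q x : (weight r q x <= 1)%R.
Proof.
rewrite /weight mulr_ile1 ?exprn_ge0 ?subr_ge0 ?ball_mass_le1//; first by case: (small _ _).
by rewrite exprn_ile1 ?subr_ge0 ?ball_mass_le1// gerBl ball_mass_ge0.
Qed.

Lemma measurable_weight r q : measurable_fun [set: k.+1.-tuple V] (weight r q).
Proof.
apply: measurable_funM; first by apply: measurable_bool_natr; exact: measurable_small.
by apply: measurable_funX; apply: measurable_funB => //; exact: measurable_ball_mass.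
Qed.

Definition expected_weight r q := \int[power_measure mu k.+1]_x (weight r q x)%:E.

Definition zoom (e : R) (x : V) (y : k.-tuple V) : k.+1.-tuple V :=
  map_tuple (fun v => x + e *: v)%R (simplex0 y).

Lemma measurable_zoom e : measurable_fun [set: V * k.-tuple V]
  (fun p : V * k.-tuple V => zoom e p.1 p.2).
Proof.
apply/measurable_fun_tnthP => i.
rewrite (_ : _ \o _ = fun p : V * k.-tuple V => (p.1 + e *: tnth (simplex0 p.2) i)%R); last first.
  by apply/funext => p /=; rewrite tnth_map.
apply: measurable_rowD => //; apply: measurable_rowZ => //.
apply: (@measurableT_comp _ _ _ _ _ _ (fun x : k.+1.-tuple V => tnth x i)).
  exact: measurable_tnth.
exact: (measurableT_comp measurable_simplex0 measurable_snd).
Qed.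

(** The density of the edges of the rescaled simplex with first vertex [x], times the probability
that its circumball is empty. *)
Definition zoom_integrand r q (e : R) (x : V) (y : k.-tuple V) : R :=
  (\prod_(i < k) kappa (x + e *: tnth y i) * weight r q (zoom e x y))%R.

Lemma measurable_zoom_integrand r q e : measurable_fun [set: V * k.-tuple V]
  (fun p : V * k.-tuple V => zoom_integrand r q e p.1 p.2).
Proof.
apply: measurable_funM.
  apply: measurable_prod => i _; apply: (measurableT_comp mkappa).
  apply: measurable_rowD => //; apply: measurable_rowZ => //.
  apply: (@measurableT_comp _ _ _ _ _ _ (fun x : k.-tuple V => tnth x i)) => //.
  exact: measurable_tnth.
exact: (measurableT_comp (measurable_weight r q) (measurable_zoom e)).
Qed.

Lemma zoom_integrand_ge0 r q e x y : (0 <= zoom_integrand r q e x y)%R.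
Proof. by rewrite mulr_ge0 ?weight_ge0// prodr_ge0// => i _; exact: kappa0. Qed.

(** The substitution [x_i = x + e y_i] in all vertices but the first, which keeps its law. *)
Lemma expected_weight_zoom r q (e : R) : (0 < e)%R ->
  expected_weight r q = ((e ^+ N) ^+ k)%:E *
    \int[power_measure (lebesgue_row N) k]_y \int[mu]_x (zoom_integrand r q e x y)%:E.
Proof.
move=> e0.
have mw := measurable_weight r q.
have mwE : measurable_fun [set: k.+1.-tuple V] (EFin \o weight r q).
  by apply/measurable_EFinP.
have w0 x : 0 <= (EFin \o weight r q) x by rewrite lee_fin weight_ge0.
have mzi := measurable_zoom_integrand r q e.
have mziE : measurable_fun [set: V * k.-tuple V]
   (fun p : V * k.-tuple V => (zoom_integrand r q e p.1 p.2)%:E).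
  by apply/measurable_EFinP.
have zi0 (p : V * k.-tuple V) : 0 <= (zoom_integrand r q e p.1 p.2)%:E.
  by rewrite lee_fin zoom_integrand_ge0.
rewrite -(fubini_tonelli (m1 := mu) (m2 := power_measure (lebesgue_row N) k)
  (fun p : V * k.-tuple V => (zoom_integrand r q e p.1 p.2)%:E))//.
rewrite -ge0_integralZl//; last 3 first.
- exact: (measurable_fun_fubini_tonelli_F (m2 := power_measure (lebesgue_row N) k)
    (fun p : V * k.-tuple V => (zoom_integrand r q e p.1 p.2)%:E)).
- by move=> x _; apply: integral_ge0 => y _; rewrite lee_fin zoom_integrand_ge0.
- by rewrite lee_fin !exprn_ge0// ltW.
rewrite /expected_weight (ge0_integral_power_measureS mu mwE w0).
apply: eq_integral => x _.
have mwx : measurable_fun [set: k.-tuple V] (fun t : k.-tuple V => (weight r q [tuple of x :: t])%:E).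
  exact: (measurable_fun_consl x mwE).
rewrite (integral_dens_tuple gd)//.
pose F (t : k.-tuple V) := (\prod_(i < k) kappa (tnth t i))%:E * (weight r q [tuple of x :: t])%:E.
have mF : measurable_fun [set: k.-tuple V] F.
  apply: emeasurable_funM => //; apply/measurable_EFinP; apply: measurable_prod => i _.
  by apply: (measurableT_comp mkappa); exact: measurable_tnth.
have F0 t : 0 <= F t.
  by rewrite /F -EFinM lee_fin mulr_ge0 ?weight_ge0// prodr_ge0.
have affF := lebesgue_row_tuple_affine x e0 mF F0.
apply: (etrans (esym affF)).
have -> : \int[power_measure (lebesgue_row N) k]_y F (map_tuple (fun v => x + e *: v)%R y) =
    \int[power_measure (lebesgue_row N) k]_y (zoom_integrand r q e x y)%:E; last by [].
apply: eq_integral => y _.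
rewrite /F -EFinM /zoom_integrand; congr ((_ * weight r q _)%:E)%R.
  by apply: eq_bigr => i _; rewrite tnth_map.
apply: eq_from_tnth => i; rewrite tnth_map.
case: (unliftP ord0 i) => [j|] ->; rewrite !(tnthS, tnth0) ?tnth_map//.
by rewrite scaler0 addr0.
Qed.

(** The limit of [zoom_integrand] when [e] tends to 0 and [q e^N = 1], at a point where [kappa] is
continuous: all vertices see the density at [x], and the number of points in the circumball is
Poisson. *)
Definition limit_integrand (x : V) (y : k.-tuple V) : R :=
  (kappa x ^+ k * (inside0 y * expR (- (kappa x * (om * rad0 y ^+ N)))))%R.

Lemma limit_integrand_ge0 x y : (0 <= limit_integrand x y)%R.
Proof. by rewrite !mulr_ge0 ?exprn_ge0 ?inside0_ge0 ?expR_ge0. Qed.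

Lemma measurable_limit_integrand : measurable_fun [set: V * k.-tuple V]
  (fun p : V * k.-tuple V => limit_integrand p.1 p.2).
Proof.
have mk : measurable_fun [set: V * k.-tuple V] (fun p : V * k.-tuple V => kappa p.1).
  exact: (measurableT_comp mkappa).
apply: measurable_funM; first exact: measurable_funX.
apply: measurable_funM.
  exact: (measurableT_comp measurable_inside0 measurable_snd).
apply: measurableT_comp => //; apply: measurableT_comp => //.
apply: measurable_funM => //; apply: measurable_funM => //; apply: measurable_funX.
exact: (measurableT_comp measurable_rad0 measurable_snd).
Qed.

Lemma measurable_affine_tuple (z : V) (s : R) : measurable_fun [set: k.-tuple V]
  (fun y : k.-tuple V => map_tuple (fun v => z + s *: v)%R y).
Proof.
apply/measurable_fun_tnthP => i.
rewrite (_ : _ \o _ = fun y : k.-tuple V => (z + s *: tnth y i)%R); last first.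
  by apply/funext => p /=; rewrite tnth_map.
apply: measurable_rowD => //; apply: measurable_rowZ => //; exact: measurable_tnth.
Qed.

(** Rescaling [y] by the [N]-th root of [kappa x] removes the density from the exponential and
produces the factor [kappa x ^+ k]: this is why the limit does not depend on the density. *)
Lemma limit_integral :
  \int[power_measure (lebesgue_row N) k]_y \int[mu]_x (limit_integrand x y)%:E =
  \int[power_measure (lebesgue_row N) k]_y
     (inside0 y * expR (- om * rad0 y ^+ N))%:E.
Proof.
have mli := measurable_limit_integrand.
have mliE : measurable_fun [set: V * k.-tuple V]
   (fun p : V * k.-tuple V => (limit_integrand p.1 p.2)%:E).
  by apply/measurable_EFinP.
rewrite -(fubini_tonelli (m1 := mu) (m2 := power_measure (lebesgue_row N) k)
  (fun p : V * k.-tuple V => (limit_integrand p.1 p.2)%:E))//; last first.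
  by move=> p; rewrite lee_fin limit_integrand_ge0.
set G := RHS.
have G0 : 0 <= G.
  by apply: integral_ge0 => y _; rewrite lee_fin mulr_ge0 ?inside0_ge0 ?expR_ge0.
transitivity (\int[mu]_(x in [set x | kappa x != 0%R]) G); last first.
  have cstE (H : \bar R) : \int[mu]_(x in [set x | kappa x != 0%R]) H = H.
    have mS := measurable_supp gd.
    have -> : \int[mu]_(x in [set x | kappa x != 0%R]) H = H * mu [set x | kappa x != 0%R].
      exact: integral_cst.
    by rewrite (mu_supp gd) mule1.
  exact: cstE.
rewrite [RHS]integral_mkcond.
apply: eq_integral => x _; rewrite patchE; case: ifPn => xS; last first.
  rewrite integral0_eq// => y _; move: xS; rewrite notin_setE /= => /negP/negPn/eqP kx0.
  by rewrite /limit_integrand kx0 expr0n gtn_eqF// mul0r.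
rewrite inE /= in xS.
have kx : (0 < kappa x)%R by rewrite lt_neqAle eq_sym xS kappa0.
have N0 := gd_N gd.
pose s := (kappa x `^ (N%:R^-1))%R.
have sN : (s ^+ N = kappa x)%R.
  by rewrite -powR_mulrn ?powR_ge0// -powRrM mulVf ?powRr1 ?pnatr_eq0 -?lt0n// ltW.
have s0 : (0 < s)%R by rewrite powR_gt0.
pose H (y : k.-tuple V) := (inside0 y * expR (- om * rad0 y ^+ N))%:E.
have mH : measurable_fun [set: k.-tuple V] H.
  apply/measurable_EFinP; apply: measurable_funM; first exact: measurable_inside0.
  apply: measurableT_comp => //; apply: measurable_funM => //.
  by apply: measurable_funX; exact: measurable_rad0.
have H0 y : 0 <= H y by rewrite lee_fin mulr_ge0 ?inside0_ge0 ?expR_ge0.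
have mHs : measurable_fun [set: k.-tuple V]
    (fun y : k.-tuple V => H (map_tuple (fun v => 0 + s *: v)%R y)).
  exact: (measurableT_comp mH (measurable_affine_tuple _ _)).
apply: (etrans _ (lebesgue_row_tuple_affine 0%R s0 mH H0)).
rewrite sN -ge0_integralZl//; last first.
  by rewrite lee_fin exprn_ge0.
apply: eq_integral => y _; rewrite -EFinM /limit_integrand; congr EFin; congr (_ * _)%R.
have sE : simplex0 (map_tuple (fun v : V => 0 + s *: v)%R y) = zoom s 0%R y.
  apply: eq_from_tnth => i; rewrite tnth_map.
  case: (unliftP ord0 i) => [j|] ->; rewrite !(tnthS, tnth0) ?tnth_map//.
  by rewrite scaler0 addr0.
rewrite /inside0 /rad0 sE /zoom center_indicator_affine//.
case: (boolP (center_indicator _ _)) => h; last by rewrite !mul0r.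
rewrite !mul1r; congr expR.
by rewrite radius_affine ?center_indicator_det// exprMn sN; ring.
Qed.

Lemma mu_indicE (A : set V) : measurable A ->
  mu A = \int[lebesgue_row N]_x (kappa x * \1_A x)%:E.
Proof.
move=> mA; rewrite -[LHS](_ : \int[mu]_x (\1_A x)%:E = _); last first.
  by rewrite integral_indic// setIT.
rewrite (integral_dens gd)//; last first.
  by apply/measurable_EFinP; exact: measurable_indic.
Qed.

Section zoomed_ball.
Variables (y : k.-tuple V) (e : R) (q : nat).
Hypotheses (e0 : (0 < e)%R) (qe : (q%:R * e ^+ N = 1)%R).
Hypothesis hy : center_indicator k (vertices (simplex0 y)).

Let B : set V := closed_eball (ccenter (simplex0 y)) (rad0 y).
Let vol : R := (om * rad0 y ^+ N)%R.

Let rad0_gt0 : (0 < rad0 y)%R. Proof. exact: radius_gt0. Qed.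

Let mB : measurable B. Proof. exact: measurable_closed_eball. Qed.

Let volE : lebesgue_row N B = vol%:E.
Proof. exact: lebesgue_row_eball. Qed.

Let indB : \int[lebesgue_row N]_z (\1_B z : R)%:E = vol%:E.
Proof. by rewrite integral_indic// setIT; exact: volE. Qed.

Lemma vol_ge0 : (0 <= vol)%R.
Proof. by rewrite mulr_ge0 ?unit_ball_volume_ge0// exprn_ge0// ltW. Qed.

Lemma ball_mass_zoom x :
  \int[lebesgue_row N]_z (kappa (x + e *: z) * \1_B z)%:E =
  (q%:R * ball_mass mu (zoom e x y))%:E.
Proof.
have d0 := center_indicator_det hy.
have mBx : measurable (closed_eball (ccenter (zoom e x y)) (cradius (zoom e x y)) : set V).
  exact: measurable_closed_eball.
rewrite EFinM ball_massE mu_indicE//.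
rewrite -[X in _ = (_ * X)](lebesgue_row_affine x e0); last 2 first.
- apply/measurable_EFinP; apply: measurable_funM => //; exact: measurable_indic.
- by move=> z; rewrite lee_fin mulr_ge0.
rewrite muleA -EFinM qe mul1e; apply: eq_integral => z _.
congr (_ * _)%:E; rewrite !indicE.
suff -> : (x + e *: z \in closed_eball (ccenter (zoom e x y)) (cradius (zoom e x y)))%R =
  (z \in B) :> bool by [].
rewrite /zoom radius_affine// center_affine//.
have h : (enorm (x + e *: z - (x + e *: ccenter (simplex0 y))) <= e * rad0 y)%R =
   (enorm (z - ccenter (simplex0 y)) <= rad0 y)%R.
  rewrite opprD addrACA subrr add0r -scalerBr enormZ gtr0_norm//.
  by rewrite ler_pM2l.
by apply/idP/idP; rewrite !inE /B /closed_eball/= h.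
Qed.

Lemma zoomed_mass_dist x :
  (`|q%:R * ball_mass mu (zoom e x y) - kappa x * vol|)%:E <=
  \int[lebesgue_row N]_z (`|kappa (e *: z + x) - kappa x| * \1_B z)%:E.
Proof.
have mk : measurable_fun setT (fun z : V => kappa (x + e *: z)).
  apply: (measurableT_comp mkappa); apply: measurable_rowD => //.
  exact: measurable_rowZ.
apply: (le_trans (abs_integral_diff (m := lebesgue_row N)
    (f := fun z => (kappa (x + e *: z) * \1_B z)%R) (g := fun z => (kappa x * \1_B z)%R)
    _ _ _ _ (ball_mass_zoom x) _)).
- by apply: measurable_funM => //; exact: measurable_indic.
- by apply: measurable_funM => //; exact: measurable_indic.
- by move=> z; rewrite mulr_ge0.
- by move=> z; rewrite mulr_ge0.
- under eq_integral do rewrite EFinM.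
  rewrite ge0_integralZl//; last 2 first.
  + by apply/measurable_EFinP; exact: measurable_indic.
  + by rewrite lee_fin.
  by rewrite indB EFinM.
- rewrite le_eqVlt; apply/orP; left; apply/eqP; apply: eq_integral => z _; congr EFin.
  by rewrite -mulrBl normrM [(e *: z + x)%R]addrC (ger0_norm (x := \1_B z)).
Qed.

(** The densities at the vertices are first replaced by [kappa x], then the probability of an
empty ball by its Poisson limit. *)
Lemma zoom_pointwise (r : R) x : (e * rad0 y <= r)%R ->
  (`|zoom_integrand r q e x y - limit_integrand x y| <=
   M ^+ k * (\sum_(i < k) `|kappa (e *: tnth y i + x) - kappa x|) +
   M ^+ k * ((M * vol) ^+ 2 * e ^+ N +
     `|q%:R * ball_mass mu (zoom e x y) - kappa x * vol|))%R.
Proof.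
move=> er; have d0 := center_indicator_det hy.
have radE : cradius (zoom e x y) = (e * rad0 y)%R by rewrite /zoom radius_affine.
rewrite /zoom_integrand /weight /small radE er andbT /limit_integrand /inside0.
rewrite {1}/zoom center_indicator_affine// hy !mul1r -/vol.
set u := ball_mass mu (zoom e x y).
have u01 : (0 <= u <= 1)%R by rewrite ball_mass_ge0 ball_mass_le1.
have uM : (u <= M * vol * e ^+ N)%R.
  apply: (le_trans (ball_mass_le gd _)); first by rewrite radE mulr_gt0.
  by rewrite radE exprMn /vol le_eqVlt; apply/orP; left; apply/eqP; rewrite -/om; ring.
have qu2 : (q%:R * u ^+ 2 <= (M * vol) ^+ 2 * e ^+ N)%R.
  apply: (@le_trans _ _ (q%:R * (M * vol * e ^+ N) ^+ 2)%R).
    apply: ler_wpM2l => //; apply: lerXn2r; rewrite ?nnegrE//; first by case/andP: u01.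
    by apply: le_trans uM; case/andP: u01.
  by rewrite (_ : q%:R * _ = (M * vol) ^+ 2 * e ^+ N * (q%:R * e ^+ N))%R; [rewrite qe mulr1|ring].
have kMi z : (0 <= kappa z <= M)%R by rewrite kappa0 kappaM.
have P1 := @prod_diff_le _ k (fun i => kappa (x + e *: tnth y i)) (fun=> kappa x) M
  (gd_M1 gd) (fun i => kMi _) (fun i => kMi _).
have P2 := @binomial_poisson _ u (kappa x * vol) q u01 (mulr_ge0 (kappa0 x) vol_ge0).
move: P1; rewrite prodr_const card_ord.
set Pz := (\prod_(i < k) _)%R; set w := ((1 - u) ^+ q)%R; set ex := expR _ => P1.
have -> : (Pz * w - kappa x ^+ k * ex = (Pz - kappa x ^+ k) * w + kappa x ^+ k * (w - ex))%R.
  ring.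
apply: (le_trans (ler_normD _ _)); rewrite !normrM; apply: lerD.
  have w1 : (`|w| <= 1)%R.
    case/andP: u01 => u0 u1.
    by rewrite ger0_norm ?exprn_ge0 ?subr_ge0// exprn_ile1 ?subr_ge0// gerBl.
  apply: (@le_trans _ _ `|Pz - kappa x ^+ k|%R).
    by rewrite -[leRHS]mulr1; apply: ler_wpM2l.
  apply: (le_trans P1); rewrite le_eqVlt; apply/orP; left; apply/eqP; congr (_ * _)%R.
  by apply: eq_bigr => i _; rewrite [(e *: _ + x)%R]addrC.
apply: ler_pM => //.
  by rewrite ger0_norm ?exprn_ge0//; apply: lerXn2r; rewrite ?nnegrE// ltW.
apply: (le_trans P2); apply: lerD => //.
Qed.

(** Integration over [x] turns every difference of values of the density into an L1 distance
between translates of it. *)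
Lemma zoom_error (r eta : R) : (e * rad0 y <= r)%R -> (0 <= eta)%R ->
  (forall i, shift_dist kappa (e *: tnth y i) <= eta%:E) ->
  (forall z, B z -> shift_dist kappa (e *: z) <= eta%:E) ->
  \int[mu]_x (`|zoom_integrand r q e x y - limit_integrand x y|)%:E <=
  (M ^+ k * (M * (k%:R * eta)) + M ^+ k * ((M * vol) ^+ 2 * e ^+ N + M * (vol * eta)))%:E.
Proof.
move=> er eta0 hy1 hB.
pose D1 (x : V) : \bar R := \sum_(i < k) (`|kappa (e *: tnth y i + x) - kappa x|%R)%:E.
pose D (p : V * V) : \bar R := (`|kappa (e *: p.2 + p.1) - kappa p.1| * \1_B p.2)%:E.
pose D2 (x : V) : \bar R := \int[lebesgue_row N]_z D (x, z).
have D0 p : 0 <= D p by rewrite lee_fin mulr_ge0.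
have mD : measurable_fun [set: V * V] D.
  apply/measurable_EFinP; apply: measurable_funM.
    apply: measurableT_comp => //; apply: measurable_funB.
      apply: (measurableT_comp mkappa); apply: measurable_rowD => //.
      exact: measurable_rowZ.
    exact: (measurableT_comp mkappa).
  apply: (@measurableT_comp _ _ _ _ _ _ (\1_B : V -> R) _ snd) => //.
have mD2 : measurable_fun setT D2.
  exact: (measurable_fun_fubini_tonelli_F (m2 := lebesgue_row N) D).
have D20 x : 0 <= D2 x by apply: integral_ge0.
have mD1 : measurable_fun setT D1.
  by apply: emeasurable_sum => i; exact: measurable_shift_diff.
have D10 x : 0 <= D1 x by apply: sume_ge0 => i _; rewrite lee_fin.
have Mk0 : 0 <= (M ^+ k)%:E by rewrite lee_fin exprn_ge0// ltW.
set C := ((M * vol) ^+ 2 * e ^+ N)%R.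
have C0 : 0 <= C%:E by rewrite lee_fin mulr_ge0 ?sqr_ge0// exprn_ge0// ltW.
have mC2 : measurable_fun [set: V] (fun x => C%:E + D2 x) by exact: emeasurable_funD.
have mzl : measurable_fun [set: V]
    (fun x => (`|zoom_integrand r q e x y - limit_integrand x y|)%:E).
  apply/measurable_EFinP; apply: measurableT_comp => //; apply: measurable_funB.
    exact: (measurableT_comp (measurable_zoom_integrand r q e) (measurable_pair2 y)).
  exact: (measurableT_comp measurable_limit_integrand (measurable_pair2 y)).
have m1 : measurable_fun [set: V] (fun x => (M ^+ k)%:E * D1 x) by exact: emeasurable_funM.
have m2 : measurable_fun [set: V] (fun x => (M ^+ k)%:E * (C%:E + D2 x)).
  exact: emeasurable_funM.
apply: (@le_trans _ _ (\int[mu]_x ((M ^+ k)%:E * D1 x + (M ^+ k)%:E * (C%:E + D2 x)))).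
  apply: ge0_le_integral; [by []|by move=> x _; rewrite lee_fin|exact: mzl| |].
    exact: emeasurable_funD.
  move=> x _; have := zoom_pointwise x er; rewrite -lee_fin EFinD !EFinM => /le_trans; apply.
  apply: leeD; rewrite lee_pmul2l ?lte_fin ?exprn_gt0//.
    by rewrite /D1 sumEFin.
  rewrite EFinD; apply: leeD2l.
  exact: zoomed_mass_dist.
have E1 : \int[mu]_x D1 x <= (M * (k%:R * eta))%:E.
  apply: (le_trans (integral_dens_le gd mD1 D10)).
  rewrite EFinM lee_pmul2l ?lte_fin// ge0_integral_sum//; last first.
    by move=> i; exact: measurable_shift_diff.
  apply: (@le_trans _ _ (\sum_(i < k) eta%:E)).
    by apply: lee_sum => i _; exact: hy1.
  by rewrite sumEFin sumr_const card_ord mulr_natl.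
have E2 : \int[mu]_x D2 x <= (M * (vol * eta))%:E.
  apply: (le_trans (integral_dens_le gd mD2 D20)).
  rewrite EFinM lee_pmul2l ?lte_fin//.
  rewrite (fubini_tonelli (m1 := lebesgue_row N) (m2 := lebesgue_row N) D)//.
  apply: (@le_trans _ _ (\int[lebesgue_row N]_z (eta%:E * (\1_B z)%:E))).
    apply: ge0_le_integral => //.
    - by move=> z _; exact: integral_ge0.
    - exact: (measurable_fun_fubini_tonelli_G (m1 := lebesgue_row N) D).
    - by apply: emeasurable_funM => //; apply/measurable_EFinP; exact: measurable_indic.
    move=> z _; rewrite /D /=.
    have [Bz|nBz] := pselect (B z); last first.
      rewrite indicE memNset//= mule0 integral0_eq// => x _.
      by rewrite mulr0.
    rewrite indicE mem_set// mule1.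
    by under eq_integral do rewrite mulr1; exact: hB.
  rewrite ge0_integralZl//; last by apply/measurable_EFinP; exact: measurable_indic.
  by rewrite indB -EFinM lee_fin mulrC.
rewrite ge0_integralD//; last 2 first.
- by move=> x _; rewrite mule_ge0.
- by move=> x _; rewrite mule_ge0// adde_ge0.
rewrite EFinD; apply: leeD.
  rewrite ge0_integralZl// EFinM lee_pmul2l// lte_fin exprn_gt0//.
rewrite ge0_integralZl//; last by move=> x _; rewrite adde_ge0.
rewrite [leRHS]EFinM lee_pmul2l ?lte_fin ?exprn_gt0// ge0_integralD// EFinD.
apply: leeD => //.
by rewrite integral_cst_probability.
Qed.

End zoomed_ball.

Lemma zoom_integrand_le r q e x y : (zoom_integrand r q e x y <= M ^+ k)%R.
Proof.
rewrite -[leRHS]mulr1; apply: ler_pM; rewrite ?weight_ge0 ?weight_le1 ?prodr_ge0//.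
rewrite -[X in (M ^+ X)%R](card_ord k) -prodr_const; apply: ler_prod => i _.
by rewrite kappa0 kappaM.
Qed.

Lemma limit_integrand_le x y : (limit_integrand x y <= M ^+ k)%R.
Proof.
rewrite -[leRHS]mulr1; apply: ler_pM; rewrite ?exprn_ge0 ?mulr_ge0 ?inside0_ge0 ?expR_ge0//.
  by apply: lerXn2r; rewrite ?nnegrE// ltW.
rewrite mulr_ile1 ?inside0_ge0 ?expR_ge0//; first by rewrite /inside0; case: (center_indicator _ _).
rewrite -[leRHS]expR0 ler_expR oppr_le0.
by rewrite !mulr_ge0// ?unit_ball_volume_ge0// exprn_ge0// radius_ge0.
Qed.

Lemma zoom_outside r q e x y : (0 < e)%R ->
  ~~ center_indicator k (vertices (simplex0 y)) -> zoom_integrand r q e x y = 0%R.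
Proof.
move=> e0 h; rewrite /zoom_integrand /weight /small /zoom center_indicator_affine//.
by rewrite (negbTE h) mul0r mulr0.
Qed.

Lemma coord_center0_le (y : k.-tuple V) j : center_indicator k (vertices (simplex0 y)) ->
  (`|ccenter (simplex0 y) ord0 j| <= rad0 y)%R.
Proof.
move=> /center_indicator_det d0.
rewrite /rad0 -(enorm_center ord0 d0) tnth0.
by apply: (le_trans _ (coord_le_enorm _ j)); rewrite !mxE sub0r normrN.
Qed.

(** Circumballs of interior simplices have mass at least [low_const] times the [N]-th power of
their radius; this bounds all rescaled integrands by one integrable function. *)
Lemma zoom_dominated r q e y : (0 < e)%R -> (q%:R * e ^+ N = 1)%R ->
  \int[mu]_x (zoom_integrand r q e x y)%:E <=
  (M ^+ k * (inside0 y * expR (- low_const kappa L m0 * rad0 y ^+ N)))%:E.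
Proof.
move=> e0 qe.
set C := (_ * _)%R.
have C0 : (0 <= C)%R by rewrite !mulr_ge0 ?exprn_ge0 ?inside0_ge0 ?expR_ge0// ltW.
have mz : measurable_fun [set: V] (fun x => (zoom_integrand r q e x y)%:E).
  apply/measurable_EFinP.
  exact: (measurableT_comp (measurable_zoom_integrand r q e) (measurable_pair2 y)).
have z0 x : 0 <= (zoom_integrand r q e x y)%:E by rewrite lee_fin zoom_integrand_ge0.
rewrite (integral_dens gd mz z0).
have -> : C%:E = \int[lebesgue_row N]_x ((kappa x)%:E * C%:E).
  rewrite -(integral_dens gd (h := fun=> C%:E))//.
  by rewrite integral_cst_probability.
apply: ge0_le_integral => //.
- by move=> x _; rewrite mule_ge0// lee_fin.
- by apply: emeasurable_funM => //; apply/measurable_EFinP.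
- by apply: emeasurable_funM => //; apply/measurable_EFinP.
move=> x _; have [kx0|kx0] := eqVneq (kappa x) 0%R; first by rewrite kx0 !mul0e.
rewrite lee_wpmul2l ?lee_fin//.
have [hy|hy] := boolP (center_indicator k (vertices (simplex0 y))); last by rewrite zoom_outside.
have [allS|/existsNP[i /negP/negPn/eqP ki]] := pselect (forall i, kappa (x + e *: tnth y i) != 0%R); last first.
  by rewrite /zoom_integrand (bigD1 i)//= ki !mul0r.
rewrite /zoom_integrand /C; apply: ler_pM; rewrite ?prodr_ge0 ?weight_ge0//.
  rewrite -[X in (M ^+ X)%R](card_ord k) -prodr_const; apply: ler_prod => i _.
  by rewrite kappa0 kappaM.
have hz : center_indicator k (vertices (zoom e x y)) by rewrite /zoom center_indicator_affine.
have Sz i : kappa (tnth (zoom e x y) i) != 0%R.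
  rewrite tnth_map; case: (unliftP ord0 i) => [j|] ->; rewrite ?tnthS ?tnth0//.
  by rewrite scaler0 addr0.
have := ball_mass_ge gd Sz hz.
have -> : cradius (zoom e x y) = (e * rad0 y)%R.
  by rewrite /zoom radius_affine// center_indicator_det.
set u := ball_mass _ _ => lu.
rewrite /weight /small /inside0 hz hy mul1r.
apply: (@le_trans _ _ ((1 - u) ^+ q)%R).
  rewrite ler_piMl ?exprn_ge0 ?subr_ge0 ?ball_mass_le1//; by case: (_ && _).
apply: (@le_trans _ _ (expR (- u) ^+ q)%R).
  apply: lerXn2r; rewrite ?nnegrE ?subr_ge0 ?ball_mass_le1 ?expR_ge0//.
  exact: expR_ge1Dx.
rewrite -expRM_natl ler_expR mulrN mulNr lerN2.
apply: (@le_trans _ _ (q%:R * (low_const kappa L m0 * (e * rad0 y) ^+ N))%R); last first.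
  exact: ler_wpM2l.
rewrite exprMn (_ : (q%:R * _)%R = (q%:R * e ^+ N) * (low_const kappa L m0 * rad0 y ^+ N))%R; last by ring.
by rewrite qe mul1r.
Qed.

Section limit.
Variables (e_ : nat -> R) (q_ : nat -> nat) (r_ : nat -> R).
Hypotheses (e0 : forall m, (0 < e_ m)%R) (ecvg : e_ m @[m --> \oo] --> (0 : R)%R).
Hypothesis qe : forall m, ((q_ m)%:R * e_ m ^+ N = 1)%R.
Hypothesis rcvg : forall A : R, \forall m \near \oo, (A * e_ m <= r_ m)%R.

Lemma near_small (a : R) : (0 < a)%R -> \forall m \near \oo, (e_ m <= a)%R.
Proof.
move=> a0; move/cvgrPdist_le : ecvg => /(_ _ a0); apply: filterS => m.
by rewrite sub0r normrN gtr0_norm.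
Qed.

Lemma zoom_cvg y :
  \int[mu]_x (zoom_integrand (r_ m) (q_ m) (e_ m) x y)%:E @[m --> \oo] -->
  \int[mu]_x (limit_integrand x y)%:E.
Proof.
have [hy|hy] := boolP (center_indicator k (vertices (simplex0 y))); last first.
  rewrite integral0_eq; last first.
    by move=> x _; rewrite /limit_integrand /inside0 (negbTE hy) mul0r mulr0.
  rewrite (_ : (fun m => _) = fun=> 0); first exact: cvg_cst.
  apply/funext => m; rewrite integral0_eq// => x _.
  by rewrite zoom_outside.
have mz m : measurable_fun [set: V] (fun x => zoom_integrand (r_ m) (q_ m) (e_ m) x y).
  exact: (measurableT_comp (measurable_zoom_integrand _ _ _) (measurable_pair2 y)).
have ml : measurable_fun [set: V] (fun x => limit_integrand x y).
  exact: (measurableT_comp measurable_limit_integrand (measurable_pair2 y)).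
have boundfin (f : V -> R) : measurable_fun setT f -> (forall x, 0 <= f x <= M ^+ k)%R ->
    \int[mu]_x (f x)%:E \is a fin_num.
  move=> mf fM; rewrite ge0_fin_numE; last first.
    by apply: integral_ge0 => x _; rewrite lee_fin; have /andP[] := fM x.
  apply: (@le_lt_trans _ _ (\int[mu]_x (M ^+ k)%:E)).
    apply: ge0_le_integral => //.
    - by move=> x _; rewrite lee_fin; have /andP[] := fM x.
    - exact/measurable_EFinP.
    - by move=> x _; rewrite lee_fin; have /andP[] := fM x.
  by rewrite integral_cst_probability ltry.
have finz m : \int[mu]_x (zoom_integrand (r_ m) (q_ m) (e_ m) x y)%:E \is a fin_num.
  by apply: boundfin => // x; rewrite zoom_integrand_ge0 zoom_integrand_le.
have finl : \int[mu]_x (limit_integrand x y)%:E \is a fin_num.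
  by apply: boundfin => // x; rewrite limit_integrand_ge0 limit_integrand_le.
rewrite -(fineK finl); apply/fine_cvgP; split; first by near=> m.
apply/cvgrPdist_le => eps eps0.
have hr := radius_gt0 k0 hy; rewrite -/(rad0 y) in hr.
pose vol := (om * rad0 y ^+ N)%R.
have v0 : (0 <= vol)%R by rewrite mulr_ge0 ?unit_ball_volume_ge0// exprn_ge0// ltW.
(* [zoom_error] gives the bound [K * eta + C * e_ m], each term of which is made at most [eps / 2] *)
pose K := (M ^+ k * (M * k%:R) + M ^+ k * (M * vol) + 1)%R.
have Mk : (0 < M ^+ k)%R by rewrite exprn_gt0.
have Mk' := ltW Mk; have M0' := ltW M0.
have K0 : (0 < K)%R.
  by rewrite ltr_wpDl//; apply: addr_ge0; apply: mulr_ge0 => //; exact: mulr_ge0.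
pose eta := (eps / (2 * K))%R.
have eta0 : (0 < eta)%R by rewrite divr_gt0// mulr_gt0.
have [delta d0 hdelta] := kappa_translation_continuous eta0.
pose C := (M ^+ k * (M * vol) ^+ 2 + 1)%R.
have C0 : (0 < C)%R by rewrite ltr_wpDl// mulr_ge0 ?sqr_ge0// ltW.
near=> m.
have em := e0 m.
have e1 : (e_ m <= 1)%R by near: m; exact: near_small.
have e2 : (e_ m <= delta / (2 * rad0 y))%R.
  by near: m; apply: near_small; rewrite divr_gt0// mulr_gt0.
have e3 : (e_ m <= eps / (2 * C))%R.
  by near: m; apply: near_small; rewrite divr_gt0// mulr_gt0.
have e4 : (rad0 y * e_ m <= r_ m)%R by near: m; exact: rcvg.
have e2' : (e_ m * (2 * rad0 y) <= delta)%R by rewrite -ler_pdivlMr// mulr_gt0.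
have shift (z : V) : (forall j, `|z ord0 j| <= 2 * rad0 y)%R -> shift_dist kappa (e_ m *: z) <= eta%:E.
  move=> hz; apply: hdelta => j; rewrite mxE normrM gtr0_norm//.
  by apply: le_trans e2'; rewrite ler_pM2l.
rewrite -lee_fin distrC.
apply: (le_trans (abs_integral_diff (m := mu) (mz m) ml _ _ _ _)).
- by move=> x; exact: zoom_integrand_ge0.
- by move=> x; exact: limit_integrand_ge0.
- by rewrite fineK.
- by rewrite fineK.
apply: (le_trans (zoom_error em (qe m) hy (r := r_ m) (eta := eta) _ _ _ _)).
- by rewrite mulrC.
- exact: ltW.
- by move=> i; apply: shift => j; exact: coord_le_rad0.
- move=> z; rewrite /closed_eball/= => hz; apply: shift => j.
  move: hz (coord_center0_le j hy); move: (ccenter _) => c hz hc.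
  have := le_trans (coord_le_enorm _ j) hz; rewrite !mxE; move: hc.
  rewrite !ler_norml => /andP[c1 c2] /andP[z1 z2]; apply/andP; split; lra.
rewrite lee_fin -/om -/vol.
have eN : (e_ m ^+ N <= e_ m)%R by apply: ler_iXnr => //; [exact: (gd_N gd)|exact: ltW].
have h1 : (M ^+ k * (M * vol) ^+ 2 * e_ m ^+ N <= eps / 2)%R.
  apply: (@le_trans _ _ (C * e_ m)%R).
    apply: ler_pM => //; [by rewrite mulr_ge0 ?sqr_ge0// ltW|by rewrite exprn_ge0// ltW|].
    by rewrite /C lerDl.
  have -> : (eps / 2 = C * (eps / (2 * C)))%R by field; rewrite gt_eqF.
  by rewrite ler_pM2l.
have h2 : ((M ^+ k * (M * k%:R) + M ^+ k * (M * vol)) * eta <= eps / 2)%R.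
  have -> : (eps / 2 = K * eta)%R by rewrite /eta; field; rewrite gt_eqF.
  by rewrite ler_pM2r// /K lerDl.
rewrite (_ : (_ + _)%R = (M ^+ k * (M * k%:R) + M ^+ k * (M * vol)) * eta +
   M ^+ k * (M * vol) ^+ 2 * e_ m ^+ N)%R; last by ring.
lra.
Unshelve. all: by end_near.
Qed.

(** Here [e_ m ^+ N] is the volume per point, and the radii up to [r_ m] eventually include any
multiple of the typical scale [e_ m]. For fixed [y] the integrands converge in L1, and dominated
convergence applies in [y]. *)
Lemma expected_weight_cvg :
  (((e_ m ^+ N) ^+ k)^-1)%:E * expected_weight (r_ m) (q_ m) @[m --> \oo] -->
  \int[power_measure (lebesgue_row N) k]_y (inside0 y * expR (- om * rad0 y ^+ N))%:E.
Proof.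
rewrite -limit_integral.
pose f m (y : k.-tuple V) := \int[mu]_x (zoom_integrand (r_ m) (q_ m) (e_ m) x y)%:E.
have -> : (fun m => (((e_ m ^+ N) ^+ k)^-1)%:E * expected_weight (r_ m) (q_ m)) =
    (fun m => \int[power_measure (lebesgue_row N) k]_y f m y).
  apply/funext => m; rewrite (expected_weight_zoom _ _ (e0 m)) muleA -EFinM mulVf ?mul1e//.
  by rewrite !expf_neq0// gt_eqF.
pose g (y : k.-tuple V) := (M ^+ k * (inside0 y * expR (- low_const kappa L m0 * rad0 y ^+ N)))%:E.
have mf m : measurable_fun [set: k.-tuple V] (f m).
  apply: (measurable_fun_fubini_tonelli_G (m1 := mu) (fun p : V * k.-tuple V =>
    (zoom_integrand (r_ m) (q_ m) (e_ m) p.1 p.2)%:E)).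
    by apply/measurable_EFinP; exact: measurable_zoom_integrand.
  by move=> p; rewrite lee_fin zoom_integrand_ge0.
have ml : measurable_fun [set: k.-tuple V] (fun y => \int[mu]_x (limit_integrand x y)%:E).
  apply: (measurable_fun_fubini_tonelli_G (m1 := mu) (fun p : V * k.-tuple V =>
    (limit_integrand p.1 p.2)%:E)).
    by apply/measurable_EFinP; exact: measurable_limit_integrand.
  by move=> p; rewrite lee_fin limit_integrand_ge0.
have mg : measurable_fun [set: k.-tuple V]
    (fun y => (inside0 y * expR (- low_const kappa L m0 * rad0 y ^+ N))%:E).
  apply/measurable_EFinP; apply: measurable_funM; first exact: measurable_inside0.
  apply: measurableT_comp => //; apply: measurable_funM => //.
  by apply: measurable_funX; exact: measurable_rad0.
have g0 y : 0 <= (inside0 y * expR (- low_const kappa L m0 * rad0 y ^+ N))%:E.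
  by rewrite lee_fin mulr_ge0 ?inside0_ge0 ?expR_ge0.
have ig : (power_measure (lebesgue_row N) k).-integrable setT g.
  apply/integrableP; split.
    rewrite (_ : g = fun y => (M ^+ k)%:E * (inside0 y * expR (- low_const kappa L m0 * rad0 y ^+ N))%:E).
      exact: emeasurable_funM.
    by apply/funext => y; rewrite /g EFinM.
  have Mk0 : 0 <= (M ^+ k)%:E by rewrite lee_fin exprn_ge0// ltW.
  rewrite (eq_integral (fun y => (M ^+ k)%:E *
      (inside0 y * expR (- low_const kappa L m0 * rad0 y ^+ N))%:E)); last first.
    by move=> y _; rewrite gee0_abs /g EFinM// mule_ge0.
  rewrite ge0_integralZl//.
  apply: lte_mul_pinfty; rewrite ?lee_fin ?exprn_ge0 ?ltW//.
  by apply: limit_integrand_lty; [exact: (gd_N gd)| |exact: low_const_gt0 gd].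
have [] := @dominated_convergence _ _ _ (power_measure (lebesgue_row N) k) setT
  measurableT f (fun y => \int[mu]_x (limit_integrand x y)%:E) g mf ml _ ig _.
- by apply: aeW => y _; exact: zoom_cvg.
- apply: aeW => y m _; rewrite gee0_abs.
    exact: zoom_dominated.
  by apply: integral_ge0 => x _; rewrite lee_fin zoom_integrand_ge0.
- by [].
Qed.

End limit.

End rescaled_expectation.

(** * Laws of finite subfamilies *)

Section law.
Context {d : measure_display} {T : measurableType d} {R : realType} {N : nat}.
Local Notation V := 'rV[R]_N.
Variables (P : probability T R) (X : nat -> {RV P >-> V}) (mu : probability V R).
Hypothesis X_indep : mutually_independent X.
Hypothesis X_law : forall i A, measurable A -> P (X i @^-1` A) = mu A.
Local Open Scope ereal_scope.

Definition pts n (s : seq nat) (w : T) : n.-tuple V := [tuple X (nth 0%N s j) w | j < n].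

Lemma tnth_pts n s w j : tnth (pts n s w) j = X (nth 0%N s j) w.
Proof. by rewrite tnth_mktuple. Qed.

Lemma measurable_pts n s : measurable_fun [set: T] (pts n s).
Proof.
apply/measurable_fun_tnthP => i.
rewrite (_ : _ \o _ = X (nth 0%N s i)); first exact: measurable_funPT.
by apply/funext => w /=; rewrite tnth_pts.
Qed.

Definition box n (A : 'I_n -> set V) : set (n.-tuple V) := [set t | forall i, A i (tnth t i)].

Lemma measurable_box n (A : 'I_n -> set V) : (forall i, measurable (A i)) -> measurable (box A).
Proof.
move=> mA; apply: measurable_forall_set => i; rewrite -[X in measurable X]setTI.
exact: measurable_tnth.
Qed.

Lemma pts_box n s (A : 'I_n -> set V) : size s = n -> uniq s -> (forall i, measurable (A i)) ->
  P (pts n s @^-1` box A) = \prod_(i < n) mu (A i).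
Proof.
move=> sn us mA.
(* the event prescribed for [X j], through the position of [j] in [s] *)
pose A' (j : nat) : set V := if insub (index j s) is Some i then A i else setT.
have mA' j : measurable (A' j) by rewrite /A'; case: insubP.
have A'_nth (i : 'I_n) : A' (nth 0%N s i) = A i.
  by rewrite /A' index_uniq ?sn// valK.
have := X_indep [fset j in s]%fset mA'.
have -> : \bigcap_(i in [set` [fset j in s]%fset]) X i @^-1` A' i = pts n s @^-1` box A.
  apply/seteqP; split => w /= h.
    move=> i; rewrite tnth_pts.
    by have := h (nth 0%N s i); rewrite /= inE mem_nth ?sn// => /(_ isT); rewrite A'_nth.
  move=> j /=; rewrite inE => js.
  have ij : (index j s < n)%N by rewrite -sn index_mem.
  by have := h (Ordinal ij); rewrite -A'_nth tnth_pts/= nth_index.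
move=> ->; rewrite (perm_big s)/=; last first.
  by apply: uniq_perm => [||j]; rewrite ?fset_uniq ?inE.
rewrite (big_nth 0%N) sn big_mkord; apply: eq_bigr => i _.
by rewrite A'_nth X_law.
Qed.

(** Both sides agree on boxes, which generate the measurable sets and are stable under
intersection. *)
Lemma pts_law n s B : size s = n -> uniq s -> measurable B ->
  P (pts n s @^-1` B) = power_measure mu n B.
Proof.
move=> sn us mB.
pose G : set (set (n.-tuple V)) :=
  [set B | exists2 A : 'I_n -> set V, (forall i, measurable (A i)) & B = box A].
have GT : G setT.
  by exists (fun=> setT) => //; apply/seteqP; split.
have Gm : G `<=` measurable by move=> _ [A mA ->]; exact: measurable_box.
pose m1 := pushforward P (pts n s).
pose m1' : {measure set (n.-tuple V) -> \bar R} :=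
  measure_function_pushforward__canonical__measure_function_Measure P (@measurable_pts n s).
apply: (g_sigma_algebra_measure_unique G Gm (fun=> setT) _ _ m1' (power_measure mu n)).
- by [].
- by rewrite bigcup_const.
- move=> _ _ [A mA ->] [A' mA' ->]; exists (fun i => A i `&` A' i).
    by move=> i; exact: measurableI.
  apply/seteqP; split=> t; rewrite /box/=; first by move=> [h h'] i; split.
  by move=> h; split => i; have [] := h i.
- by move=> _ [A mA ->]; rewrite [LHS]pts_box//; apply/esym; exact: power_measure_box.
- move=> _; have -> : m1' setT = P setT by []. 
  by rewrite probability_setT ltry.
move: B mB; apply: smallest_sub; first exact: smallest_sigma_algebra.
move=> B /=; rewrite -bigcup_seq/= => -[i _] [A mA <-]; apply: sub_sigma_algebra.
exists (fun j => if j == i then A else setT); first by move=> j; case: ifP.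
rewrite setTI; apply/seteqP; split => t; rewrite /box/=.
  by move=> At j; case: eqP => // ->.
by move=> /(_ i); rewrite eqxx.
Qed.

Lemma integral_pts n s (f : n.-tuple V -> \bar R) : size s = n -> uniq s ->
  measurable_fun [set: n.-tuple V] f -> (forall t, 0 <= f t) ->
  \int[P]_w f (pts n s w) = \int[power_measure mu n]_t f t.
Proof.
move=> sn us mf f0.
pose m1 : {measure set (n.-tuple V) -> \bar R} :=
  measure_function_pushforward__canonical__measure_function_Measure P (@measurable_pts n s).
transitivity (\int[m1]_t f t).
  rewrite (ge0_integral_pushforward (@measurable_pts n s))//.
apply: eq_measure_integral => A mA _; exact: pts_law.
Qed.

Lemma val_pts n s w : size s = n -> tval (pts n s w) = [seq X i w | i <- s].
Proof.
move=> sn; apply: (@eq_from_nth _ 0%R); first by rewrite size_tuple size_map.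
move=> i; rewrite size_tuple => lt_in.
by rewrite -[i]/(val (Ordinal lt_in)) -tnth_nth tnth_pts (nth_map 0%N)// sn.
Qed.

Lemma pts_cat m l s s' w : size s = m -> size s' = l ->
  pts (m + l) (s ++ s') w = [tuple of pts m s w ++ pts l s' w].
Proof.
by move=> sm sl; apply: val_inj; rewrite /= !val_pts ?map_cat// size_cat sm sl.
Qed.

Definition lpart m l (t : (m + l).-tuple V) : m.-tuple V := [tuple tnth t (lshift l j) | j < m].
Definition rpart m l (t : (m + l).-tuple V) : l.-tuple V := [tuple tnth t (rshift m j) | j < l].

Lemma lpart_cat m l (u : m.-tuple V) (v : l.-tuple V) : lpart [tuple of u ++ v] = u.
Proof. by apply: eq_from_tnth => j; rewrite tnth_mktuple tnth_lshift. Qed.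

Lemma rpart_cat m l (u : m.-tuple V) (v : l.-tuple V) : rpart [tuple of u ++ v] = v.
Proof. by apply: eq_from_tnth => j; rewrite tnth_mktuple tnth_rshift. Qed.

Lemma measurable_lpart m l : measurable_fun [set: (m + l).-tuple V] (@lpart m l).
Proof.
apply/measurable_fun_tnthP => i.
rewrite (_ : _ \o _ = (fun t => tnth t (lshift l i))); first exact: measurable_tnth.
by apply/funext => t /=; rewrite tnth_mktuple.
Qed.

Lemma measurable_rpart m l : measurable_fun [set: (m + l).-tuple V] (@rpart m l).
Proof.
apply/measurable_fun_tnthP => i.
rewrite (_ : _ \o _ = (fun t => tnth t (rshift m i))); first exact: measurable_tnth.
by apply/funext => t /=; rewrite tnth_mktuple.
Qed.

Lemma power_measure_split m l (F : m.-tuple V -> l.-tuple V -> \bar R) :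
  measurable_fun [set: m.-tuple V * l.-tuple V] (fun p => F p.1 p.2) ->
  (forall u v, 0 <= F u v) ->
  \int[power_measure mu (m + l)]_t F (lpart t) (rpart t) =
  \int[power_measure mu m]_u \int[power_measure mu l]_v F u v.
Proof.
move=> mF F0; rewrite power_measure_cat//; last first.
  apply: (measurableT_comp mF (g := fun t => (@lpart m l t, @rpart m l t))).
  by apply: measurable_fun_pair; [exact: measurable_lpart|exact: measurable_rpart].
apply: eq_integral => u _; apply: eq_integral => v _.
by rewrite lpart_cat rpart_cat.
Qed.

Lemma integral_pts2 m l s s' (F : m.-tuple V -> l.-tuple V -> \bar R) :
  size s = m -> size s' = l -> uniq (s ++ s') ->
  measurable_fun [set: m.-tuple V * l.-tuple V] (fun p => F p.1 p.2) ->
  (forall u v, 0 <= F u v) ->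
  \int[P]_w F (pts m s w) (pts l s' w) =
  \int[power_measure mu m]_u \int[power_measure mu l]_v F u v.
Proof.
move=> sm sl us mF F0; rewrite -power_measure_split//.
rewrite -(integral_pts (s := s ++ s') (f := fun t => F (lpart t) (rpart t)))//.
- by apply: eq_integral => w _; rewrite pts_cat// lpart_cat rpart_cat.
- by rewrite size_cat sm sl.
- apply: (measurableT_comp mF (g := fun t => (@lpart m l t, @rpart m l t))).
  by apply: measurable_fun_pair; [exact: measurable_lpart|exact: measurable_rpart].
Qed.

(** Given the points with indices in [s], the points with indices in [s'] are independent and each
of them lies in the random set with the same probability. *)
Lemma expectation_avoid m l s s' (g : m.-tuple V -> R) (D : m.-tuple V -> set V) :
  size s = m -> size s' = l -> uniq (s ++ s') ->
  measurable_fun [set: m.-tuple V] g -> (forall x, 0 <= g x)%R ->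
  measurable [set p : m.-tuple V * V | D p.1 p.2] ->
  \int[P]_w (g (pts m s w) * \prod_(i <- s') \1_(D (pts m s w)) (X i w))%:E =
  \int[power_measure mu m]_x (g x * (fine (mu (D x))) ^+ l)%:E.
Proof.
move=> sm sl us mg g0 mD.
pose F (u : m.-tuple V) (v : l.-tuple V) : \bar R :=
  (g u * \prod_(j < l) \1_(D u) (tnth v j))%:E.
have mF : measurable_fun [set: m.-tuple V * l.-tuple V] (fun p => F p.1 p.2).
  apply/measurable_EFinP; apply: measurable_funM.
    exact: (measurableT_comp mg measurable_fst).
  apply: measurable_prod => j _.
  have mh : measurable_fun [set: m.-tuple V * l.-tuple V]
      (fun p : m.-tuple V * l.-tuple V => (p.1, tnth p.2 j)).
    apply: measurable_fun_pair; first exact: measurable_fst.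
    exact: (measurableT_comp (measurable_tnth j) measurable_snd).
  exact: (measurableT_comp (measurable_indic mD) mh).
have F0 u v : 0 <= F u v by rewrite lee_fin mulr_ge0// prodr_ge0.
transitivity (\int[P]_w F (pts m s w) (pts l s' w)).
  apply: eq_integral => w _; rewrite /F (big_nth 0%N) sl big_mkord.
  by under [in RHS]eq_bigr do rewrite tnth_pts.
rewrite integral_pts2//; apply: eq_integral => u _.
have mDu : measurable (D u).
  have -> : D u = xsection [set p | D p.1 p.2] u by rewrite xsectionE.
  exact: measurable_xsection.
have mprod : measurable_fun [set: l.-tuple V]
    (fun v : l.-tuple V => (\prod_(j < l) (\1_(D u) (tnth v j) : R))%:E).
  apply/measurable_EFinP; apply: measurable_prod => j _.
  exact: (measurableT_comp (measurable_indic mDu) (measurable_tnth j)).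
have prod0 (v : l.-tuple V) : 0 <= (\prod_(j < l) (\1_(D u) (tnth v j) : R))%:E.
  by rewrite lee_fin prodr_ge0.
rewrite /F; under eq_integral do rewrite EFinM.
rewrite ge0_integralZl// ?lee_fin//.
rewrite EFinM; congr (_ * _).
under eq_integral do rewrite -prodEFin.
rewrite (power_measure_prod mu (F := fun _ x => (\1_(D u) x)%:E)); last 2 first.
- by move=> i; apply/measurable_EFinP; exact: measurable_indic.
- by move=> i x; rewrite lee_fin.
rewrite (eq_bigr (fun=> (fine (mu (D u)))%:E)); first by rewrite prodEFin prodr_const card_ord.
by move=> i _; rewrite integral_indic// setIT fineK// fin_num_measure.
Qed.

Lemma power_measureT m : power_measure mu m setT = 1.
Proof.
have -> : [set: m.-tuple V] = [set t : m.-tuple V | forall i : 'I_m, [set: V] (tnth t i)].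
  by apply/seteqP; split.
have -> := @power_measure_box _ _ _ mu m (fun=> setT) (fun=> measurableT).
by rewrite big1// => i _; exact: probability_setT.
Qed.

Lemma integral_power_cst m (c : R) : \int[power_measure mu m]_x c%:E = c%:E.
Proof.
have -> : \int[power_measure mu m]_x c%:E = c%:E * power_measure mu m setT by exact: integral_cst.
by rewrite power_measureT mule1.
Qed.

Definition clustered (rho : R) i0 (s : seq nat) : set T :=
  [set w | forall i, i \in s -> forall j, (`|X i w ord0 j - X i0 w ord0 j| <= rho)%R].

Lemma measurable_clustered rho i0 s : measurable (clustered rho i0 s).
Proof.
have -> : clustered rho i0 s = \bigcap_(i in [set` s])
    [set w | forall j, (`|X i w ord0 j - X i0 w ord0 j| <= rho)%R].
  by apply/seteqP; split => w h i si; exact: h.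
apply: fin_bigcap_measurable => [|i _]; first exact: finite_seq.
apply: measurable_forall_set => j; apply: measurable_le_set; apply: measurableT_comp => //.
by apply: measurable_funB; apply: measurable_fun_coord; exact: measurable_funPT.
Qed.

(** Given [X i0], the other points have to fall in a cube around it, whose mass is at most the
bound of the density times its volume. *)
Lemma cluster_probability kappa L M m0 (rho : R) i0 (s : seq nat) :
  good_density mu kappa L M m0 -> uniq (i0 :: s) -> (0 <= rho)%R ->
  P (clustered rho i0 s) <= ((M * (2 * rho) ^+ N) ^+ size s)%:E.
Proof.
move=> gd us rho0.
pose D (x : 1.-tuple V) : set V :=
  [set v | forall j, (`|v ord0 j - tnth x ord0 ord0 j| <= rho)%R].
have mD : measurable [set p : 1.-tuple V * V | D p.1 p.2].
  apply: measurable_forall_set => j; apply: measurable_le_set; apply: measurableT_comp => //.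
  apply: measurable_funB; apply: measurable_fun_coord => //.
  exact: (measurableT_comp (measurable_tnth ord0) measurable_fst).
have M0 : (0 <= M)%R by apply: le_trans (gd_M1 gd).
have E := @expectation_avoid 1 (size s) [:: i0] s (fun=> 1%R) D erefl erefl us.
have -> : P (clustered rho i0 s) = \int[P]_w (\1_(clustered rho i0 s) w)%:E.
  by rewrite integral_indic ?setIT//; exact: measurable_clustered.
rewrite (eq_integral (fun w => (1 * \prod_(i <- s) \1_(D (pts 1 [:: i0] w)) (X i w))%:E)); last first.
  move=> w _; rewrite mul1r; congr (_%:E).
  rewrite indicE; have [] := boolP (w \in clustered rho i0 s).
    rewrite inE => h; rewrite big1_seq// => i /andP[_ si].
    by rewrite indicE mem_set// => j; rewrite tnth_pts; exact: h.
  move=> /negP h; apply/esym/eqP; rewrite prodf_seq_eq0; apply/negPn/negP => /hasPn h'.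
  apply: h; rewrite inE => i si j.
  have := h' _ si; rewrite /= indicE; case: (boolP (X i w \in _)) => [|_]; last by rewrite eqxx.
  by rewrite inE => /(_ j); rewrite tnth_pts.
rewrite E//.
apply: (@le_trans _ _ (\int[power_measure mu 1]_x ((M * (2 * rho) ^+ N) ^+ size s)%:E)).
  apply: ge0_le_integral => //.
  - by move=> x _; rewrite lee_fin mul1r exprn_ge0// fine_ge0.
  - apply/measurable_EFinP; apply: measurable_funM => //; apply: measurable_funX.
    exact: measurable_section_mass.
  - move=> x _; rewrite lee_fin mul1r lerXn2r ?nnegrE ?fine_ge0//.
      by rewrite mulr_ge0// exprn_ge0// mulr_ge0.
    rewrite -lee_fin fineK ?fin_num_measure//; last exact: measurable_cube.
    rewrite EFinM -(lebesgue_row_cube (tnth x ord0) rho0).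
    by apply: (mu_le gd); exact: measurable_cube.
by rewrite integral_power_cst.
Qed.

End law.

(** * First and second moments of the counts *)

Section moments.
Context {d : measure_display} {T : measurableType d} {R : realType} {N k : nat}.
Local Notation V := 'rV[R]_N.
Variables (P : probability T R) (X : nat -> {RV P >-> V}) (mu : probability V R).
Hypothesis X_indep : mutually_independent X.
Hypothesis X_law : forall i A, measurable A -> P (X i @^-1` A) = mu A.
Local Open Scope ereal_scope.

Local Notation pts := (pts X).
Local Notation cfg := (k.+1.-tuple V).

Definition outside (x : cfg) (v : V) : bool := (cradius x < enorm (v - ccenter x))%R.

Definition others (q : nat) (s : seq nat) : seq nat := [seq i <- iota 0 q | i \notin s].

(** When [sel] selects the simplices with interior circumcenter and [q] is the size of the sample,
this is criticality of the simplex with indices [s]. Since [s] is not bounded by [q], vertices and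
obstacles can be taken from samples of different sizes. *)
Definition sparse (sel : cfg -> bool) (q : nat) (s : seq nat) (w : T) : bool :=
  sel (pts k.+1 s w) && all (fun i => outside (pts k.+1 s w) (X i w)) (others q s).

Lemma measurable_outside : measurable_fun [set: cfg * V] (fun p : cfg * V => outside p.1 p.2).
Proof.
apply: measurable_fun_ltr.
  exact: (measurableT_comp measurable_radius measurable_fst).
apply: measurable_enorm; apply: measurable_rowB; first exact: measurable_snd.
exact: (measurableT_comp measurable_center measurable_fst).
Qed.

Lemma measurable_outside_graph : measurable [set p : cfg * V | outside p.1 p.2].
Proof. exact: measurable_bool_set measurable_outside. Qed.

Lemma mu_outside x : fine (mu [set v | outside x v]) = (1 - ball_mass mu x)%R.
Proof.
have -> : [set v | outside x v] = ~` closed_eball (ccenter x) (cradius x).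
  by apply/seteqP; split => v; rewrite /outside /closed_eball/= ltNge => /negP.
rewrite probability_setC; last exact: measurable_closed_eball.
by rewrite -ball_massE.
Qed.

Lemma measurable_sparse sel q s : measurable_fun [set: cfg] sel ->
  measurable_fun [set: T] (sparse sel q s).
Proof.
move=> ms; apply: measurable_and.
  exact: (measurableT_comp ms (@measurable_pts _ _ _ _ _ X k.+1 s)).
elim: (others q s) => [|i t IH] /=; first exact: measurable_cst.
apply: measurable_and => //.
apply: (measurableT_comp measurable_outside (g := fun w => (pts k.+1 s w, X i w))).
apply: measurable_fun_pair; last exact: measurable_funPT.
exact: (@measurable_pts _ _ _ _ _ X k.+1 s).
Qed.

Lemma all_indic (A : pred V) (t : seq nat) w :
  (all (fun i => A (X i w)) t)%:R = (\prod_(i <- t) \1_[set v | A v] (X i w))%R :> R.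
Proof.
elim: t => [|i t IH]; first by rewrite big_nil.
rewrite big_cons -IH /= indicE; have [Ai|nAi] := boolP (A (X i w)).
  by rewrite mem_set// mul1r.
by rewrite memNset ?mul0r//=; exact/negP.
Qed.

Lemma others_uniq q s : uniq s -> uniq (s ++ others q s).
Proof.
move=> us; rewrite cat_uniq us filter_uniq ?iota_uniq// andbT.
by apply/hasPn => i; rewrite mem_filter => /andP[].
Qed.

Lemma size_others_le q s : (size (others q s) <= q)%N.
Proof. by rewrite size_filter (leq_trans (count_size _ _))// size_iota. Qed.

Lemma size_others_ge q s : (q - size s <= size (others q s))%N.
Proof.
rewrite size_filter leq_subLR -[X in (X <= _)%N](size_iota 0 q).
rewrite -(count_predC (fun i => i \in s) (iota 0 q)) leq_add2r -size_filter.
apply: uniq_leq_size; first by rewrite filter_uniq// iota_uniq.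
by move=> i; rewrite mem_filter => /andP[].
Qed.

Lemma expectation_sparse sel q s : measurable_fun [set: cfg] sel ->
  uniq s -> size s = k.+1 ->
  \int[P]_w ((sparse sel q s w)%:R)%:E =
  \int[power_measure mu k.+1]_x ((sel x)%:R * (1 - ball_mass mu x) ^+ size (others q s))%:E.
Proof.
move=> msel us sk.
have := @expectation_avoid _ _ _ _ _ X mu X_indep X_law k.+1 (size (others q s)) s (others q s)
  (fun x => (sel x)%:R) (fun x => [set v | outside x v]) sk erefl (others_uniq q us)
  (measurable_bool_natr msel) (fun=> ler0n _ _) measurable_outside_graph.
under [in X in _ = X -> _]eq_integral do rewrite mu_outside.
move=> <-; apply: eq_integral => w _; congr (_%:E).
by rewrite -all_indic /sparse; case: (sel _); rewrite ?mul1r ?mul0r.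
Qed.

(** Separation of the circumballs by one coordinate. Its negation bounds the distance of the
centers in sup norm, the norm used for clusters. *)
Definition apart (x y : cfg) : bool :=
  ~~ [forall j, `|ccenter x ord0 j - ccenter y ord0 j|%R <= cradius x + cradius y]%R.

Lemma measurable_apart : measurable_fun [set: cfg * cfg] (fun p : cfg * cfg => apart p.1 p.2).
Proof.
apply: measurable_neg; apply: measurable_forall => j.
have mc (f : cfg * cfg -> cfg) : measurable_fun setT f ->
    measurable_fun setT (fun p => ccenter (f p) ord0 j).
  move=> mf; apply: (measurableT_comp (measurable_row_coord j)).
  exact: (measurableT_comp measurable_center mf).
apply: measurable_fun_ler.
  by apply: measurableT_comp => //; apply: measurable_funB; apply: mc.
apply: measurable_funD; first exact: (measurableT_comp measurable_radius measurable_fst).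
exact: (measurableT_comp measurable_radius measurable_snd).
Qed.

(** The balls are disjoint, and [1 - u - v <= (1 - u) * (1 - v)]. *)
Lemma mu_outside_apart x y : apart x y ->
  (fine (mu [set v | outside x v && outside y v]) <=
   (1 - ball_mass mu x) * (1 - ball_mass mu y))%R.
Proof.
move=> xy; pose B (z : cfg) := closed_eball (ccenter z) (cradius z).
have mB z : measurable (B z) by exact: measurable_closed_eball.
have dis : B x `&` B y = set0.
  apply/seteqP; split => // v []; rewrite /B /closed_eball/= => vx vy.
  move/negP: xy; apply; apply/forallP => j.
  have := le_trans (coord_le_enorm _ j) vx; have := le_trans (coord_le_enorm _ j) vy.
  rewrite !mxE; rewrite !ler_norml => /andP[a1 a2] /andP[b1 b2]; apply/andP; split; lra.
have -> : [set v | outside x v && outside y v] = ~` (B x `|` B y).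
  apply/seteqP; split => v; rewrite /outside /B /closed_eball/= !ltNge.
    by move=> /andP[/negP h /negP h'] [].
  by move=> h; apply/andP; split; apply/negP => h'; apply: h; [left|right].
rewrite probability_setC; last exact: measurableU.
rewrite measureU//.
have -> : (mu (B x) + mu (B y) = (ball_mass mu x + ball_mass mu y)%:E)%E.
  by rewrite EFinD !ball_massE.
rewrite /= mulrBl mul1r mulrBr mulr1.
have := mulr_ge0 (ball_mass_ge0 mu x) (ball_mass_ge0 mu y); lra.
Qed.

Definition far_pair r q s s' w : bool :=
  [&& small r (pts k.+1 s w), small r (pts k.+1 s' w), apart (pts k.+1 s w) (pts k.+1 s' w) &
      all (fun i => outside (pts k.+1 s w) (X i w) && outside (pts k.+1 s' w) (X i w))
        (others q (s ++ s'))].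

Local Notation EW := (expected_weight (k := k) mu).

(** For simplices that are apart, the conditional probability that both circumballs are empty is
at most the product of the two; the points of the simplices themselves are not counted among the
obstacles, hence the smaller number of them. *)
Lemma expectation_far r q s s' : uniq (s ++ s') -> size s = k.+1 -> size s' = k.+1 ->
  \int[P]_w ((far_pair r q s s' w)%:R)%:E <=
  EW r (q - (k.+1 + k.+1)) * EW r (q - (k.+1 + k.+1)).
Proof.
move=> us sk sk'; set l := (q - _)%N.
pose g (t : (k.+1 + k.+1).-tuple V) : bool :=
  [&& small r (lpart t), small r (rpart t) & apart (lpart t) (rpart t)].
pose D (t : (k.+1 + k.+1).-tuple V) : set V := [set v | outside (lpart t) v && outside (rpart t) v].
have mg : measurable_fun [set: (k.+1 + k.+1).-tuple V] g.
  apply: measurable_and; first exact: (measurableT_comp (measurable_small r) (@measurable_lpart _ _ _ _)).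
  apply: measurable_and; first exact: (measurableT_comp (measurable_small r) (@measurable_rpart _ _ _ _)).
  apply: (measurableT_comp measurable_apart (g := fun t => (lpart t, rpart t))).
  by apply: measurable_fun_pair; [exact: measurable_lpart|exact: measurable_rpart].
have mD : measurable [set p : (k.+1 + k.+1).-tuple V * V | D p.1 p.2].
  have mo (f : (k.+1 + k.+1).-tuple V -> cfg) : measurable_fun setT f ->
      measurable_fun [set: (k.+1 + k.+1).-tuple V * V] (fun p => outside (f p.1) p.2).
    move=> mf; apply: (measurableT_comp measurable_outside (g := fun p => (f p.1, p.2))).
    apply: measurable_fun_pair; last exact: measurable_snd.
    exact: (measurableT_comp mf measurable_fst).
  apply: measurable_bool_set; apply: measurable_and; apply: mo; first exact: measurable_lpart.
  exact: measurable_rpart.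
have E := @expectation_avoid _ _ _ _ _ X mu X_indep X_law (k.+1 + k.+1) (size (others q (s ++ s')))
  (s ++ s') (others q (s ++ s')) (fun t => (g t)%:R) D _ erefl (others_uniq q us)
  (measurable_bool_natr mg) (fun=> ler0n _ _) mD.
rewrite (eq_integral (fun w => ((g (pts (k.+1 + k.+1) (s ++ s') w))%:R *
   \prod_(i <- others q (s ++ s')) \1_(D (pts (k.+1 + k.+1) (s ++ s') w)) (X i w))%:E)); last first.
  move=> w _; congr (_%:E); rewrite pts_cat// /D lpart_cat rpart_cat.
  rewrite -(all_indic (fun v => outside (pts k.+1 s w) v && outside (pts k.+1 s' w) v)).
  rewrite /far_pair /g lpart_cat rpart_cat.
  by case: (small _ _); case: (small _ _); case: (apart _ _); rewrite ?mul1r ?mul0r.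
rewrite E; last by rewrite size_cat sk sk'.
apply: (@le_trans _ _ (\int[power_measure mu (k.+1 + k.+1)]_t
   (weight mu r l (lpart t) * weight mu r l (rpart t))%:E)).
  apply: ge0_le_integral => //.
  - by move=> t _; rewrite lee_fin mulr_ge0// exprn_ge0// fine_ge0.
  - apply/measurable_EFinP; apply: measurable_funM; first exact: measurable_bool_natr.
    by apply: measurable_funX; exact: measurable_section_mass.
  - apply/measurable_EFinP; apply: measurable_funM; apply: measurableT_comp;
     [exact: measurable_weight|exact: measurable_lpart|exact: measurable_weight|exact: measurable_rpart].
  - move=> t _; rewrite lee_fin /weight.
    rewrite /g; case: (boolP (small r (lpart t))) => [hl|_]; last first.
      by rewrite !mul0r.
    case: (boolP (small r (rpart t))) => [hr|_]; last by rewrite !mul0r mulr0.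
    case: (boolP (apart _ _)) => [hlr|_]; last first.
      by rewrite mul0r !mul1r mulr_ge0// exprn_ge0// subr_ge0 ball_mass_le1.
    rewrite !mul1r -exprMn; have D1 := mu_outside_apart hlr.
    have D0 : (0 <= fine (mu (D t)))%R by exact: fine_ge0.
    apply: (@le_trans _ _ (fine (mu (D t)) ^+ l)%R).
      apply: ler_wiXn2l => //.
        apply: (le_trans D1); apply: mulr_ile1; rewrite ?subr_ge0 ?ball_mass_le1//;
          by rewrite gerBl ball_mass_ge0.
      by have := size_others_ge q (s ++ s'); rewrite size_cat sk sk'.
    by apply: lerXn2r; rewrite ?nnegrE// mulr_ge0// subr_ge0 ball_mass_le1.
have W0 u : 0 <= (weight mu r l u)%:E by rewrite lee_fin weight_ge0.
have mW : measurable_fun [set: cfg] (fun u => (weight mu r l u)%:E).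
  by apply/measurable_EFinP; exact: measurable_weight.
rewrite (power_measure_split mu (F := fun u v => (weight mu r l u * weight mu r l v)%:E)); last 2 first.
- apply/measurable_EFinP; apply: measurable_funM; apply: measurableT_comp;
     [exact: measurable_weight|exact: measurable_fst|exact: measurable_weight|exact: measurable_snd].
- by move=> u v; rewrite lee_fin mulr_ge0 ?weight_ge0.
under eq_integral => u _.
  under eq_integral do rewrite EFinM.
  rewrite ge0_integralZl//.
  over.
by rewrite ge0_integralZr//; exact: integral_ge0.
Qed.

Lemma coord_center_small r s w i j : size s = k.+1 -> i \in s -> small r (pts k.+1 s w) ->
  (`|X i w ord0 j - ccenter (pts k.+1 s w) ord0 j| <= r)%R.
Proof.
move=> sk si /andP[/center_indicator_det d0 xr].
have lt_i : (index i s < k.+1)%N by rewrite -sk index_mem.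
have := enorm_center (Ordinal lt_i) d0; rewrite tnth_pts/= nth_index// => E.
move: E xr; move: (ccenter _) => c <- xr.
by apply: le_trans xr; have := coord_le_enorm (X i w - c) j; rewrite !mxE.
Qed.

(** Vertices are at distance at most [r] from their center, and the centers at distance at most
[2 * r] from each other. *)
Lemma near_cluster r s s' w i0 t : size s = k.+1 -> size s' = k.+1 ->
  i0 \in s ++ s' -> {subset t <= s ++ s'} ->
  small r (pts k.+1 s w) -> small r (pts k.+1 s' w) ->
  (forall j, `|ccenter (pts k.+1 s w) ord0 j - ccenter (pts k.+1 s' w) ord0 j| <= 2 * r)%R ->
  clustered X (4 * r) i0 t w.
Proof.
move=> sk sk' i0s ts sx sx' cc i it j.
have := cc j.
have h (a : nat) : a \in s ++ s' ->
    (`|X a w ord0 j - ccenter (pts k.+1 s w) ord0 j| <= r \/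
     `|X a w ord0 j - ccenter (pts k.+1 s' w) ord0 j| <= r)%R.
  by rewrite mem_cat => /orP[as_|as_]; [left|right]; exact: coord_center_small.
have := h _ (ts _ it); have := h _ i0s.
move: (X i w ord0 j) (X i0 w ord0 j) (ccenter _ ord0 j) (ccenter _ ord0 j) => a b c c'.
rewrite !ler_norml.
move=> [] /andP[b1 b2] [] /andP[a1 a2] /andP[c1 c2]; apply/andP; split; lra.
Qed.

(** Two simplices either have no common vertex and circumballs that are apart, or all their
vertices form a cluster; the exponent is the number of vertices besides the one at its center. *)
Lemma expectation_pair kappa L M m0 r q s s' : good_density mu kappa L M m0 -> (0 <= r)%R ->
  uniq s -> uniq s' -> size s = k.+1 -> size s' = k.+1 ->
  \int[P]_w ((sparse (small r) q s w && sparse (small r) q s' w)%:R)%:E <=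
  EW r (q - (k.+1 + k.+1)) * EW r (q - (k.+1 + k.+1)) +
  ((M * (2 * (4 * r)) ^+ N) ^+ (size (undup (s ++ s'))).-1)%:E.
Proof.
move=> gd r0 us us' sk sk'.
case E : (undup (s ++ s')) => [|i0 t].
  have : head 0%N s \in undup (s ++ s') by rewrite mem_undup mem_cat; case: (s) sk => //= ? ? _; rewrite inE eqxx.
  by rewrite E.
have i0s : i0 \in s ++ s' by rewrite -mem_undup E inE eqxx.
have ts : {subset t <= s ++ s'} by move=> i it; rewrite -mem_undup E inE it orbT.
have uit : uniq (i0 :: t) by rewrite -E undup_uniq.
have r4 : (0 <= 4 * r)%R by rewrite mulr_ge0.
have mcl := measurable_clustered X (4 * r)%R i0 t.
pose far w := uniq (s ++ s') && far_pair r q s s' w.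
have mpts a : measurable_fun setT (pts k.+1 a) by exact: measurable_pts.
have mfar : measurable_fun setT far.
  rewrite /far; case: (uniq _) => /=; last exact: measurable_cst.
  apply: measurable_and; first exact: (measurableT_comp (measurable_small r)).
  apply: measurable_and; first exact: (measurableT_comp (measurable_small r)).
  apply: measurable_and.
    apply: (measurableT_comp measurable_apart (g := fun w => (pts k.+1 s w, pts k.+1 s' w))).
    exact: measurable_fun_pair.
  elim: (others _ _) => [|i o IH] /=; first exact: measurable_cst.
  apply: measurable_and => //; apply: measurable_and.
    apply: (measurableT_comp measurable_outside (g := fun w => (pts k.+1 s w, X i w))).
    by apply: measurable_fun_pair => //; exact: measurable_funPT.
  apply: (measurableT_comp measurable_outside (g := fun w => (pts k.+1 s' w, X i w))).
  by apply: measurable_fun_pair => //; exact: measurable_funPT.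
apply: (@le_trans _ _ (\int[P]_w (((far w)%:R)%:E + (\1_(clustered X (4 * r) i0 t) w)%:E))).
  apply: ge0_le_integral => //.
  - apply/measurable_EFinP; apply: measurable_bool_natr; apply: measurable_and;
      apply: measurable_sparse; exact: measurable_small.
  - apply: emeasurable_funD; apply/measurable_EFinP; first exact: measurable_bool_natr.
    exact: measurable_indic.
  - move=> w _; rewrite -EFinD lee_fin.
    case: (boolP (_ && _)) => [/andP[/andP[sx ax] /andP[sx' ax']]|_]; last by rewrite addr_ge0.
    have [fw|nfw] := boolP (far w); first by rewrite lerDl.
    rewrite indicE mem_set ?lerDr//.
    apply: (near_cluster sk sk') => // j.
    have cs a b := @coord_center_small r a w b j.
    have [us2|nus] := boolP (uniq (s ++ s')); last first.
      have [i si si'] : exists2 i, i \in s & i \in s'.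
        move: nus; rewrite cat_uniq us us' andbT /= negbK => /hasP[i si' si].
        by exists i.
      have := cs _ _ sk si sx; have := cs _ _ sk' si' sx'.
      rewrite !ler_norml => /andP[a1 a2] /andP[b1 b2]; apply/andP; split; lra.
    have nap : ~~ apart (pts k.+1 s w) (pts k.+1 s' w).
      apply/negP => ap; move/negP: nfw; apply.
      rewrite /far us2 /far_pair sx sx' ap /=; apply/allP => i.
      rewrite mem_filter mem_cat negb_or => /andP[/andP[is_ is_'] iq].
      by rewrite (allP ax) ?(allP ax') ?mem_filter ?is_ ?is_'.
    move: nap; rewrite negbK => /forallP/(_ j) /le_trans; apply.
    by move: sx sx' => /andP[_ xr] /andP[_ xr']; lra.
rewrite ge0_integralD//; last 2 first.
- by apply/measurable_EFinP; exact: measurable_bool_natr.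
- by apply/measurable_EFinP; exact: measurable_indic.
apply: leeD; last first.
  rewrite integral_indic// setIT; exact: (cluster_probability X_indep X_law gd).
rewrite /far; case: (boolP (uniq (s ++ s'))) => us2; last first.
  rewrite integral0//; apply: mule_ge0; apply: integral_ge0 => x _; exact: weight_ge0.
exact: expectation_far.
Qed.

End moments.

Lemma second_moment {d} {T : measurableType d} {R : realType} (P : probability T R)
    (f : T -> R) (Q B S : R) : measurable_fun setT f -> (forall w, 0 <= f w <= B) -> 0 <= Q ->
  (Q%:E <= \int[P]_w (f w)%:E)%E -> (\int[P]_w (f w ^+ 2)%:E <= S%:E)%E ->
  (\int[P]_w ((f w - Q) ^+ 2)%:E <= (S - Q ^+ 2)%:E)%E.
Proof.
move=> mf fB Q0 Qf fS.
have mE (g : T -> R) : measurable_fun setT g -> measurable_fun setT (EFin \o g).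
  by move=> mg; exact/measurable_EFinP.
have m1 : measurable_fun setT (fun w => ((f w - Q) ^+ 2)%:E).
  by apply: mE; apply: measurable_funX; exact: measurable_funB.
have m2 : measurable_fun setT (fun w => (f w ^+ 2)%:E).
  by apply: mE; exact: measurable_funX.
have m3 : measurable_fun setT (fun w => (f w)%:E) by exact: mE.
have E : (\int[P]_w ((f w - Q) ^+ 2)%:E + (2 * Q)%:E * \int[P]_w (f w)%:E =
     \int[P]_w (f w ^+ 2)%:E + (Q ^+ 2)%:E)%E.
  have -> : ((Q ^+ 2)%:E = \int[P]_w (Q ^+ 2)%:E)%E.
    by rewrite integral_cst_probability.
  have f0 w : 0 <= f w by have /andP[] := fB w.
  have m4 : measurable_fun setT (fun w => ((2 * Q)%:E * (f w)%:E)%E).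
    by apply: emeasurable_funM => //; exact: measurable_cst.
  have e1 (w : T) : (0 <= ((f w - Q) ^+ 2)%:E)%E by rewrite lee_fin sqr_ge0.
  have e2 (w : T) : (0 <= (f w ^+ 2)%:E)%E by rewrite lee_fin sqr_ge0.
  have e3 (w : T) : (0 <= (f w)%:E)%E by rewrite lee_fin.
  have e4 (w : T) : (0 <= (Q ^+ 2)%:E :> \bar R)%E by rewrite lee_fin sqr_ge0.
  have e5 (w : T) : (0 <= ((2 * Q)%:E * (f w)%:E) :> \bar R)%E by rewrite mule_ge0// lee_fin mulr_ge0.
  rewrite -ge0_integralZl ?lee_fin ?mulr_ge0// -!ge0_integralD//.
  by apply: eq_integral => w _; rewrite -EFinM -!EFinD; congr (_%:E); ring.
  by move=> w _; exact: (e4 w).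
have ffin : (\int[P]_w (f w)%:E)%E \is a fin_num.
  rewrite ge0_fin_numE; last by apply: integral_ge0 => w _; rewrite lee_fin; have /andP[] := fB w.
  apply: (@le_lt_trans _ _ (\int[P]_w B%:E)%E).
    by apply: ge0_le_integral => // w _; rewrite lee_fin; have /andP[] := fB w.
  by rewrite integral_cst_probability ltry.
move: Qf E; rewrite -(fineK ffin); move: (fine _) => g; rewrite lee_fin => Qg.
rewrite -EFinM => E.
have := leeD2r (Q ^+ 2)%:E fS; rewrite -E -EFinD.
rewrite -leeBrDr// -EFinB => /le_trans; apply; rewrite lee_fin; nra.
Qed.

Section counting.
Context {R : realType}.

(** Expanding the power gives one term for each list of [n] indices, and every set of size [n] is
enumerated by such a list. *)
Lemma sum_prod_subsets_le (I : finType) (c : I -> R) n : (forall i, 0 <= c i) ->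
  \sum_(J : {set I} | #|J| == n) \prod_(i in J) c i <= (\sum_i c i) ^+ n.
Proof.
move=> c0.
have -> : (\sum_i c i) ^+ n = \prod_(j < n) \sum_i c i by rewrite prodr_const card_ord.
rewrite bigA_distr_bigA /=.
rewrite [leRHS](partition_big (fun f : {ffun 'I_n -> I} => [set f j | j : 'I_n]%SET) xpredT)//=.
rewrite [leRHS](bigID (fun J : {set I} => #|J| == n))/=.
apply: ler_wpDr; first by apply: sumr_ge0 => J _; apply: sumr_ge0 => f _; exact: prodr_ge0.
apply: ler_sum => J /eqP Jn.
have [f fJ] : exists f : {ffun 'I_n -> I}, [set f j | j : 'I_n]%SET = J /\ injective f.
  exists [ffun j => enum_val (cast_ord (esym Jn) j)]; split; last first.
    by move=> i j; rewrite !ffunE => /enum_val_inj /cast_ord_inj.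
  apply/setP => x; apply/imsetP/idP => [[j _ ->]|xJ]; first by rewrite ffunE enum_valP.
  exists (cast_ord Jn (enum_rank_in xJ x)) => //.
  by rewrite ffunE cast_ordK enum_rankK_in.
rewrite (bigD1 f)/=; last by rewrite fJ.1.
apply: ler_wpDr; first by apply: sumr_ge0 => g _; exact: prodr_ge0.
by rewrite -fJ.1 big_imset//=; move=> ? ? _ _; exact: fJ.2.
Qed.

Definition idx p (J : {set 'I_p}) : seq nat := map val (enum J).

Lemma idx_uniq p (J : {set 'I_p}) : uniq (idx J).
Proof. by rewrite map_inj_uniq ?enum_uniq//; exact: val_inj. Qed.

Lemma size_idx p (J : {set 'I_p}) : size (idx J) = #|J|.
Proof. by rewrite size_map -cardE. Qed.

Lemma mem_idx p (J : {set 'I_p}) (i : 'I_p) : ((i : nat) \in idx J) = (i \in J).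
Proof. by rewrite mem_map ?mem_enum//; exact: val_inj. Qed.

Lemma size_undup_idx p (J J' : {set 'I_p}) :
  size (undup (idx J ++ idx J')) = (#|J| + #|J' :\: J|)%N.
Proof.
rewrite (perm_size (s2 := idx (J :|: J')%SET)); last first.
  apply: uniq_perm; rewrite ?undup_uniq ?idx_uniq// => i.
  rewrite mem_undup mem_cat; apply/orP/mapP.
    by case=> /mapP[j]; rewrite mem_enum => jJ ->; exists j; rewrite ?mem_enum ?inE ?jJ ?orbT.
  by case=> j; rewrite mem_enum inE => /orP[] jJ ->; [left|right]; rewrite mem_idx.
by rewrite size_idx cardsU cardsD finset.setIC addnBA// subset_leq_card// subsetIl.
Qed.

(** Index sets as increasing lists: unlike sets of ordinals these do not depend on the bound [p],
and families for different bounds can be compared. *)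
Definition combs n p : seq (seq nat) :=
  [seq idx J | J <- enum [pred J : {set 'I_p} | #|J| == n]].

Lemma big_combs {S : Type} (x0 : S) (op : Monoid.com_law x0) n p (F : seq nat -> S) :
  \big[op/x0]_(s <- combs n p) F s = \big[op/x0]_(J : {set 'I_p} | #|J| == n) F (idx J).
Proof. by rewrite big_map big_enum. Qed.

Lemma size_combs n p : size (combs n p) = 'C(p, n).
Proof.
rewrite size_map -cardE -[in RHS](card_ord p) -cardsT -cards_draws; apply: eq_card => J.
by rewrite !inE finset.subsetT.
Qed.

Lemma combs_size n p s : s \in combs n p -> size s = n.
Proof. by case/mapP => J; rewrite mem_enum inE => /eqP <- ->; rewrite size_idx. Qed.

Lemma combs_lists_uniq n p s : s \in combs n p -> uniq s.
Proof. by case/mapP => J _ ->; exact: idx_uniq. Qed.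

(** For fixed [s], the power of [th] is [th ^+ k] times the product over [s'] of weights equal to 1
on [s] and to [th] elsewhere; the total weight is at most [k.+1 + p * th]. *)
Lemma sum_pairs_le p k (th : R) : 0 <= th ->
  \sum_(s <- combs k.+1 p) \sum_(s' <- combs k.+1 p) th ^+ (size (undup (s ++ s'))).-1 <=
  p%:R ^+ k.+1 * (th ^+ k * (k.+1%:R + p%:R * th) ^+ k.+1).
Proof.
move=> th0; rewrite big_combs; under eq_bigr do rewrite big_combs.
have step (J : {set 'I_p}) : #|J| == k.+1 ->
   \sum_(J' : {set 'I_p} | #|J'| == k.+1) th ^+ (size (undup (idx J ++ idx J'))).-1 <=
   th ^+ k * (k.+1%:R + p%:R * th) ^+ k.+1.
  move=> /eqP Jk.
  pose c (i : 'I_p) := if i \in J then 1 else th.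
  have c0 i : 0 <= c i by rewrite /c; case: ifP.
  rewrite (eq_bigr (fun J' : {set 'I_p} => th ^+ k * \prod_(i in J') c i)); last first.
    move=> J' _; rewrite size_undup_idx Jk addSn/= exprD; congr (_ * _).
    rewrite (bigID (mem J))/= big1 ?mul1r; last by move=> i /andP[_ iJ]; rewrite /c iJ.
    rewrite (eq_bigr (fun=> th)); last by move=> i /andP[_ /negbTE iJ]; rewrite /c iJ.
    rewrite prodr_const; congr (_ ^+ _); apply: eq_card => i.
    by rewrite !inE andbC.
  rewrite -mulr_sumr ler_wpM2l ?exprn_ge0//.
  apply: (le_trans (sum_prod_subsets_le k.+1 c0)).
  apply: lerXn2r; rewrite ?nnegrE ?sumr_ge0// ?addr_ge0// ?mulr_ge0//.
  rewrite (bigID (mem J))/=; apply: lerD.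
    rewrite (eq_bigr (fun=> 1)); last by move=> i iJ; rewrite /c iJ.
    by rewrite sumr_const Jk.
  rewrite (eq_bigr (fun=> th)); last by move=> i /negbTE iJ; rewrite /c iJ.
  rewrite sumr_const -[leLHS]mulr_natl ler_wpM2r// ler_nat.
  by rewrite -[leqRHS]card_ord max_card.
apply: (le_trans (ler_sum _ step)).
rewrite sumr_const -[leLHS]mulr_natl ler_wpM2r ?mulr_ge0 ?exprn_ge0 ?addr_ge0 ?mulr_ge0//.
have := sum_prod_subsets_le (I := 'I_p) (c := fun=> 1) k.+1 (fun=> ler01).
rewrite sumr_const card_ord (eq_bigr (fun=> 1)); last by move=> J _; rewrite big1.
by rewrite sumr_const.
Qed.

End counting.

Section count_moments.
Context {d : measure_display} {T : measurableType d} {R : realType} {N k : nat}.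
Local Notation V := 'rV[R]_N.
Variables (P : probability T R) (X : nat -> {RV P >-> V}) (mu : probability V R).
Hypothesis X_indep : mutually_independent X.
Hypothesis X_law : forall i A, measurable A -> P (X i @^-1` A) = mu A.
Variables (kappa : V -> R) (L M m0 : R).
Hypothesis gd : good_density mu kappa L M m0.
Local Open Scope ereal_scope.

Local Notation cfg := (k.+1.-tuple V).
Local Notation EW := (expected_weight (k := k) mu).

Definition num_sparse (sel : cfg -> bool) (p q : nat) (w : T) : nat :=
  (\sum_(s <- combs k.+1 p) sparse X sel q s w)%N.

Lemma countE sel p q w : (num_sparse sel p q w)%:R =
  (\sum_(s <- combs k.+1 p) (sparse X sel q s w)%:R)%R :> R.
Proof. by rewrite /num_sparse natr_sum. Qed.

Lemma measurable_count sel p q : measurable_fun setT sel ->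
  measurable_fun setT (fun w => (num_sparse sel p q w)%:R : R).
Proof.
move=> ms; under eq_fun do rewrite countE.
apply: measurable_sum => s; apply: measurable_bool_natr.
exact: measurable_sparse.
Qed.

Lemma expectation_count sel p q : measurable_fun setT sel ->
  \int[P]_w ((num_sparse sel p q w)%:R)%:E =
  \sum_(s <- combs k.+1 p) \int[P]_w ((sparse X sel q s w)%:R)%:E.
Proof.
move=> ms; under eq_integral do rewrite countE -sumEFin.
rewrite ge0_integral_sum// => s.
by apply/measurable_EFinP; apply: measurable_bool_natr; exact: measurable_sparse.
Qed.

Lemma sum_combs_cst p (a : R) : (\sum_(s <- combs k.+1 p) a = 'C(p, k.+1)%:R * a)%R.
Proof. by rewrite big_const_seq count_predT size_combs -Monoid.iteropE mulr_natl. Qed.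

Lemma EW_fin r q : EW r q \is a fin_num.
Proof.
rewrite ge0_fin_numE; last by apply: integral_ge0 => x _; exact: weight_ge0.
apply: (@le_lt_trans _ _ (\int[power_measure mu k.+1]_x 1%:E)).
  apply: ge0_le_integral => //; last by move=> x _; rewrite lee_fin weight_le1.
  - by move=> x _; exact: weight_ge0.
  - by apply/measurable_EFinP; exact: measurable_weight.
by rewrite integral_power_cst ltry.
Qed.

Definition ew r q : R := fine (EW r q).

Lemma ewE r q : EW r q = (ew r q)%:E.
Proof. by rewrite fineK// EW_fin. Qed.

Lemma ew_ge0 r q : (0 <= ew r q)%R.
Proof. by apply: fine_ge0; apply: integral_ge0 => x _; exact: weight_ge0. Qed.

Lemma expectation_count_ge r p q :
  (('C(p, k.+1))%:R * ew r q)%:E <= \int[P]_w ((num_sparse (small r) p q w)%:R)%:E.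
Proof.
have ms : measurable_fun [set: cfg] (small r) by exact: measurable_small.
rewrite expectation_count//.
rewrite -sum_combs_cst -sumEFin big_seq [leRHS]big_seq; apply: lee_sum => s sc.
rewrite (expectation_sparse X_indep X_law) ?(combs_lists_uniq sc) ?(combs_size sc)// -ewE.
apply: ge0_le_integral => //.
- by move=> x _; exact: weight_ge0.
- by apply/measurable_EFinP; exact: measurable_weight.
- apply/measurable_EFinP; apply: measurable_funM; first exact: measurable_bool_natr.
  by apply: measurable_funX; apply: measurable_funB => //; exact: measurable_ball_mass.
- move=> x _; rewrite lee_fin /weight ler_wpM2l//.
  apply: ler_wiXn2l; rewrite ?subr_ge0 ?ball_mass_le1 ?gerBl ?ball_mass_ge0//.
  exact: size_others_le.
Qed.

Let th r : R := (M * (2 * (4 * r)) ^+ N)%R.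

Lemma expectation_count_sqr r p q : (0 <= r)%R ->
  \int[P]_w ((num_sparse (small r) p q w)%:R ^+ 2)%:E <=
  (('C(p, k.+1)%:R * ew r (q - (k.+1 + k.+1))) ^+ 2 +
   p%:R ^+ k.+1 * (th r ^+ k * (k.+1%:R + p%:R * th r) ^+ k.+1))%:E.
Proof.
move=> r0.
have M0 : (0 <= M)%R by apply: le_trans (gd_M1 gd).
have th0 : (0 <= th r)%R by rewrite mulr_ge0// exprn_ge0// !mulr_ge0.
have ms : measurable_fun [set: cfg] (small r) by exact: measurable_small.
have -> : \int[P]_w ((num_sparse (small r) p q w)%:R ^+ 2)%:E = \int[P]_w
    (\sum_(s <- combs k.+1 p) \sum_(s' <- combs k.+1 p)
     ((sparse X (small (k := k) r) q s w && sparse X (small (k := k) r) q s' w)%:R : R)%:E).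
  apply: eq_integral => w _; rewrite countE expr2 mulr_suml -sumEFin; apply: eq_bigr => s _.
  rewrite mulr_sumr -sumEFin; apply: eq_bigr => s' _.
  by case: (sparse _ _ _ _ _); case: (sparse _ _ _ _ _); rewrite ?mul1r ?mul0r.
have msp s s' : measurable_fun setT (fun w => ((sparse X (small (k := k) r) q s w &&
    sparse X (small (k := k) r) q s' w)%:R : R)%:E).
  apply/measurable_EFinP; apply: measurable_bool_natr.
  by apply: measurable_and; exact: measurable_sparse.
rewrite ge0_integral_sum//; last 2 first.
- by move=> s; exact: emeasurable_sum.
- by move=> s w _; exact: sume_ge0.
apply: (@le_trans _ _ (\sum_(s <- combs k.+1 p) \sum_(s' <- combs k.+1 p)
     ((ew r (q - (k.+1 + k.+1))) ^+ 2 + (th r) ^+ (size (undup (s ++ s'))).-1)%:E)).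
  rewrite big_seq [leRHS]big_seq; apply: lee_sum => s sc.
  rewrite ge0_integral_sum// big_seq [leRHS]big_seq; apply: lee_sum => s' sc'.
  have := expectation_pair (k := k) X_indep X_law q gd r0 (combs_lists_uniq sc) (combs_lists_uniq sc').
  by rewrite (combs_size sc) (combs_size sc') ewE -EFinM -expr2 -EFinD; apply.
under eq_bigr do rewrite sumEFin.
rewrite sumEFin lee_fin.
under eq_bigr do rewrite big_split/=.
rewrite big_split/=; apply: lerD; last exact: sum_pairs_le.
under eq_bigr do rewrite sum_combs_cst.
by rewrite sum_combs_cst exprMn mulrA expr2.
Qed.

(** Each of the [m] additional points is avoided with probability at least [1 - rho]. *)
Lemma ew_shift_le (rho : R) r q m : (forall x : cfg, small r x -> ball_mass mu x <= rho)%R ->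
  (rho <= 1)%R -> ((1 - rho) ^+ m * ew r (q - m) <= ew r q)%R.
Proof.
move=> urho rho1; rewrite -lee_fin EFinM -!ewE.
have r1 : (0 <= 1 - rho)%R by rewrite subr_ge0.
have mW l : measurable_fun [set: cfg] (fun u => (weight mu r l u)%:E).
  by apply/measurable_EFinP; exact: measurable_weight.
have W0 l (u : cfg) : 0 <= (weight mu r l u)%:E by rewrite lee_fin weight_ge0.
rewrite /expected_weight -ge0_integralZl ?lee_fin ?exprn_ge0//.
apply: ge0_le_integral => //.
- by move=> u _; rewrite mule_ge0// lee_fin exprn_ge0.
- by apply: emeasurable_funM => //; exact: measurable_cst.
- move=> u _; rewrite -EFinM lee_fin /weight.
  case: (boolP (small r u)) => [su|_]; last by rewrite !mul0r mulr0.
  rewrite !mul1r; have b1 := ball_mass_le1 mu u; have b0 := ball_mass_ge0 mu u.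
  apply: (@le_trans _ _ ((1 - ball_mass mu u) ^+ m * (1 - ball_mass mu u) ^+ (q - m))%R).
    apply: ler_wpM2r; first by rewrite exprn_ge0// subr_ge0.
    by apply: lerXn2r; rewrite ?nnegrE ?subr_ge0// lerB// urho.
  rewrite -exprD; apply: ler_wiXn2l; rewrite ?subr_ge0// ?gerBl//.
  lia.
Qed.

Lemma small_mass_le r (x : cfg) : (0 < k)%N -> small r x ->
  (ball_mass mu x <= M * (unit_ball_volume N * r ^+ N))%R.
Proof.
move=> k0 /andP[cx xr]; have x0 := radius_gt0 k0 cx.
have M0 : (0 <= M)%R by apply: le_trans (gd_M1 gd).
apply: (le_trans (ball_mass_le gd x0)); apply: ler_wpM2l => //.
apply: ler_wpM2l; first exact: unit_ball_volume_ge0.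
by apply: lerXn2r; rewrite // nnegrE ltW// (lt_le_trans x0 xr).
Qed.

Let rho r : R := (M * (unit_ball_volume N * r ^+ N))%R.

(** Pairs of simplices that are apart contribute the square of the mean, up to a relative error
coming from their [2 * k.+1] vertices, which is of the order of the mass of a small ball. The other
pairs are counted by [sum_pairs_le]. *)
Lemma count_variance r p q : (0 < k)%N -> (0 <= r)%R -> ((4 * k.+1)%:R * rho r <= 1 / 2)%R ->
  \int[P]_w (((num_sparse (small r) p q w)%:R - 'C(p, k.+1)%:R * ew r q) ^+ 2)%:E <=
  (2 * ((4 * k.+1)%:R * rho r) * ('C(p, k.+1)%:R * ew r q) ^+ 2 +
   p%:R ^+ k.+1 * (th r ^+ k * (k.+1%:R + p%:R * th r) ^+ k.+1))%:E.
Proof.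
move=> k0 r0 hrho; have M0 : (0 <= M)%R by apply: le_trans (gd_M1 gd).
have ms : measurable_fun [set: cfg] (small r) by exact: measurable_small.
have := second_moment (measurable_count p q ms) (B := ('C(p, k.+1)%:R)%R) _ _
  (expectation_count_ge r p q) (expectation_count_sqr p q r0).
move=> h; apply: (le_trans (h _ _)).
- move=> w; rewrite ler0n ler_nat /num_sparse -(size_combs k.+1 p) -sum1_size.
  by apply: leq_sum => s _; case: (sparse _ _ _ _ _).
- by rewrite mulr_ge0// ew_ge0.
rewrite lee_fin; set C := ('C(p, k.+1)%:R)%R; set n := (4 * k.+1)%N in hrho *.
have rho0 : (0 <= rho r)%R.
  by rewrite mulr_ge0// mulr_ge0 ?unit_ball_volume_ge0// exprn_ge0.
have n1 : (1 <= n%:R :> R)%R by rewrite ler1n.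
have rho1 : (rho r <= 1)%R by nra.
have := ew_shift_le q (k.+1 + k.+1) (fun x => @small_mass_le r x k0) rho1.
set a := ew r q; set b := ew _ _; set t := ((1 - rho r) ^+ (k.+1 + k.+1))%R => tb.
have t0 : (0 <= t)%R by rewrite exprn_ge0// subr_ge0.
have a0 : (0 <= a)%R by exact: ew_ge0.
have b0 : (0 <= b)%R by exact: ew_ge0.
(* Bernoulli's inequality *)
have bern : (1 - n%:R * rho r <= t ^+ 2)%R.
  rewrite /t -exprM (_ : ((k.+1 + k.+1) * 2)%N = n); last by rewrite addnn -muln2 -mulnA mulnC.
  have h01 : (0 <= 1 - rho r <= 1)%R by rewrite subr_ge0 rho1 gerBl rho0.
  have := @exprB_le _ 1%R (1 - rho r)%R n _ h01; rewrite ler01 lexx opprB addrCA subrr addr0.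
  rewrite expr1n (ger0_norm rho0) => /(_ isT) /ler_normlP[_]; lra.
have sq : (t ^+ 2 * b ^+ 2 <= a ^+ 2)%R.
  by rewrite -exprMn; apply: lerXn2r; rewrite ?nnegrE// mulr_ge0.
set U := (n%:R * rho r)%R in hrho bern *.
have U0 : (0 <= U)%R by rewrite mulr_ge0.
have b2 : (b ^+ 2 <= (1 + 2 * U) * a ^+ 2)%R.
  have : ((1 - U) * b ^+ 2 <= a ^+ 2)%R.
    by apply: le_trans sq; apply: ler_wpM2r => //; exact: sqr_ge0.
  move=> ab; have p1 : (0 <= 1 + 2 * U)%R by lra.
  have p2 : (0 <= U * (1 - 2 * U) * b ^+ 2)%R.
    by rewrite mulr_ge0 ?sqr_ge0// mulr_ge0//; lra.
  have := ler_wpM2l p1 ab; lra.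
rewrite lerBlDr -addrA [leRHS]addrCA [leLHS]addrC lerD2l !exprMn.
have := ler_wpM2l (sqr_ge0 C) b2; lra.
Qed.

End count_moments.

(** * Critical simplices as index lists *)

Section index_lists.

Lemma idx_sorted p (J : {set 'I_p}) : sorted ltn (idx J).
Proof.
apply: (subseq_sorted ltn_trans (s2 := iota 0 p)); last exact: iota_ltn_sorted.
rewrite -val_enum_ord; apply: map_subseq.
have -> : enum J = [seq i <- enum 'I_p | i \in J] by rewrite enumT.
exact: filter_subseq.
Qed.

Lemma mem_combs n p s :
  (s \in combs n p) = [&& sorted ltn s, size s == n & all (fun i => (i < p)%N) s].
Proof.
apply/mapP/and3P => [[J]|[ss sn sp]].
  rewrite mem_enum inE => Jn ->; rewrite idx_sorted size_idx Jn; split => //.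
  by apply/allP => i /mapP[j _ ->]; exact: ltn_ord.
have mJ i : (i \in idx [set i : 'I_p | (i : nat) \in s]%SET) = (i \in s).
  apply/mapP/idP => [[j]|si]; first by rewrite mem_enum inE => ? ->.
  by exists (Ordinal (allP sp _ si)); rewrite // mem_enum inE.
have E : idx [set i : 'I_p | (i : nat) \in s]%SET = s.
  by apply: (irr_sorted_eq ltn_trans ltnn) => //; exact: idx_sorted.
exists [set i : 'I_p | (i : nat) \in s]%SET => //.
by rewrite mem_enum inE -size_idx E.
Qed.

Lemma combs_uniq n p : uniq (combs n p).
Proof.
rewrite map_inj_in_uniq ?enum_uniq// => J J' _ _ E.
by apply/setP => i; rewrite -!mem_idx E.
Qed.

Lemma combs_sub n p p' : (p <= p')%N -> {subset combs n p <= combs n p'}.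
Proof.
move=> pp' s; rewrite !mem_combs => /and3P[-> -> /allP sp] /=.
by apply/allP => i /sp /leq_trans; apply.
Qed.

Lemma sum_bool_count (A : Type) (b : A -> bool) (l : seq A) : (\sum_(s <- l) b s = count b l)%N.
Proof. by rewrite -sum1_count [RHS]big_mkcond; apply: eq_bigr => s _; case: (b s). Qed.

End index_lists.

Section sandwich.
Context {d : measure_display} {T : measurableType d} {R : realType} {N k : nat}.
Local Notation V := 'rV[R]_N.
Variables (P : probability T R) (X : nat -> {RV P >-> V}).
Local Notation cfg := (k.+1.-tuple V).

Lemma count_size (sel : cfg -> bool) p q w :
  num_sparse X sel p q w = size [seq s <- combs k.+1 p | sparse X sel q s w].
Proof. by rewrite /num_sparse sum_bool_count size_filter. Qed.

Lemma sparse_le (sel : cfg -> bool) q q' s w : (q <= q')%N ->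
  sparse X sel q' s w -> sparse X sel q s w.
Proof.
move=> qq' /andP[ss /allP h]; rewrite /sparse ss; apply/allP => i.
rewrite mem_filter mem_iota add0n => /andP[is_ iq]; apply: h.
by rewrite mem_filter is_ mem_iota add0n /= (leq_trans _ qq').
Qed.

Lemma count_le (sel : cfg -> bool) p p' q q' w : (p <= p')%N -> (q' <= q)%N ->
  (num_sparse X sel p q w <= num_sparse X sel p' q' w)%N.
Proof.
move=> pp' qq'; rewrite !count_size; apply: uniq_leq_size.
  by rewrite filter_uniq// combs_uniq.
move=> s; rewrite !mem_filter => /andP[ss sc].
by rewrite (sparse_le qq' ss) (combs_sub pp').
Qed.

Definition central (x : cfg) : bool := center_indicator k (vertices x).

Definition large (r : R) (x : cfg) : bool := central x && (r < cradius x).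

Lemma count_central r p q w :
  num_sparse X central p q w = (num_sparse X (small (k := k) r) p q w + num_sparse X (large r) p q w)%N.
Proof.
rewrite /num_sparse -big_split/=; apply: eq_bigr => s _.
rewrite /sparse /small /large /central; case: (center_indicator _ _) => //=.
by case: leP => _ /=; rewrite ?addn0 ?add0n.
Qed.

Definition pset (s : seq nat) (w : T) : {fset V} := vertices (pts X k.+1 s w).

Lemma psetE s w : size s = k.+1 -> pset s w = [fset v in [seq X i w | i <- s]]%fset.
Proof. by move=> sk; rewrite /pset /vertices /= val_pts. Qed.

Section distinct.
Variables (n : nat) (w : T).
Hypothesis X_inj : {in iota 0 n &, injective (fun i => X i w)}.

Lemma sampleP v : reflect (exists2 i, (i < n)%N & v = X i w) (v \in sample X n w).
Proof.
rewrite /sample; apply: (iffP (imfsetP _ _ _ _)) => /=.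
  by case=> i; rewrite mem_iota add0n => ? ->; exists i.
by case=> i ilt ->; exists i; rewrite // mem_iota.
Qed.

Lemma mem_pset s i : s \in combs k.+1 n -> (i < n)%N -> (X i w \in pset s w) = (i \in s).
Proof.
rewrite mem_combs => /and3P[_ /eqP sk /allP sn] ilt; rewrite psetE// inE /=.
apply/mapP/idP => [[j js]|]; last by exists i.
by move=> /X_inj ->//; rewrite mem_iota// add0n /= sn.
Qed.

(** For an interior simplex, the complex at the value of the circumradius contains it, the
circumcenter being a common point of the balls. *)
Lemma pset_critical s : s \in combs k.+1 n ->
  reflect (critical_simplex k (sample X n w) (pset s w)) (sparse X central n s w).
Proof.
move=> sc; have := sc; rewrite mem_combs => /and3P[_ /eqP sk /allP sn].
have ps i : i \in s -> X i w \in pset s w by move=> si; rewrite mem_pset// sn.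
have inball i : central (pts X k.+1 s w) ->
    circumball (pset s w) (X i w) <-> ~~ outside (pts X k.+1 s w) (X i w).
  by move=> cs; rewrite /pset circumball_vertices// /outside -leNgt.
apply: (iffP andP) => [[cs /allP h]|[_ ck cs h]]; last first.
  split; first by [].
  apply/allP => i; rewrite mem_filter mem_iota add0n => /andP[is_ /= ilt].
  apply/negPn/negP => /(inball _ cs); apply: h.
  by rewrite inE mem_pset// is_; apply/sampleP; exists i.
have /asboolP[card_s _ _] := cs.
split => //.
- exists (cradius (pts X k.+1 s w)); first exact: radius_ge0.
  split.
  + by rewrite -cardfs_gt0 [X in (_ < X)%N]card_s.
  + apply/fsubsetP => v; rewrite psetE// inE /= => /mapP[i si ->].
    by apply/sampleP; exists i => //; exact: sn.
  + exists (ccenter (pts X k.+1 s w)) => v /=.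
    rewrite psetE// inE /= => /mapP[i si ->].
    rewrite /closed_eball/= -enormN opprB.
    have lt_i : (index i s < k.+1)%N by rewrite -sk index_mem.
    have := enorm_center (Ordinal lt_i) (center_indicator_det cs).
    by rewrite tnth_pts/= nth_index// => ->.
- move=> v; rewrite inE => /andP[vs /sampleP[i ilt vE]]; rewrite vE in vs *.
  move=> /(inball _ cs) /negP; apply; apply: h.
  by rewrite mem_filter mem_iota add0n -(mem_pset sc ilt) vs ilt.
Qed.

(** Distinct points are determined by their indices, so that simplices correspond to index lists. *)
Lemma num_criticalE : num_critical k (sample X n w) = num_sparse X central n n w.
Proof.
rewrite count_size /num_critical.
rewrite -(size_map (fun s => pset s w)).
apply: perm_size; apply: uniq_perm; rewrite ?fset_uniq//.
  rewrite map_inj_in_uniq ?filter_uniq ?combs_uniq// => s s'.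
  rewrite !mem_filter => /andP[_ sc] /andP[_ sc'] E.
  have := sc; have := sc'; rewrite !mem_combs => /and3P[ss' _ /allP ls'] /and3P[ss _ /allP ls].
  apply: (irr_sorted_eq ltn_trans ltnn) => // i; apply/idP/idP => si.
    by rewrite -(mem_pset sc' (ls i si)) -E (mem_pset sc (ls i si)).
  by rewrite -(mem_pset sc (ls' i si)) E (mem_pset sc' (ls' i si)).
move=> sigma; rewrite !inE /= fpowersetE.
apply/andP/mapP => [[/fsubsetP sub /asboolP crit]|[s]]; last first.
  rewrite mem_filter => /andP[ss sc] ->; have /(pset_critical sc) crit := ss.
  by have [[t _ [_ ? _]] _ _ _] := crit; split => //; exact/asboolP.
pose s := [seq i <- iota 0 n | X i w \in sigma].
have [_ ck _ _] := crit.
have us : uniq [seq X i w | i <- s].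
  rewrite map_inj_in_uniq ?filter_uniq ?iota_uniq// => i j.
  by rewrite !mem_filter => /andP[_ ni] /andP[_ nj]; exact: X_inj.
have smem v : (v \in [seq X i w | i <- s]) = (v \in sigma).
  apply/mapP/idP => [[i]|vs]; first by rewrite mem_filter => /andP[? _] ->.
  have /sampleP[i ilt vE] := sub _ vs.
  by exists i; rewrite // mem_filter mem_iota add0n /= ilt andbT -vE.
have sk : size s = k.+1.
  rewrite -(size_map (fun i => X i w)) -ck; apply: perm_size; apply: uniq_perm => //.
  exact: fset_uniq.
have sE : sigma = pset s w.
  by apply/fsetP => v; rewrite psetE// inE /= smem.
have sc : s \in combs k.+1 n.
  rewrite mem_combs sk eqxx (sorted_filter ltn_trans) ?iota_ltn_sorted//=.
  by apply/allP => i; rewrite mem_filter mem_iota add0n => /andP[].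
exists s => //; rewrite mem_filter sc andbT.
by apply/(pset_critical sc); rewrite -sE.
Qed.

End distinct.

(** The number of critical simplices is not monotone in the sample, but more vertices give more
candidates and more obstacles give fewer empty balls. With vertices from the smaller sample and
obstacles from the larger one, or conversely, the count becomes a bound for all intermediate
samples. Large circumballs are only dropped from the lower bound. *)
Lemma num_critical_bounds r a n b w : (a <= n)%N -> (n <= b)%N ->
  {in iota 0 b &, injective (fun i => X i w)} ->
  (num_sparse X (small (k := k) r) a b w <= num_critical k (sample X n w) <=
   num_sparse X (small (k := k) r) b a w + num_sparse X (large r) b a w)%N.
Proof.
move=> an nb inj_b.
have inj_n : {in iota 0 n &, injective (fun i => X i w)}.
  move=> i j; rewrite !mem_iota !add0n /= => ilt jlt; apply: inj_b;
    by rewrite mem_iota add0n /= (leq_trans _ nb).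
rewrite num_criticalE//; apply/andP; split; last by rewrite -count_central count_le.
by rewrite (leq_trans _ (count_le _ _ an nb))// (count_central r) leq_addr.
Qed.

End sandwich.

(** * Almost sure convergence *)

Section summable_expectations.
Context {d : measure_display} {T : measurableType d} {R : realType} (P : probability T R).

(** Telescoping, as [(m+1)^-2 <= 2/(m+1) - 2/(m+2)]. *)
Lemma sum_inv_sqr_le n : \sum_(0 <= m < n) (m.+1%:R ^+ 2)^-1 <= 2 - 2 / n.+1%:R :> R.
Proof.
elim: n => [|n IH]; first by rewrite big_geq// divr1 subrr.
rewrite big_nat_recr//=; apply: (le_trans (lerD IH (lexx _))).
have n1 : (0 < n.+1%:R :> R) by rewrite ltr0n.
have n2 : (0 < n.+2%:R :> R) by rewrite ltr0n.
rewrite -subr_ge0.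
have -> : 2 - 2 / n.+2%:R - (2 - 2 / n.+1%:R + (n.+1%:R ^+ 2)^-1) =
   (2 * n.+1%:R * (n.+2%:R - n.+1%:R) - n.+2%:R) / (n.+1%:R ^+ 2 * n.+2%:R) :> R.
  by field; rewrite !gt_eqF.
apply: divr_ge0; last by rewrite mulr_ge0// sqr_ge0.
have e : n.+2%:R = n.+1%:R + 1 :> R by rewrite -natr1.
have : 1 <= n.+1%:R :> R by rewrite ler1n.
rewrite e; lra.
Qed.

(** The sum of the [Z m] has a finite expectation, hence is almost surely finite. *)
Lemma summable_ae_cvg0 (Z : nat -> T -> R) (C : R) :
  (forall m, measurable_fun setT (Z m)) -> (forall m w, 0 <= Z m w) -> 0 <= C ->
  (\forall m \near \oo, (\int[P]_w (Z m w)%:E <= (C * (m.+1%:R ^+ 2)^-1)%:E)%E) ->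
  {ae P, forall w, Z m w @[m --> \oo] --> 0}.
Proof.
move=> mZ Z0 C0 [m0 _ hm0].
pose Z' m w := if (m < m0)%N then 0 else Z m w.
have mZ' m : measurable_fun setT (fun w => (Z' m w)%:E).
  by apply/measurable_EFinP; rewrite /Z'; case: (m < m0)%N.
have Z'0 m w : (0 <= (Z' m w)%:E)%E by rewrite lee_fin /Z'; case: ifP.
have intZ' m : (\int[P]_w (Z' m w)%:E <= (C * (m.+1%:R ^+ 2)^-1)%:E)%E.
  rewrite /Z'; case: ltnP => mm0; last exact: hm0.
  rewrite integral0// lee_fin mulr_ge0// invr_ge0 sqr_ge0.
have sumZ' : (\int[P]_w (\sum_(0 <= m <oo) (Z' m w)%:E) <= (C * 2)%:E)%E.
  rewrite integral_nneseries//; apply: lime_le.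
    by apply: is_cvg_nneseries => m _ _; exact: integral_ge0.
  near=> n; apply: (@le_trans _ _ (\sum_(0 <= m < n) (C * (m.+1%:R ^+ 2)^-1)%:E)%E).
    by apply: lee_sum => m _.
  rewrite sumEFin lee_fin -mulr_sumr ler_wpM2l//.
  by apply: (le_trans (sum_inv_sqr_le n)); rewrite gerBl divr_ge0.
have mS : measurable_fun setT (fun w => \sum_(0 <= m <oo) (Z' m w)%:E)%E.
  by apply: ge0_emeasurable_sum.
have S0 w : (0 <= \sum_(0 <= m <oo) (Z' m w)%:E)%E by exact: nneseries_ge0.
have intS : P.-integrable setT (fun w => \sum_(0 <= m <oo) (Z' m w)%:E)%E.
  apply/integrableP; split => //.
  under eq_integral do rewrite gee0_abs//.
  exact: le_lt_trans sumZ' (ltry _).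
have := integrable_ae measurableT intS.
apply: filterS => w /(_ Logic.I) Sfin.
have /cvg_series_cvg_0 : cvgn (series (Z' ^~ w)).
  apply: nondecreasing_is_cvgn.
    by apply: nondecreasing_series => m _ _; rewrite -lee_fin.
  exists (fine (\sum_(0 <= m <oo) (Z' m w)%:E)%E) => _ [n _ <-].
  rewrite -lee_fin fineK// /series/= -sumEFin.
  by apply: nneseries_lim_ge => m _ _.
apply: cvg_trans; apply: near_eq_cvg.
by exists m0 => // m /= hm; rewrite /Z' ltnNge hm.
Unshelve. all: by end_near.
Qed.

End summable_expectations.

Section interpolation.
Context {R : realType}.

(** Between two stages [a m] and [a m.+1] the sequence is squeezed between values attached to [m]. *)
Lemma interpolation_cvg (a : nat -> nat) (u l h : nat -> R) (g : R) :
  (forall m, (m < a m)%N) -> (a 0%N <= 1)%N ->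
  (forall m n, (a m <= n <= a m.+1)%N -> l m <= u n <= h m) ->
  l @ \oo --> g -> h @ \oo --> g -> u @ \oo --> g.
Proof.
move=> ma a0 lu lg hg; apply/cvgrPdist_le => e e0.
move/cvgrPdist_le : lg => /(_ e e0)[m1 _ h1].
move/cvgrPdist_le : hg => /(_ e e0)[m2 _ h2].
pose m3 := maxn m1 m2.
exists (\max_(i < m3.+1) a i) => // n /= hn.
have n1 : (1 <= n)%N.
  by apply: leq_trans hn; apply: leq_trans (leq_bigmax (F := fun i : 'I_m3.+1 => a i) ord0); exact: ma.
have ex : exists m, (a m <= n)%N by exists 0%N; exact: leq_trans n1.
have bd m : (a m <= n)%N -> (m <= n)%N by move=> am; apply: ltnW; exact: leq_trans (ma m) am.
case: (ex_maxnP ex bd) => m am mmax.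
have am1 : (n <= a m.+1)%N.
  by rewrite leqNgt; apply/negP => /ltnW /mmax; rewrite ltnn.
have m3m : (m3 <= m)%N.
  by apply: mmax; apply: leq_trans hn; exact: (leq_bigmax (F := fun i : 'I_m3.+1 => a i) ord_max).
have := lu m n; rewrite am am1 => /(_ isT) /andP[lm hm].
have := h1 m (leq_trans (leq_maxl _ _) m3m); have := h2 m (leq_trans (leq_maxr _ _) m3m).
rewrite /= !ler_norml => /andP[a1 a2] /andP[b1 b2]; apply/andP; split; lra.
Qed.

End interpolation.

Section rare_events.
Context {d : measure_display} {T : measurableType d} {R : realType} {N k : nat}.
Local Notation V := 'rV[R]_N.
Variables (P : probability T R) (X : nat -> {RV P >-> V}) (mu : probability V R).
Hypothesis X_indep : mutually_independent X.
Hypothesis X_law : forall i A, measurable A -> P (X i @^-1` A) = mu A.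
Variables (kappa : V -> R) (L M m0 : R).
Hypothesis gd : good_density mu kappa L M m0.

(** Two equal points form a cluster of radius 0, an event of probability 0. *)
Lemma ae_distinct : {ae P, forall w, forall b, {in iota 0 b &, injective (fun i => X i w)}}.
Proof.
have pair i j : {ae P, forall w, X i w = X j w -> i = j}.
  have [->|ij] := eqVneq i j; first by apply: aeW.
  have M0 : 0 <= M by apply: le_trans (gd_M1 gd).
  have := @cluster_probability _ _ _ _ P X mu X_indep X_law kappa L M m0 0 i [:: j] gd.
  rewrite /= inE ij mulr0 expr1 expr0n (gtn_eqF (gd_N gd)) mulr0 => /(_ isT (lexx _)).
  rewrite measure_le0 => /eqP P0.
  exists (clustered X 0 i [:: j]); split => //; first exact: measurable_clustered.
  move=> w /= /not_implyP[E _] j'; rewrite inE => /eqP -> l.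
  by rewrite E subrr normr0.
have := ae_foralln (fun i => ae_foralln (pair i)).
apply: filterS => w h b i j _ _; exact: h.
Qed.

Lemma measurable_large r : measurable_fun setT (large (k := k) (N := N) (R := R) r).
Proof.
apply: measurable_and; first exact: measurable_center_indicator.
by apply: measurable_fun_ltr => //; exact: measurable_radius.
Qed.

(** The mass of a large circumball is bounded below, and the number of points inside is binomial. *)
Lemma expectation_large (r : R) p q : 0 <= r ->
  (\int[P]_w ((num_sparse X (large (k := k) r) p q w)%:R)%:E <=
  (p%:R ^+ k.+1 * expR (- (low_const kappa L m0 * r ^+ N * (q - k.+1)%:R)))%:E)%E.
Proof.
move=> r0; have lc0 := low_const_gt0 gd.
have ml : measurable_fun [set: k.+1.-tuple V] (large r) by exact: measurable_large.
set v := low_const kappa L m0 * r ^+ N.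
have v0 : 0 <= v by rewrite mulr_ge0 ?exprn_ge0// ltW.
rewrite expectation_count//.
apply: (@le_trans _ _ (\sum_(s <- combs k.+1 p) (expR (- (v * (q - k.+1)%:R)))%:E)%E); last first.
  rewrite sumEFin lee_fin sum_combs_cst ler_wpM2r ?expR_ge0//.
  have := sum_prod_subsets_le (R := R) (I := 'I_p) (c := fun=> 1) k.+1 (fun=> ler01).
  rewrite sumr_const card_ord (eq_bigr (fun=> 1)); last by move=> J _; rewrite big1.
  by rewrite -(big_combs _ k.+1 p (fun=> 1)) sum_combs_cst mulr1.
rewrite big_seq [leRHS]big_seq; apply: lee_sum => s sc.
rewrite (expectation_sparse X_indep X_law) ?(combs_lists_uniq sc) ?(combs_size sc)//.
have l1 : ((q - k.+1) <= size (others q s))%N by rewrite -(combs_size sc) size_others_ge.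
have mf : measurable_fun [set: k.+1.-tuple V]
    (fun x => ((large r x)%:R * (1 - ball_mass mu x) ^+ size (others q s))%:E).
  apply/measurable_EFinP; apply: measurable_funM; first exact: measurable_bool_natr.
  by apply: measurable_funX; apply: measurable_funB => //; exact: measurable_ball_mass.
apply: (@le_trans _ _ (\int[power_measure mu k.+1]_x (expR (- (v * (q - k.+1)%:R)))%:E)%E); last first.
  by rewrite integral_power_cst.
apply: (le_integral_supp gd) => //.
- by move=> x; rewrite lee_fin mulr_ge0// exprn_ge0// subr_ge0 ball_mass_le1.
move=> x sx; rewrite lee_fin.
have [/andP[cx rx]|_] := boolP (large r x); last by rewrite mul0r expR_ge0.
rewrite mul1r.
have b1 := ball_mass_le1 mu x; have b0 := ball_mass_ge0 mu x.
apply: (@le_trans _ _ ((1 - ball_mass mu x) ^+ (q - k.+1))).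
  by apply: ler_wiXn2l; rewrite ?subr_ge0 ?gerBl.
rewrite -mulNr mulrC expRM_natl.
apply: lerXn2r; rewrite ?nnegrE ?subr_ge0 ?expR_ge0//.
apply: (@le_trans _ _ (expR (- ball_mass mu x))); first exact: expR_ge1Dx.
rewrite ler_expR lerN2; apply: le_trans (ball_mass_ge gd sx cx).
rewrite ler_wpM2l ?(ltW lc0)//; apply: lerXn2r; rewrite ?nnegrE ?radius_ge0//; exact: ltW.
Qed.

End rare_events.

(** The exponential dominates the term of degree [D + 2] of its power series. *)
Lemma exp_decay {R : realType} (c : R) D : 0 < c ->
  exists2 K, 0 <= K & forall t : R, 0 < t -> t ^+ D * expR (- (c * t)) <= K * (t ^+ 2)^-1.
Proof.
move=> c0; exists ((D.+2)`!%:R / c ^+ D.+2); first by rewrite divr_ge0// exprn_ge0// ltW.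
move=> t t0; have t2 : 0 < t ^+ 2 by rewrite exprn_gt0.
have ct : 0 <= c * t by rewrite mulr_ge0// ltW.
have cD : 0 < c ^+ D.+2 by rewrite exprn_gt0.
have f0 : 0 < (D.+2)`!%:R :> R by rewrite ltr0n fact_gt0.
rewrite ler_pdivlMr// ler_pdivlMr// expRN.
have -> : t ^+ D / expR (c * t) * t ^+ 2 * c ^+ D.+2 = (c * t) ^+ D.+2 / expR (c * t).
  have -> : (c * t) ^+ D.+2 = c ^+ D.+2 * (t ^+ D * t ^+ 2).
    by rewrite exprMn -exprD addn2.
  by move: (c ^+ _) (t ^+ D) (t ^+ 2) (expR _)^-1 => u v w x; ring.
have e0 := expR_gt0 (c * t).
rewrite ler_pdivrMr// [leRHS]mulrC -ler_pdivrMr//.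
by apply: le_trans (expR_ge1Dxn D.+1 ct); rewrite lerDr.
Qed.

(** * The law of large numbers along a subsequence *)

(** The unit ball contains the cube of half-side [1/N]. *)
Lemma unit_ball_volume_gt0 {R : realType} N : (0 < N)%N -> 0 < unit_ball_volume N :> R.
Proof.
move=> N0; have N0' : 0 < N%:R :> R by rewrite ltr0n.
have i0 : 0 <= N%:R^-1 :> R by rewrite invr_ge0.
rewrite -lte_fin unit_ball_volumeE.
apply: (@lt_le_trans _ _ (lebesgue_row N
    [set v : 'rV[R]_N | forall i, `|v ord0 i - (0 : 'rV[R]_N) ord0 i| <= N%:R^-1])).
  by rewrite lebesgue_row_cube// lte_fin exprn_gt0// mulr_gt0// invr_gt0.
apply: le_measure; rewrite ?inE.
- exact: measurable_cube.
- exact: measurable_closed_eball.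
- move=> v /= hv; rewrite /closed_eball/=; apply: (le_trans (enorm_le_sum _)).
  apply: (@le_trans _ _ (\sum_(i < N) N%:R^-1)).
    by apply: ler_sum => i _; have := hv i; rewrite !mxE.
  by rewrite sumr_const card_ord -[X in X <= _]mulr_natl mulfV// gt_eqF.
Qed.

Section real_sequences.
Context {R : realType}.

Lemma cvg_expr n (u : nat -> R) (l : R) : u @ \oo --> l -> u m ^+ n @[m --> \oo] --> l ^+ n.
Proof. by move=> ul; apply: (cvg_comp u (fun x => x ^+ n) ul); exact: exprn_continuous. Qed.

(** A falling factorial of fixed length is asymptotic to a power. *)
Lemma cvg_binomial n (p : nat -> nat) : (fun m => ((p m)%:R)^-1 : R) @ \oo --> (0 : R) ->
  (forall m, (0 < p m)%N) ->
  ('C(p m, n)%:R / (p m)%:R ^+ n : R) @[m --> \oo] --> (n`!%:R^-1 : R).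
Proof.
move=> pcvg p0.
have f0 : n`!%:R != 0 :> R by rewrite pnatr_eq0 -lt0n fact_gt0.
rewrite (_ : (fun m => _) = fun m => ((p m) ^_ n)%:R / (p m)%:R ^+ n * n`!%:R^-1 :> R); last first.
  apply/funext => m; rewrite -bin_ffact natrM; field.
  by rewrite f0 expf_neq0// pnatr_eq0 -lt0n p0.
rewrite -[X in _ --> X]mul1r; apply: cvgMl.
elim: n {f0} => [|n IH].
  by rewrite (_ : (fun m => _) = fun=> 1); [exact: cvg_cst|apply/funext => m; rewrite expr0 divr1].
rewrite (_ : (fun m => _) = fun m => ((p m) ^_ n)%:R / (p m)%:R ^+ n *
   ((p m - n)%:R / (p m)%:R)); last first.
  apply/funext => m; rewrite ffactnSr natrM exprSr; field.
  by rewrite expf_neq0// pnatr_eq0 -lt0n p0.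
rewrite -[X in _ --> X]mulr1; apply: cvgM => //.
have nc : (n%:R * (p m)%:R^-1 : R) @[m --> \oo] --> (0 : R).
  by rewrite -[X in _ --> X](mulr0 n%:R); exact: cvgMr.
apply/cvgrPdist_le => e e0; move/cvgrPdist_le : nc => /(_ _ e0); apply: filterS => m.
have pm : 0 < (p m)%:R :> R by rewrite ltr0n.
rewrite sub0r normrN ger0_norm; last by rewrite divr_ge0// ltW.
apply: le_trans.
have [np|pn] := leqP n (p m).
  rewrite natrB// mulrBl mulfV ?gt_eqF// opprB addrC subrK ger0_norm//.
rewrite (_ : (p m - n)%N = 0%N); last by apply/eqP; rewrite subn_eq0 ltnW.
by rewrite mul0r subr0 normr1 ler_pdivlMr// mul1r ler_nat ltnW.
Qed.

(** The contribution of the clustered pairs when there are of order [y^(2k+3)] points and each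
point has another one nearby with probability of order [h/y^(2k+2)]. Relative to the square of the
number of points it is of order [y^-2]. *)
Lemma pair_term_le (p y c h : R) k : 1 <= y -> 0 <= p -> p <= c * y ^+ (2 * k + 3) -> 0 <= h -> 0 <= c ->
  p ^+ k.+1 * ((h / y ^+ (2 * k + 2)) ^+ k * (k.+1%:R + p * (h / y ^+ (2 * k + 2))) ^+ k.+1) <=
  c * (c * h) ^+ k * (k.+1%:R + c * h) ^+ k.+1 * (y ^+ (2 * k + 3)) ^+ 2 * (y ^+ 2)^-1.
Proof.
move=> y1 p0 pc h0 c0; have y0 : 0 < y by lra.
have y0' := ltW y0.
set th := h / _.
have th0 : 0 <= th by rewrite divr_ge0// exprn_ge0// ltW.
have pth : p * th <= c * h * y.
  apply: (le_trans (ler_wpM2r th0 pc)).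
  rewrite /th (_ : (2 * k + 3)%N = (2 * k + 2).+1); last by rewrite addnS.
  rewrite exprS le_eqVlt; apply/orP; left; apply/eqP; field.
  by rewrite expf_neq0// gt_eqF.
have b1 : (p * th) ^+ k <= (c * h * y) ^+ k.
  by apply: lerXn2r => //; rewrite nnegrE; apply: mulr_ge0 => //; exact: mulr_ge0.
have b2 : (k.+1%:R + p * th) ^+ k.+1 <= ((k.+1%:R + c * h) * y) ^+ k.+1.
  have q1 : 0 <= p * th by exact: mulr_ge0.
  have q2 : 0 <= c * h by exact: mulr_ge0.
  apply: lerXn2r; rewrite ?nnegrE; [exact: addr_ge0|apply: mulr_ge0 => //; exact: addr_ge0|].
  have : 0 <= k.+1%:R * (y - 1) by rewrite mulr_ge0// subr_ge0.
  lra.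
rewrite exprS -mulrA [X in _ * X]mulrA -exprMn.
apply: (@le_trans _ _ (c * y ^+ (2 * k + 3) * ((c * h * y) ^+ k * ((k.+1%:R + c * h) * y) ^+ k.+1))).
  apply: ler_pM => //.
    by apply: mulr_ge0; apply: exprn_ge0; [|apply: addr_ge0 => //]; exact: mulr_ge0.
  by apply: ler_pM => //; apply: exprn_ge0; [|apply: addr_ge0 => //]; exact: mulr_ge0.
rewrite ![((_ * y) ^+ _)]exprMn.
have e : y ^+ (2 * k + 3) = y ^+ k * y ^+ k.+1 * y ^+ 2.
  by rewrite -!exprD; congr (_ ^+ _); rewrite mul2n -addnn !addnS !addn0.
rewrite le_eqVlt; apply/orP; left; apply/eqP; rewrite e.
move: (y ^+ k) (y ^+ k.+1) ((c * h) ^+ k) (_ ^+ k.+1) => u v w x; field.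
by rewrite gt_eqF.
Qed.

End real_sequences.

Section subsequence.
Context {d : measure_display} {T : measurableType d} {R : realType} {N k : nat}.
Local Notation V := 'rV[R]_N.
Variables (P : probability T R) (X : nat -> {RV P >-> V}) (mu : probability V R).
Hypothesis X_indep : mutually_independent X.
Hypothesis X_law : forall i A, measurable A -> P (X i @^-1` A) = mu A.
Variables (kappa : V -> R) (L M m0 : R).
Hypothesis gd : good_density mu kappa L M m0.
Hypothesis k0 : (0 < k)%N.

Let N0 : (0 < N)%N := gd_N gd.
Let M0 : 0 <= M. Proof. by apply: le_trans (gd_M1 gd). Qed.

(** The number of points at stage [m]. With [y = (m+1)^N] this is [y^(2k+3)], while a ball of radius
[rstage m] has mass of order [y^-(2k+2)]: small circumballs may contain about [y] points in the
mean, whereas typical critical ones contain a bounded number. The exponents make the variances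
summable, although consecutive stages are asymptotically equal. *)
Definition stage (m : nat) : nat := (m.+1 ^ (N * (2 * k + 3)))%N.
Definition rstage (m : nat) : R := (m.+1%:R ^+ (2 * k + 2))^-1.
Definition estage (m : nat) : R := (m.+1%:R ^+ (2 * k + 3))^-1.

Let t (m : nat) : R := m.+1%:R.
Let y (m : nat) : R := t m ^+ N.
Let t1 m : 1 <= t m. Proof. by rewrite ler1n. Qed.
Let tgt0 m : 0 < t m. Proof. by rewrite ltr0n. Qed.
Let ygt0 m : 0 < y m. Proof. exact: exprn_gt0. Qed.
Let y1 m : 1 <= y m. Proof. exact: exprn_ege1. Qed.
Let ty m : t m <= y m. Proof. exact: ler_eXnr. Qed.

Lemma stage_gt0 m : (0 < stage m)%N. Proof. by rewrite expn_gt0. Qed.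

Lemma stageE m : (stage m)%:R = y m ^+ (2 * k + 3) :> R.
Proof. by rewrite natrX exprM. Qed.

Lemma rstage_gt0 m : 0 < rstage m. Proof. by rewrite invr_gt0 exprn_gt0. Qed.

Lemma rstageN m : rstage m ^+ N = (y m ^+ (2 * k + 2))^-1.
Proof. by rewrite exprVn -!exprM mulnC. Qed.

Lemma ltn_stage m : (m < stage m)%N.
Proof.
apply: (@leq_trans (m.+1 ^ 1)%N); first by rewrite expn1.
by apply: leq_pexp2l => //; rewrite muln_gt0 N0 addn_gt0 orbT.
Qed.

Lemma estage_gt0 m : 0 < estage m. Proof. by rewrite invr_gt0 exprn_gt0. Qed.

Lemma stage_estage m : (stage m)%:R * estage m ^+ N = 1.
Proof.
rewrite natrX exprVn -exprM mulnC mulfV// expf_neq0// gt_eqF//; exact: tgt0.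
Qed.

Lemma inv_t_cvg : (t m)^-1 @[m --> \oo] --> (0 : R).
Proof. exact: cvg_harmonic. Qed.

Lemma estage_cvg : estage m @[m --> \oo] --> (0 : R).
Proof.
have := cvg_expr (n := 2 * k + 3) inv_t_cvg; rewrite expr0n addn_eq0 andbF.
by under eq_fun do rewrite exprVn.
Qed.

Lemma inv_stage_cvg : (stage m)%:R^-1 @[m --> \oo] --> (0 : R).
Proof.
have := cvg_expr (n := N * (2 * k + 3)) inv_t_cvg.
rewrite expr0n muln_eq0 addn_eq0 andbF orbF (gtn_eqF N0).
by under eq_fun do rewrite exprVn -natrX.
Qed.

Lemma estage_rstage (A : R) : \forall m \near \oo, A * estage m <= rstage m.
Proof.
have A1 : 0 < (`|A| + 1)^-1 by rewrite invr_gt0 ltr_wpDl.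
move/cvgrPdist_le : inv_t_cvg => /(_ _ A1); apply: filterS => m.
rewrite sub0r normrN ger0_norm; last by rewrite invr_ge0 ltW.
move=> h; have -> : estage m = (t m)^-1 * rstage m.
  by rewrite /estage /rstage (_ : (2 * k + 3)%N = (2 * k + 2).+1) ?exprS ?invfM// !addnS.
have rs := ltW (rstage_gt0 m).
rewrite mulrA; apply: ler_piMl => //.
apply: (@le_trans _ _ ((`|A| + 1) * (t m)^-1)).
  rewrite ler_wpM2r ?invr_ge0 ?(ltW (tgt0 m))//; apply: (le_trans (ler_norm A)).
  by rewrite lerDl.
by rewrite -ler_pdivlMl ?mulr1// ltr_wpDl.
Qed.

Lemma ratio_cvg : (stage m.+1)%:R / (stage m)%:R @[m --> \oo] --> (1 : R).
Proof.
rewrite (_ : (fun m => _) = fun m => (1 + (t m)^-1) ^+ (N * (2 * k + 3))); last first.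
  apply/funext => m; rewrite !natrX -expr_div_n; congr (_ ^+ _).
  by rewrite -[m.+2%:R]natr1 mulrDl mulfV ?gt_eqF ?tgt0// div1r.
rewrite -[X in _ --> X](expr1n _ (N * (2 * k + 3))) -[X in X ^+ _]addr0; apply: cvg_expr.
by apply: cvgD; [exact: cvg_cst|exact: inv_t_cvg].
Qed.

Definition limit_value : R := fine (\int[power_measure (lebesgue_row N) k]_z
  (inside0 z * expR (- unit_ball_volume N * rad0 z ^+ N))%:E).

Lemma limit_valueE : (\int[power_measure (lebesgue_row N) k]_z
  (inside0 z * expR (- unit_ball_volume N * rad0 z ^+ N))%:E)%E = limit_value%:E.
Proof.
rewrite fineK// ge0_fin_numE; last first.
  by apply: integral_ge0 => z _; rewrite lee_fin mulr_ge0 ?inside0_ge0 ?expR_ge0.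
exact: limit_integrand_lty N0 k0 (unit_ball_volume_gt0 N0).
Qed.

Local Notation ew := (ew (k := k) mu).

Lemma ew_cvg (e_ : nat -> R) (q_ : nat -> nat) :
  (forall m, 0 < e_ m) -> e_ @ \oo --> (0 : R) -> (forall m, (q_ m)%:R * e_ m ^+ N = 1) ->
  (forall A : R, \forall m \near \oo, A * e_ m <= rstage m) ->
  (q_ m)%:R ^+ k * ew (rstage m) (q_ m) @[m --> \oo] --> limit_value.
Proof.
move=> e0 ecvg qe re; have := expected_weight_cvg gd k0 e0 ecvg qe re.
rewrite limit_valueE => /fine_cvgP[_].
apply: cvg_trans; apply: near_eq_cvg; apply: nearW => m /=.
rewrite ewE -EFinM /=; congr (_ * _); rewrite -exprVn; congr (_ ^+ _).
have eN : e_ m ^+ N != 0 by rewrite expf_neq0// gt_eqF.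
by apply: (mulIf eN); rewrite qe mulVf.
Qed.

Lemma ew_stage_cvg :
  (stage m)%:R ^+ k * ew (rstage m) (stage m) @[m --> \oo] --> limit_value.
Proof.
by apply: (ew_cvg estage_gt0 estage_cvg stage_estage); exact: estage_rstage.
Qed.

Lemma ew_stageS_cvg :
  (stage m.+1)%:R ^+ k * ew (rstage m) (stage m.+1) @[m --> \oo] --> limit_value.
Proof.
apply: (ew_cvg (e_ := fun m => estage m.+1) (q_ := fun m => stage m.+1)) => [m||m|A].
- exact: estage_gt0.
- by rewrite (cvg_shiftS estage); exact: estage_cvg.
- exact: stage_estage.
- have := estage_rstage `|A|; apply: filterS => m; apply: le_trans.
  apply: (@le_trans _ _ (`|A| * estage m.+1)).
    by rewrite ler_wpM2r ?ler_norm// ltW// estage_gt0.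
  rewrite ler_wpM2l// lef_pV2 ?posrE ?exprn_gt0//.
  by apply: lerXn2r; rewrite ?nnegrE// ler_nat.
Qed.

Let ga : R := (k.+1)`!%:R^-1 * limit_value.

Lemma mean_lower_cvg : 'C(stage m, k.+1)%:R * ew (rstage m) (stage m.+1) / (stage m)%:R
  @[m --> \oo] --> ga.
Proof.
have ratioV : (((stage m.+1)%:R / (stage m)%:R)^-1) ^+ k @[m --> \oo] --> (1 : R).
  have h := @cvg_expr R k (fun m => ((stage m.+1)%:R / (stage m)%:R)^-1) 1; rewrite expr1n in h.
  apply: h; rewrite -[X in _ --> X]invr1; apply: cvgV; [exact: oner_neq0|exact: ratio_cvg].
have : 'C(stage m, k.+1)%:R / (stage m)%:R ^+ k.+1 * (((stage m.+1)%:R / (stage m)%:R)^-1) ^+ k *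
    ((stage m.+1)%:R ^+ k * ew (rstage m) (stage m.+1)) @[m --> \oo] --> ga.
  rewrite /ga -[_^-1]mulr1; apply: cvgM; last exact: ew_stageS_cvg.
  by apply: cvgM => //; exact: cvg_binomial inv_stage_cvg stage_gt0.
apply: cvg_trans; apply: near_eq_cvg; apply: nearW => m.
rewrite /= exprS invf_div expr_div_n; field.
by rewrite !expf_neq0 ?pnatr_eq0 -?lt0n ?stage_gt0.
Qed.

Lemma mean_upper_cvg : 'C(stage m.+1, k.+1)%:R * ew (rstage m) (stage m) / (stage m)%:R
  @[m --> \oo] --> ga.
Proof.
have invS : (stage m.+1)%:R^-1 @[m --> \oo] --> (0 : R).
  by rewrite (cvg_shiftS (fun m => (stage m)%:R^-1 : R)); exact: inv_stage_cvg.
have ratioX : ((stage m.+1)%:R / (stage m)%:R) ^+ k.+1 @[m --> \oo] --> (1 : R).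
  have h := @cvg_expr R k.+1 (fun m => (stage m.+1)%:R / (stage m)%:R) 1; rewrite expr1n in h.
  by apply: h; exact: ratio_cvg.
have : 'C(stage m.+1, k.+1)%:R / (stage m.+1)%:R ^+ k.+1 * ((stage m.+1)%:R / (stage m)%:R) ^+ k.+1 *
    ((stage m)%:R ^+ k * ew (rstage m) (stage m)) @[m --> \oo] --> ga.
  rewrite /ga -[_^-1]mulr1; apply: cvgM; last exact: ew_stage_cvg.
  by apply: cvgM => //; exact: cvg_binomial invS (fun m => stage_gt0 m.+1).
apply: cvg_trans; apply: near_eq_cvg; apply: nearW => m.
rewrite /= expr_div_n [(stage m)%:R ^+ k.+1]exprS; field.
by rewrite !expf_neq0 ?pnatr_eq0 -?lt0n ?stage_gt0.
Qed.

Let om : R := unit_ball_volume N.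
Let om0 : 0 <= om. Proof. exact: unit_ball_volume_ge0. Qed.

Lemma rstageN_le m : rstage m ^+ N <= (t m ^+ 2)^-1.
Proof.
rewrite rstageN lef_pV2 ?posrE ?exprn_gt0//.
apply: (@le_trans _ _ (y m ^+ 2)); first by apply: lerXn2r; rewrite ?nnegrE// ltW.
by apply: ler_weXn2l => //; rewrite addn2.
Qed.

Lemma near_inv_t (e : R) : 0 < e -> \forall m \near \oo, (t m ^+ 2)^-1 <= e.
Proof.
move=> e0; move/cvgrPdist_le : inv_t_cvg => /(_ _ e0); apply: filterS => m.
rewrite sub0r normrN ger0_norm; last by rewrite invr_ge0 ltW.
apply: le_trans; rewrite lef_pV2 ?posrE ?exprn_gt0//.
exact: ler_eXnr.
Qed.

Local Notation num r p q := (num_sparse X (small (k := k) r) p q).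

(** The variance of the count, relative to the square of the number of points, is of order
[(m+1)^-2] by [count_variance] and [pair_term_le]. *)
Lemma small_lln (p q : nat -> nat) (c : R) : 0 <= c ->
  (forall m, (p m)%:R <= c * (stage m)%:R) ->
  'C(p m, k.+1)%:R * ew (rstage m) (q m) / (stage m)%:R @[m --> \oo] --> ga ->
  {ae P, forall w, (num (rstage m) (p m) (q m) w)%:R / (stage m)%:R @[m --> \oo] --> ga}.
Proof.
move=> c0 pc Qga.
pose Q m := 'C(p m, k.+1)%:R * ew (rstage m) (q m).
pose Z m w := (((num (rstage m) (p m) (q m) w)%:R - Q m) / (stage m)%:R) ^+ 2 : R.
pose n := (4 * k.+1)%N.
pose D : R := `|ga| + 1.
pose h : R := M * 8 ^+ N.
have h0 : 0 <= h by rewrite mulr_ge0// exprn_ge0.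
pose c4 : R := c * (c * h) ^+ k * (k.+1%:R + c * h) ^+ k.+1.
have c40 : 0 <= c4.
  by rewrite mulr_ge0 ?exprn_ge0 ?addr_ge0 ?mulr_ge0 ?exprn_ge0 ?mulr_ge0.
have nMo : 0 <= n%:R * (M * om) :> R by rewrite !mulr_ge0.
have mnum m : measurable_fun setT (fun w => (num (rstage m) (p m) (q m) w)%:R : R).
  by apply: measurable_count; exact: measurable_small.
have mZ m : measurable_fun setT (Z m).
  apply: measurable_funX; apply: measurable_funM; last exact: measurable_cst.
  by apply: measurable_funB.
have : {ae P, forall w, Z m w @[m --> \oo] --> 0}.
  apply: (summable_ae_cvg0 (C := 2 * (n%:R * (M * om)) * D ^+ 2 + c4)) => //.
  - by move=> m w; exact: sqr_ge0.
  - by rewrite addr_ge0// mulr_ge0 ?sqr_ge0// mulr_ge0.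
  have q1 : 0 < (2 * (n%:R * (M * om)) + 1)^-1 by rewrite invr_gt0 ltr_wpDl// mulr_ge0.
  have near1 := near_inv_t q1.
  have near2 : \forall m \near \oo, `|Q m / (stage m)%:R| <= D.
    move/cvgrPdist_le : Qga => /(_ 1 ltr01); apply: filterS => m hm.
    have := ler_normB ga (ga - Q m / (stage m)%:R); rewrite opprB addrCA subrr addr0 => /le_trans; apply.
    by rewrite lerD2l.
  move: near1 near2; apply: filterS2 => m near1 near2.
  have st0 : 0 < (stage m)%:R :> R by rewrite ltr0n stage_gt0.
  have hr : n%:R * (M * (om * rstage m ^+ N)) <= n%:R * (M * om) * (t m ^+ 2)^-1.
    by rewrite !mulrA; apply: ler_wpM2l; rewrite -?mulrA// rstageN_le.
  have hrho : n%:R * (M * (om * rstage m ^+ N)) <= 1 / 2.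
    apply: (le_trans hr); apply: (le_trans (ler_wpM2l nMo near1)).
    move: nMo; set B := (_ * (_ * _)) => B0.
    by rewrite ler_pdivrMr ?ltr_wpDl ?mulr_ge0//; lra.
  have var := count_variance X_indep X_law gd (p m) (q m) k0 (ltW (rstage_gt0 m)) hrho.
  rewrite -/(Q m) in var.
  have -> : (\int[P]_w (Z m w)%:E = (((stage m)%:R ^+ 2)^-1)%:E *
      \int[P]_w (((num (rstage m) (p m) (q m) w)%:R - Q m) ^+ 2)%:E)%E.
    rewrite -ge0_integralZl//.
    - by apply: eq_integral => w _; rewrite -EFinM /Z expr_div_n mulrC.
    - by apply/measurable_EFinP; apply: measurable_funX; exact: measurable_funB.
    - by move=> w _; rewrite lee_fin sqr_ge0.
  have i0 : (0 <= (((stage m)%:R ^+ 2)^-1)%:E :> \bar R)%E by rewrite lee_fin invr_ge0 sqr_ge0.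
  apply: (le_trans (lee_wpmul2l i0 var)).
  rewrite -EFinM lee_fin mulrDr [leRHS]mulrDl; apply: lerD.
    have -> : ((stage m)%:R ^+ 2)^-1 * (2 * (n%:R * (M * (om * rstage m ^+ N))) * Q m ^+ 2) =
       2 * (n%:R * (M * (om * rstage m ^+ N))) * (Q m / (stage m)%:R) ^+ 2.
      by rewrite expr_div_n; ring.
    rewrite -(real_normK (num_real (Q m / (stage m)%:R))).
    have hD : `|Q m / (stage m)%:R| ^+ 2 <= D ^+ 2.
      by apply: lerXn2r; rewrite ?nnegrE ?addr_ge0.
    apply: (@le_trans _ _ (2 * (n%:R * (M * om) * (t m ^+ 2)^-1) * D ^+ 2)).
      apply: ler_pM => //; last by rewrite ler_wpM2l.
      by rewrite mulr_ge0// mulr_ge0// mulr_ge0// mulr_ge0// exprn_ge0// ltW// rstage_gt0.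
    by rewrite le_eqVlt; apply/orP; left; apply/eqP; ring.
  have ym := y1 m.
  have th : M * (2 * (4 * rstage m)) ^+ N = h / y m ^+ (2 * k + 2).
    by rewrite mulrA exprMn rstageN mulrA -natrM.
  rewrite th.
  have p1 : (p m)%:R <= c * y m ^+ (2 * k + 3) by rewrite -stageE.
  have := pair_term_le ym (ler0n _ _) p1 h0 c0; rewrite -stageE -/c4 => pt.
  have s2 : 0 < (stage m)%:R ^+ 2 :> R by rewrite exprn_gt0.
  rewrite mulrC ler_pdivrMr//; apply: (le_trans pt).
  have yt : (y m ^+ 2)^-1 <= (t m ^+ 2)^-1.
    by rewrite lef_pV2 ?posrE ?exprn_gt0//; apply: lerXn2r; rewrite ?nnegrE// ltW.
  apply: (@le_trans _ _ (c4 * (stage m)%:R ^+ 2 * (t m ^+ 2)^-1)).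
    by rewrite ler_wpM2l// mulr_ge0// ltW.
  by rewrite le_eqVlt; apply/orP; left; apply/eqP; ring.
apply: filterS => w Z0.
have dif0 : ((num (rstage m) (p m) (q m) w)%:R - Q m) / (stage m)%:R @[m --> \oo] --> (0 : R).
  apply/cvgrPdist_lt => e e0; have e2 : 0 < e ^+ 2 by rewrite exprn_gt0.
  move/cvgrPdist_lt : Z0 => /(_ _ e2); apply: filterS => m.
  rewrite !sub0r !normrN /Z ger0_norm ?sqr_ge0// -(real_normK (num_real _)).
  by rewrite ltr_pXn2r// ?nnegrE// ltW.
have : ((num (rstage m) (p m) (q m) w)%:R - Q m) / (stage m)%:R + Q m / (stage m)%:R
  @[m --> \oo] --> 0 + ga by exact: cvgD.
rewrite add0r; apply: cvg_trans; apply: near_eq_cvg.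
by apply: nearW => m /=; rewrite mulrBl subrK.
Qed.

(** A large circumball contains in the mean at least a positive multiple of [m] points, and the
probability that it is empty decays exponentially, against a polynomial number of simplices. *)
Lemma large_lln (p : nat -> nat) (c : R) : 0 <= c ->
  (forall m, (p m)%:R <= c * (stage m)%:R) ->
  {ae P, forall w,
    (num_sparse X (large (k := k) (rstage m)) (p m) (stage m) w)%:R / (stage m)%:R @[m --> \oo] --> (0 : R)}.
Proof.
move=> c0 pc; have lc0 := low_const_gt0 gd; set lc := low_const _ _ _ in lc0.
have [K K0 hK] := exp_decay (N * (2 * k + 3) * k.+1) lc0.
apply: (summable_ae_cvg0 (C := c ^+ k.+1 * expR (lc * k.+1%:R) * K)).
- move=> m; apply: measurable_funM; last exact: measurable_cst.
  by apply: measurable_count; exact: measurable_large.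
- by move=> m w; rewrite divr_ge0.
- by rewrite !mulr_ge0 ?exprn_ge0 ?expR_ge0.
apply: nearW => m.
have st0 : 0 < (stage m)%:R :> R by rewrite ltr0n stage_gt0.
have st1 : 1 <= (stage m)%:R :> R by rewrite ler1n stage_gt0.
have ml : measurable_fun setT
    (fun w => ((num_sparse X (large (k := k) (rstage m)) (p m) (stage m) w)%:R : R)%:E).
  by apply/measurable_EFinP; apply: measurable_count; exact: measurable_large.
apply: (@le_trans _ _ (\int[P]_w ((num_sparse X (large (k := k) (rstage m)) (p m) (stage m) w)%:R)%:E)%E).
  apply: ge0_le_integral => //.
  - apply/measurable_EFinP; apply: measurable_funM; last exact: measurable_cst.
    by apply: measurable_count; exact: measurable_large.
  - by move=> w _; rewrite lee_fin ler_pdivrMr// ler_peMr.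
apply: (le_trans (expectation_large X_indep X_law gd _ _ (ltW (rstage_gt0 m)))).
rewrite lee_fin -/lc.
have e1 : - (lc * rstage m ^+ N * (stage m - k.+1)%:R) <= lc * k.+1%:R - lc * t m.
  have h1 : (stage m)%:R - k.+1%:R <= (stage m - k.+1)%:R :> R.
    by rewrite lerBlDr -natrD ler_nat addnC -leq_subLR.
  have rN1 : rstage m ^+ N <= 1.
    by rewrite rstageN invf_le1 ?exprn_gt0// exprn_ege1.
  have rN0 : 0 <= rstage m ^+ N by rewrite exprn_ge0// ltW// rstage_gt0.
  have yE : rstage m ^+ N * (stage m)%:R = y m.
    rewrite rstageN stageE (_ : (2 * k + 3)%N = (2 * k + 2).+1); last by rewrite !addnS.
    by rewrite exprS mulrCA mulVf ?mulr1// expf_neq0// gt_eqF.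
  have := ler_wpM2l rN0 h1; rewrite mulrBr yE => h2.
  have h3 : t m - k.+1%:R <= rstage m ^+ N * (stage m - k.+1)%:R.
    apply: le_trans h2; apply: lerB; first exact: ty.
    by rewrite -[leRHS]mul1r ler_wpM2r.
  have := ler_wpM2l (ltW lc0) h3; lra.
apply: (@le_trans _ _ ((c * (stage m)%:R) ^+ k.+1 * (expR (lc * k.+1%:R) * expR (- (lc * t m))))).
  apply: ler_pM; rewrite ?exprn_ge0 ?expR_ge0//; last by rewrite -expRD ler_expR.
  by apply: lerXn2r; rewrite ?nnegrE ?mulr_ge0.
have := hK _ (tgt0 m).
rewrite exprMn natrX -exprM => hKm.
have q0 : 0 <= c ^+ k.+1 * expR (lc * k.+1%:R) by rewrite mulr_ge0 ?exprn_ge0 ?expR_ge0.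
by rewrite -/(t m) -[leRHS]mulrA mulrACA; exact: ler_wpM2l.
Qed.

Lemma stageS_le m : (stage m.+1)%:R <= 2 ^+ (N * (2 * k + 3)) * (stage m)%:R :> R.
Proof.
rewrite !natrX -exprMn; apply: lerXn2r; rewrite ?nnegrE ?mulr_ge0//.
by rewrite -natrM ler_nat mul2n -addnn addSn ltnS leq_addl.
Qed.

Theorem num_critical_cvg :
  {ae P, forall w, (num_critical k (sample X n w))%:R / n%:R @[n --> \oo] --> ga}.
Proof.
pose c : R := 2 ^+ (N * (2 * k + 3)).
have c0 : 0 <= c by rewrite exprn_ge0.
have c1 : 1 <= c by rewrite exprn_ege1// ler1n.
have le1 m : (stage m)%:R <= c * (stage m)%:R :> R by rewrite ler_peMl.
have low := small_lln c0 le1 mean_lower_cvg.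
have upp := small_lln (p := fun m => stage m.+1) c0 stageS_le mean_upper_cvg.
have lar := large_lln (p := fun m => stage m.+1) c0 stageS_le.
have inj := ae_distinct X_indep X_law gd.
suff main : {ae P, forall w, (forall b, {in iota 0 b &, injective (fun i => X i w)}) ->
    (num_critical k (sample X n w))%:R / n%:R @[n --> \oo] --> ga}.
  by move: inj main; apply: filterS2 => w iw; apply.
move: low upp lar; apply: filterS3 => w low upp lar {}inj.
have stg (m : nat) : 0 < (stage m)%:R :> R by rewrite ltr0n stage_gt0.
have lcv : (num (rstage m) (stage m) (stage m.+1) w)%:R / (stage m)%:R *
    ((stage m.+1)%:R / (stage m)%:R)^-1 @[m --> \oo] --> ga.
  rewrite -[ga]mulr1; apply: cvgM => //; rewrite -[X in _ --> X]invr1.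
  by apply: cvgV; [exact: oner_neq0|exact: ratio_cvg].
have ucv : (num (rstage m) (stage m.+1) (stage m) w)%:R / (stage m)%:R +
    (num_sparse X (large (k := k) (rstage m)) (stage m.+1) (stage m) w)%:R / (stage m)%:R
    @[m --> \oo] --> ga.
  by rewrite -[ga]addr0; exact: cvgD.
apply: (interpolation_cvg (a := stage) ltn_stage _ _ lcv ucv).
  by rewrite /stage exp1n.
move=> m n /andP[mn nm].
have n0 : 0 < n%:R :> R by rewrite ltr0n (leq_trans (stage_gt0 m)).
have /andP[lo up] := num_critical_bounds (k := k) (rstage m) mn nm (inj _).
apply/andP; split.
  rewrite invf_div mulrA divfK ?gt_eqF//.
  apply: ler_pM; rewrite ?invr_ge0// ?ler_nat//.
  by rewrite lef_pV2 ?posrE// ler_nat.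
rewrite -mulrDl -natrD.
apply: ler_pM; rewrite ?invr_ge0 ?(ltW n0)// ?ler_nat//.
by rewrite lef_pV2 ?posrE// ler_nat.
Qed.

End subsequence.

(** * The theorem *)

Lemma simplex_at0_vertices {R : realType} {N k : nat} (y : k.-tuple 'rV[R]_N) :
  simplex_at0 y = vertices (simplex0 y).
Proof.
rewrite /simplex_at0 /vertices; apply/fsetP => v; rewrite in_fset1U.
by rewrite !in_fset /= !inE.
Qed.

Lemma gamma_constE {R : realType} (N k : nat) :
  gamma_const N k = (((k.+1)`!%:R^-1)%:E * \int[power_measure (lebesgue_row N) k]_y
    (inside0 y * expR (- unit_ball_volume N * rad0 y ^+ N))%:E)%E :> \bar R.
Proof.
congr (_ * _)%E; apply: eq_integral => y _; congr (_%:E).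
rewrite simplex_at0_vertices /inside0.
have [h|_] := boolP (center_indicator k _); last by rewrite !mul0r.
by rewrite circumradius_vertices.
Qed.

(** As the infimum of [kappa] over its closed support is positive, [kappa] vanishes nowhere on it:
the set where [kappa] is nonzero is already closed. *)
Lemma density_good {R : realType} {N : nat} (mu : probability 'rV[R]_N R) (kappa : 'rV[R]_N -> R) :
  (0 < N)%N -> measurable_fun setT kappa -> (forall x, 0 <= kappa x) ->
  (forall A, measurable A -> mu A = (\int[lebesgue_row N]_(x in A) (kappa x)%:E)%E) ->
  convex_set (fun_support kappa) -> compact (fun_support kappa) ->
  (0 < ereal_inf [set (kappa x)%:E | x in fun_support kappa])%E ->
  (ereal_sup [set (kappa x)%:E | x in fun_support kappa] < +oo)%E ->
  exists L M m0, good_density mu kappa L M m0.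
Proof.
move=> N0 mk k0 kd conv comp; set I := ereal_inf _; set S := ereal_sup _ => I0 Soo.
have infI x : fun_support kappa x -> (I <= (kappa x)%:E)%E.
  by move=> sx; apply: ereal_inf_lbound; exists x.
have supS x : fun_support kappa x -> ((kappa x)%:E <= S)%E.
  by move=> sx; apply: ereal_sup_ubound; exists x.
have sub x : kappa x != 0 -> fun_support kappa x by move=> kx; exact: subset_closure.
have suppE : [set x | kappa x != 0] = fun_support kappa.
  apply/seteqP; split => x; first exact: sub.
  by move=> /infI Ik /=; rewrite gt_eqF// -lte_fin; exact: lt_le_trans I0 Ik.
have [m0 m00 hm0] : exists2 m0 : R, 0 < m0 & forall x, fun_support kappa x -> m0 <= kappa x.
  case EI : I I0 => [i| |] //= I0; last by exists 1 => // x /infI; rewrite EI.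
  by exists i => // x /infI; rewrite EI lee_fin.
have [M M1 hM] : exists2 M : R, 1 <= M & forall x, fun_support kappa x -> kappa x <= M.
  case ES : S Soo => [s| |] //= Soo; last by exists 1 => // x /supS; rewrite ES.
  exists (Num.max 1 s); first by rewrite le_max lexx.
  by move=> x /supS; rewrite ES lee_fin le_max => ->; rewrite orbT.
have [L L0 hL] : exists2 L : R, 0 < L & forall x, fun_support kappa x -> big_cube L x.
  have [L0 [_ hL0]] := compact_bounded comp.
  exists (`|L0| + 1); first by rewrite ltr_wpDl.
  move=> x sx i; have := hL0 (`|L0| + 1) _ x sx.
  rewrite (le_lt_trans (ler_norm L0)) ?ltrDl// => /(_ isT); apply: le_trans.
  rewrite [leRHS]/Num.Def.normr /= mx_normrE.
  exact: (le_bigmax _ (fun ij => `|x ij.1 ij.2|) (ord0, i)).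
exists L, M, m0; split => //.
- move=> x; have [kx|kx] := eqVneq (kappa x) 0; last exact: hM (sub _ kx).
  by rewrite kx (le_trans ler01).
- by move=> x /sub /hm0.
- by move=> x /sub /hL.
- by rewrite suppE.
Qed.

Unset Implicit Arguments.

Theorem theorem4p1 (R : realType) (N k : nat) (hk : (1 <= k <= N)%N)
    (d : measure_display) (T : measurableType d) (P : probability T R)
    (X : nat -> {RV P >-> 'rV[R]_N}) (kappa : 'rV[R]_N -> R)
    (X_indep : mutually_independent X)
    (X_density : forall n, has_density (X n) kappa)
    (S_convex : convex_set (fun_support kappa))
    (S_compact : compact (fun_support kappa))
    (kappa_inf : (0 < ereal_inf [set (kappa x)%:E | x in fun_support kappa])%E)
    (kappa_sup : (ereal_sup [set (kappa x)%:E | x in fun_support kappa] < +oo)%E) :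
  (gamma_const N k : \bar R) \is a fin_num /\
  {ae P, forall w,
    (num_critical k (sample X n w))%:R / n%:R @[n --> \oo]
      --> fine (gamma_const N k : \bar R)}.
Proof.
have /andP[k0 kN] := hk; have N0 : (0 < N)%N := leq_trans k0 kN.
pose mu : probability 'rV[R]_N R := distribution P (X 0%N).
have [mk kappa0 mudens] := X_density 0%N.
have X_law i A : measurable A -> P (X i @^-1` A) = mu A.
  by move=> mA; have [_ _ di] := X_density i; exact: etrans (di A mA) (esym (mudens A mA)).
have [L [M [m0 gd]]] := density_good N0 mk kappa0 mudens S_convex S_compact kappa_inf kappa_sup.
have E := limit_valueE gd k0.
have gE : gamma_const N k = ((k.+1)`!%:R^-1 * limit_value (R := R) (N := N) (k := k))%:E.
  by rewrite gamma_constE E.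
split; first by rewrite gE.
by rewrite gE; exact: (num_critical_cvg X_indep X_law gd k0).
Qed.
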